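(* Let $f$ be a complex-valued harmonic mapping on $\mathbb{C}$ of finite valence. Let $\Omega_+$ and $\Omega_-$ be distinct connected components of $\mathbb{C}\setminus(f(S)\cup C(f,\infty))$ that share a common non-degenerate boundary arc $\beta_0$, and suppose $\operatorname{int}\beta_0$ does not lie entirely in $C(f,\infty)$. Then there is a non-degenerate subarc $\beta$ of $\beta_0$ that lies outside $C(f,\infty)$ and satisfies $f^{-1}(\beta)\cap(F\cup N)=\varnothing$. Choose $w_0\in\operatorname{int}\beta$ and label the two components so that $\Omega_+$ is the one containing the tangent to $\beta$ at $w_0$. Suppose $w_0$ has $N_0\ge0$ distinct preimages off $S$ and $N_1>0$ distinct preimages in $S$. Then $\mathrm{Val}(f,\Omega_-)=N_0$ and $\mathrm{Val}(f,\Omega_+)=N_0+2N_1$.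
   Context: Finite valence means $\sup_{w\in\mathbb{C}}\mathrm{Val}(f,w)<\infty$, where $\mathrm{Val}(f,w)=\#\{z\in\mathbb{C}:f(z)=w\}$; for a set $\Omega$, $\mathrm{Val}(f,\Omega)=\sup_{w\in\Omega}\mathrm{Val}(f,w)$. Writing $f=u+iv$, $J_f=u_xv_y-u_yv_x$ and $S=\{z: J_f(z)=0\}$. $C(f,\infty)$ is the set of finite $\zeta$ for which there is a sequence $|z_n|\to\infty$ with $f(z_n)\to\zeta$. An arc is non-degenerate if it is not a single point. Write $f=h+\overline{g}$ with $h,g$ entire and $\psi=h'/g'$. The non-folding critical points are $N=\{z\in S:|\psi(z)|\neq1\}$ (at such points $h'=g'=0$); let $\Gamma_f=S\setminus N$. If $z_0\in\Gamma_f$ and $\psi'(z_0)\neq0$, then $z_0$ is interior to a Jordan subarc of $\Gamma_f$ with analytic parametrization $z(t)$, $t\in[0,1]$, $z_0=z(t_0)$, $0<t_0<1$, and a continuous increasing $\phi$ with $\psi(z(t))=\exp(i\phi(t))$; set $\omega(t)=h'(z(t))z'(t)\exp(-i\phi(t)/2)$. Then $z_0\in F_1$ if $\mathrm{Re}\,\omega$ changes sign at $t_0$, and $z_0\in F_2$ if $z_0\notin F_1$ and $h'(z_0)=0$. $F_3$ is the set of $z_0\in\Gamma_f$ with $\psi'(z_0)=0$, and $F=F_1\cup F_2\cup F_3$ (this classification is independent of the choice of arc and parametrization). The image under $f$ of such an arc of $\Gamma_f$ avoiding $F\cup N$ is locally convex, so near $w_0$ the tangent line to $\beta$ at $w_0$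 (apart from $w_0$) lies on one side of $\beta$, i.e. in one of $\Omega_\pm$. *)

(* Defs.v *)
From Stdlib Require Import Reals List Classical ClassicalEpsilon.
From Coquelicot Require Export Coquelicot.
Open Scope R_scope.
Open Scope C_scope.

Definition cderiv (h : C -> C) (z d : C) : Prop :=
  @is_derive C_AbsRing C_NormedModule h z d.

Definition rderiv (z : R -> C) (t : R) (d : C) : Prop :=
  @is_derive R_AbsRing C_R_NormedModule z t d.

Definition entire_with (h dh : C -> C) : Prop := forall z, cderiv h z (dh z).

Definition cis (phi : R) : C := (cos phi, sin phi).

Definition ux (f : C -> C) (z : C) : R := Derive (fun x => fst (f (x, snd z))) (fst z).
Definition uy (f : C -> C) (z : C) : R := Derive (fun y => fst (f (fst z, y))) (snd z).
Definition vx (f : C -> C) (z : C) : R := Derive (fun x => snd (f (x, snd z))) (fst z).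
Definition vy (f : C -> C) (z : C) : R := Derive (fun y => snd (f (fst z, y))) (snd z).
Definition Jac (f : C -> C) (z : C) : R := ux f z * vy f z - uy f z * vx f z.

Definition Sset (f : C -> C) (z : C) : Prop := Jac f z = 0.

Definition image (f : C -> C) (A : C -> Prop) (w : C) : Prop := exists z, A z /\ f z = w.

Definition cluster_inf (f : C -> C) (zeta : C) : Prop :=
  exists zs : nat -> C,
    is_lim_seq (fun n => Cmod (zs n)) p_infty /\
    forall eps, 0 < eps -> exists n0, forall n, (n0 <= n)%nat -> Cmod (f (zs n) - zeta) < eps.

Definition copen (U : C -> Prop) : Prop :=
  forall z, U z -> exists eps, 0 < eps /\ forall w, Cmod (w - z) < eps -> U w.
Definition cclosure (A : C -> Prop) (z : C) : Prop :=
  forall eps, 0 < eps -> exists a, A a /\ Cmod (a - z) < eps.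
Definition cinterior (A : C -> Prop) (z : C) : Prop :=
  exists eps, 0 < eps /\ forall w, Cmod (w - z) < eps -> A w.
Definition cboundary (A : C -> Prop) (z : C) : Prop := cclosure A z /\ ~ cinterior A z.

Definition cconnected (A : C -> Prop) : Prop :=
  ~ exists U V : C -> Prop, copen U /\ copen V /\
      (forall z, A z -> U z \/ V z) /\
      (exists z, A z /\ U z) /\ (exists z, A z /\ V z) /\
      (forall z, A z -> U z -> V z -> False).

Definition is_component (X Om : C -> Prop) : Prop :=
  (exists z, Om z) /\ (forall z, Om z -> X z) /\ cconnected Om /\
  forall A : C -> Prop, cconnected A -> (forall z, Om z -> A z) ->
    (forall z, A z -> X z) -> forall z, A z -> Om z.

Definition arc_param (gam : R -> C) (beta : C -> Prop) : Prop :=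
  (forall t, 0 <= t <= 1 -> forall eps, 0 < eps -> exists del, 0 < del /\
      forall s, 0 <= s <= 1 -> Rabs (s - t) < del -> Cmod (gam s - gam t) < eps) /\
  (forall s t, 0 <= s <= 1 -> 0 <= t <= 1 -> gam s = gam t -> s = t) /\
  (forall w, beta w <-> exists t, 0 <= t <= 1 /\ gam t = w).
Definition is_arc (beta : C -> Prop) : Prop := exists gam, arc_param gam beta.
Definition nondegenerate (beta : C -> Prop) : Prop :=
  exists w1 w2, beta w1 /\ beta w2 /\ w1 <> w2.
Definition arc_int (beta : C -> Prop) (w : C) : Prop :=
  exists gam, arc_param gam beta /\ exists t, 0 < t < 1 /\ gam t = w.

Definition count_eq (P : C -> Prop) (n : nat) : Prop :=
  exists l : list C, NoDup l /\ length l = n /\ forall z, P z <-> In z l.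
Definition val_le (f : C -> C) (w : C) (n : nat) : Prop :=
  forall l : list C, NoDup l -> (forall z, In z l -> f z = w) -> (length l <= n)%nat.
Definition finite_valence (f : C -> C) : Prop := exists M : nat, forall w, val_le f w M.
Definition Val_on_eq (f : C -> C) (Om : C -> Prop) (n : nat) : Prop :=
  (forall w, Om w -> val_le f w n) /\
  exists w, Om w /\ count_eq (fun z => f z = w) n.

(** psi = h'/g' : [psi_value dh dg z0 w] means psi(z0) = w (finite), i.e. the
    meromorphic function h'/g' has the finite value w at z0 (limit over nearby
    points where g' <> 0, such points existing arbitrarily close to z0). *)
Definition psi_value (dh dg : C -> C) (z0 w : C) : Prop :=
  (forall eps, 0 < eps -> exists z, z <> z0 /\ Cmod (z - z0) < eps /\ dg z <> 0) /\
  (forall eps, 0 < eps -> exists del, 0 < del /\ forall z,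
      z <> z0 -> Cmod (z - z0) < del -> dg z <> 0 -> Cmod (dh z / dg z - w) < eps).

(** The function psi near z0, with its (removable-singularity) value w at z0. *)
Definition psi_ext (dh dg : C -> C) (z0 w : C) (z : C) : C :=
  match excluded_middle_informative (z = z0) with
  | left _ => w
  | right _ => dh z / dg z
  end.

(** S, N and Gamma_f; f = h + conj g with h' = dh, g' = dg. *)
Definition Gamma_f (f : C -> C) (dh dg : C -> C) (z : C) : Prop :=
  Sset f z /\ exists w, psi_value dh dg z w /\ Cmod w = 1.
Definition Nset (f : C -> C) (dh dg : C -> C) (z : C) : Prop :=
  Sset f z /\ ~ (exists w, psi_value dh dg z w /\ Cmod w = 1).

Definition psi_deriv (dh dg : C -> C) (z0 d : C) : Prop :=
  exists w, psi_value dh dg z0 w /\ cderiv (psi_ext dh dg z0 w) z0 d.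

Definition ranalytic_at (z : R -> C) (t : R) : Prop :=
  exists r a, 0 < r /\ forall s, Rabs (s - t) < r ->
    @is_series R_AbsRing C_R_NormedModule (fun n => RtoC ((s - t) ^ n)%R * a n) (z s).

Definition changes_sign_at (rw : R -> R) (t0 : R) : Prop :=
  exists del, 0 < del /\ forall s t, t0 - del < s < t0 -> t0 < t < t0 + del ->
    rw s * rw t < 0.

Definition F1set (f : C -> C) (dh dg : C -> C) (z0 : C) : Prop :=
  Gamma_f f dh dg z0 /\ ~ psi_deriv dh dg z0 0 /\
  exists (z dz : R -> C) (phi : R -> R) (t0 : R),
    (forall t, 0 <= t <= 1 -> ranalytic_at z t /\ rderiv z t (dz t)) /\
    arc_param z (fun w => exists t, 0 <= t <= 1 /\ z t = w) /\
    (forall t, 0 <= t <= 1 -> Gamma_f f dh dg (z t)) /\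
    0 < t0 < 1 /\ z t0 = z0 /\
    (forall t, 0 <= t <= 1 -> continuity_pt phi t) /\
    (forall s t, 0 <= s -> s < t -> t <= 1 -> phi s < phi t) /\
    (forall t, 0 <= t <= 1 -> psi_value dh dg (z t) (cis (phi t))) /\
    changes_sign_at (fun t => fst (dh (z t) * dz t * cis (- phi t / 2))) t0.

Definition F2set (f : C -> C) (dh dg : C -> C) (z0 : C) : Prop :=
  Gamma_f f dh dg z0 /\ ~ psi_deriv dh dg z0 0 /\ ~ F1set f dh dg z0 /\ dh z0 = 0.

Definition F3set (f : C -> C) (dh dg : C -> C) (z0 : C) : Prop :=
  Gamma_f f dh dg z0 /\ psi_deriv dh dg z0 0.

Definition Fset (f : C -> C) (dh dg : C -> C) (z : C) : Prop :=
  F1set f dh dg z \/ F2set f dh dg z \/ F3set f dh dg z.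

Definition tangent_dir (beta : C -> Prop) (w0 tau : C) : Prop :=
  tau <> 0 /\ exists gam t0, arc_param gam beta /\ 0 < t0 < 1 /\ gam t0 = w0 /\
    rderiv gam t0 tau.

Definition tangent_side (w0 tau : C) (Om : C -> Prop) : Prop :=
  exists del, 0 < del /\ forall s : R, 0 < Rabs s < del -> Om (w0 + scal s tau).

(* Main.v *)
(* Off the critical set, f is a local homeomorphism and, away from C(f,oo), a proper map, so the
   number of preimages is constant on each component; only the jump across beta has to be found.

   For u <> 0 put Q = u h + conj(u) g and P = u h - conj(u) g, so that Re(u f) = Re Q and
   Im(u f) = Im P. Where Q' <> 0 take zeta = Q(z) as a coordinate: then u f is the shear
   (x, y) |-> (x, Im p(x + i y)) with p = P o Q^(-1) and p'' = 2 |u|^2 (h'' g' - h' g'') / Q'^3.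
   If Im p'' <> 0 at a critical point, v = Im p is strictly convex in y and, being harmonic,
   strictly concave in x (or conversely). Hence vertical lines are folded over the graph of
   m(x) = min_y v(x, y): points above it have two preimages and points below it none; and the graph
   lies strictly below its tangents, so the tangent is on the two-preimage side.

   The arc beta is found in three steps: avoid the images of the zeros of an entire function
   (isolated, by the identity theorem); avoid the images of the critical points with Im p'' = 0
   (a one-dimensional Sard argument on the curves Re(P'/Q') = 0); finally shrink until each of the
   finitely many graphs either contains the arc or misses it. *)
Require Import Defs.
From Stdlib Require Import Reals Ranalysis5 List Lra Lia Classical ClassicalEpsilon.
From Coquelicot Require Import Coquelicot.
Open Scope R_scope.
Open Scope C_scope.

(** * Limits and Caratheodory derivatives *)

(** Several critical points may lie over one value. Their image curves can be matched, and their
    convexity compared, only as graphs over a common axis, so a single [u] has to satisfy the fold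
    condition at all of them.

    On the critical curve Re(P'/Q') = 0, with parameter t = Im(P'/Q'), the velocity of u f is (Re
    E)(1 + i t), where E is the velocity of Q, and Re E vanishes exactly where Im p'' does. The
    critical points that fail the fold condition are thus the singular points of a real plane curve;
    this is why Sard's theorem in one variable is enough. Up to real factors Re E is also the
    Re(omega) that defines F_1: a nonzero value, by continuity, forbids a change of sign, so fold
    points lie outside F_1. Moreover h', g' and psi' do not vanish at critical fold points, which
    disposes of F_2, F_3 and N.

    From complex analysis only two facts are needed: derivatives of entire functions are entire, and
    zeros of an entire function that is not identically zero are isolated. Both come from Cauchy's
    formula on circles about 0, hence from a Goursat theorem that tolerates one exceptional
    point. *)

Definition cnear (z : C) (P : C -> Prop) : Prop :=
  exists d, 0 < d /\ forall w, Cmod (w - z) < d -> P w.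

Global Instance cnear_filter z : Filter (cnear z).
Proof.
  constructor.
  - exists 1%R. split; [lra|auto].
  - intros P Q [d [Hd HP]] [e [He HQ]]. exists (Rmin d e). split.
    + now apply Rmin_glb_lt.
    + intros w Hw. split; [apply HP|apply HQ]; eapply Rlt_le_trans; eauto;
        [apply Rmin_l|apply Rmin_r].
  - intros P Q H [d [Hd HP]]. exists d. split; auto.
Qed.

Lemma cnear_self z P : cnear z P -> P z.
Proof.
  intros [d [Hd H]]. apply H. replace (z - z) with (RtoC 0) by ring.
  now rewrite Cmod_0.
Qed.

Lemma cnear_ball z d : (0 < d)%R -> cnear z (fun w => Cmod (w - z) < d).
Proof. intro H. exists d. auto. Qed.

Lemma cnear_cnear z P : cnear z P -> cnear z (fun w => cnear w P).
Proof.
  intros [d [Hd H]]. exists d. split; auto. intros w Hw.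
  exists (d - Cmod (w - z))%R. split; [lra|]. intros v Hv. apply H.
  replace (v - z) with ((v - w) + (w - z)) by ring.
  eapply Rle_lt_trans; [apply Cmod_triangle|lra].
Qed.

Lemma Cmod_sub_sym a b : Cmod (a - b) = Cmod (b - a).
Proof. rewrite <- Cmod_opp. f_equal. ring. Qed.

Lemma Cmod_sub_triangle a b c : (Cmod (a - c) <= Cmod (a - b) + Cmod (b - c))%R.
Proof. replace (a - c) with ((a - b) + (b - c)) by ring. apply Cmod_triangle. Qed.

Lemma Cmod_rev_triangle a b : (Cmod a - Cmod b <= Cmod (a - b))%R.
Proof.
  assert (H := Cmod_triangle (a - b) b). replace (a - b + b) with a in H by ring. lra.
Qed.

Lemma fst_le_Cmod c : (Rabs (fst c) <= Cmod c)%R.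
Proof. eapply Rle_trans; [apply Rmax_l|apply Rmax_Cmod]. Qed.

Lemma snd_le_Cmod c : (Rabs (snd c) <= Cmod c)%R.
Proof. eapply Rle_trans; [apply Rmax_r|apply Rmax_Cmod]. Qed.

Lemma Cmod_le_sum c : (Cmod c <= Rabs (fst c) + Rabs (snd c))%R.
Proof.
  replace c with (RtoC (fst c) + Ci * RtoC (snd c)) at 1.
  - eapply Rle_trans; [apply Cmod_triangle|].
    rewrite Cmod_mult, Cmod_Ci, !Cmod_R. lra.
  - destruct c; unfold RtoC, Ci, Cplus, Cmult; simpl. f_equal; ring.
Qed.

Lemma Cminus_neq0 (a b : C) : a <> b -> a - b <> 0.
Proof.
  intros H E. apply H. replace a with ((a - b) + b) by ring. rewrite E. ring.
Qed.

Lemma eq_of_Cminus (a b : C) : a - b = 0 -> a = b.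
Proof.
  intro E. replace a with ((a - b) + b) by ring. rewrite E. ring.
Qed.

Lemma locally_R_iff (t : R) (P : R -> Prop) :
  locally t P <-> exists d, (0 < d)%R /\ forall s, (Rabs (s - t) < d)%R -> P s.
Proof.
  split.
  - intros [d H]. exists d. split; [apply cond_pos|]. intros s Hs. now apply H.
  - intros [d [Hd H]]. exists (mkposreal d Hd). intros s Hs. now apply H.
Qed.

(** The filters used below are those of full, not punctured, neighbourhoods, so a limit at a point
    also fixes the value there; the quotient in a Caratheodory derivative takes the derivative as
    its value at the base point. *)
Definition tends {T} (N : (T -> Prop) -> Prop) (phi : T -> C) (l : C) : Prop :=
  forall eps, (0 < eps)%R -> N (fun x => Cmod (phi x - l) < eps).

Lemma tends_near {T} (N : (T -> Prop) -> Prop) {FN : Filter N} phi l P :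
  tends N phi l -> cnear l P -> N (fun x => P (phi x)).
Proof.
  intros H [d [Hd HP]]. eapply filter_imp; [|apply (H d Hd)]. intros x Hx. now apply HP.
Qed.

Lemma tends_const {T} (N : (T -> Prop) -> Prop) {FN : Filter N} c :
  tends N (fun _ => c) c.
Proof.
  intros e He. apply filter_forall. intros _. replace (c - c) with (RtoC 0) by ring.
  now rewrite Cmod_0.
Qed.

Lemma tends_ext {T} (N : (T -> Prop) -> Prop) {FN : Filter N} phi psi l :
  N (fun x => phi x = psi x) -> tends N phi l -> tends N psi l.
Proof.
  intros H H1 e He. eapply filter_imp; [|apply filter_and; [exact H|exact (H1 e He)]].
  intros x [E Hx]. now rewrite <- E.
Qed.

Lemma tends_plus {T} (N : (T -> Prop) -> Prop) {FN : Filter N} phi psi l m :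
  tends N phi l -> tends N psi m -> tends N (fun x => phi x + psi x) (l + m).
Proof.
  intros H1 H2 e He.
  eapply filter_imp; [|apply filter_and; [apply (H1 (e/2)%R)|apply (H2 (e/2)%R)]]; try lra.
  intros x [Ha Hb]. replace (phi x + psi x - (l + m)) with ((phi x - l) + (psi x - m)) by ring.
  eapply Rle_lt_trans; [apply Cmod_triangle|lra].
Qed.

Lemma tends_mult {T} (N : (T -> Prop) -> Prop) {FN : Filter N} phi psi l m :
  tends N phi l -> tends N psi m -> tends N (fun x => phi x * psi x) (l * m).
Proof.
  intros H1 H2 e He.
  assert (Hl := Cmod_ge_0 l). assert (Hm := Cmod_ge_0 m).
  set (k := (1 + Cmod l + Cmod m)%R).
  set (d := Rmin 1 (e / k)).
  assert (Hd : (0 < d)%R) by (apply Rmin_glb_lt; [lra|apply Rdiv_lt_0_compat; unfold k; lra]).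
  assert (Hd1 : (d <= 1)%R) by apply Rmin_l.
  assert (Hd2 : (d * k <= e)%R).
  { apply Rle_trans with (e / k * k)%R.
    - apply Rmult_le_compat_r; [unfold k; lra|apply Rmin_r].
    - right. field. unfold k; lra. }
  eapply filter_imp; [|apply filter_and; [apply (H1 d Hd)|apply (H2 d Hd)]].
  intros x [Ha Hb].
  replace (phi x * psi x - l * m)
    with ((phi x - l) * (psi x - m) + (l * (psi x - m) + (phi x - l) * m)) by ring.
  eapply Rle_lt_trans; [apply Cmod_triangle|].
  eapply Rle_lt_trans; [apply Rplus_le_compat_l; apply Cmod_triangle|].
  rewrite !Cmod_mult. unfold k in Hd2.
  assert (A := Cmod_ge_0 (phi x - l)). assert (B := Cmod_ge_0 (psi x - m)).
  set (a := Cmod (phi x - l)) in *. set (b := Cmod (psi x - m)) in *.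
  assert (a * b <= a)%R by nra.
  assert (Cmod l * b <= Cmod l * d)%R by (apply Rmult_le_compat_l; lra).
  assert (a * Cmod m <= d * Cmod m)%R by (apply Rmult_le_compat_r; lra).
  lra.
Qed.

Lemma tends_opp {T} (N : (T -> Prop) -> Prop) {FN : Filter N} phi l :
  tends N phi l -> tends N (fun x => - phi x) (- l).
Proof.
  intros H e He. eapply filter_imp; [|apply (H e He)]. intros x Hx.
  replace (- phi x - - l) with (- (phi x - l)) by ring. now rewrite Cmod_opp.
Qed.

Lemma tends_minus {T} (N : (T -> Prop) -> Prop) {FN : Filter N} phi psi l m :
  tends N phi l -> tends N psi m -> tends N (fun x => phi x - psi x) (l - m).
Proof. intros H1 H2. apply tends_plus; auto. now apply tends_opp. Qed.

Lemma tends_conj {T} (N : (T -> Prop) -> Prop) {FN : Filter N} phi l :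
  tends N phi l -> tends N (fun x => Cconj (phi x)) (Cconj l).
Proof.
  intros H e He. eapply filter_imp; [|apply (H e He)]. intros x Hx.
  rewrite <- Cminus_conj. now rewrite Cmod_conj.
Qed.

Lemma tends_inv {T} (N : (T -> Prop) -> Prop) {FN : Filter N} phi (l : C) :
  l <> 0 -> tends N phi l -> tends N (fun x => / phi x) (/ l).
Proof.
  intros Hl H e He.
  assert (Hk : (0 < Cmod l)%R) by (now apply Cmod_gt_0).
  set (d := Rmin (Cmod l / 2) (e * (Cmod l * Cmod l) / 2)).
  assert (Hd : (0 < d)%R).
  { apply Rmin_glb_lt; [lra|]. apply Rdiv_lt_0_compat; [|lra]. apply Rmult_lt_0_compat; nra. }
  eapply filter_imp; [|apply (H d Hd)]. intros x Hx. cbv beta in *.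
  assert (D1 : (d <= Cmod l / 2)%R) by apply Rmin_l.
  assert (D2 : (d <= e * (Cmod l * Cmod l) / 2)%R) by apply Rmin_r.
  assert (Hb : (Cmod l / 2 < Cmod (phi x))%R).
  { assert (E := Cmod_rev_triangle l (phi x)). rewrite Cmod_sub_sym in E. lra. }
  assert (Hp : phi x <> 0) by (apply Cmod_gt_0; lra).
  replace (/ phi x - / l) with ((l - phi x) / (phi x * l)) by (field; auto).
  rewrite Cmod_div by (now apply Cmult_neq_0).
  rewrite (Cmod_sub_sym l), Cmod_mult.
  apply Rmult_lt_reg_r with (Cmod (phi x) * Cmod l)%R; [nra|].
  unfold Rdiv. rewrite Rmult_assoc, Rinv_l, Rmult_1_r by nra.
  assert (e * (Cmod l / 2 * Cmod l) < e * (Cmod (phi x) * Cmod l))%R.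
  { apply Rmult_lt_compat_l; [lra|]. apply Rmult_lt_compat_r; lra. }
  lra.
Qed.

Lemma tends_div {T} (N : (T -> Prop) -> Prop) {FN : Filter N} phi psi (l m : C) :
  m <> 0 -> tends N phi l -> tends N psi m -> tends N (fun x => phi x / psi x) (l / m).
Proof. intros Hm H1 H2. apply tends_mult; auto. now apply tends_inv. Qed.

Lemma tends_pow {T} (N : (T -> Prop) -> Prop) {FN : Filter N} phi l n :
  tends N phi l -> tends N (fun x => Cpow (phi x) n) (Cpow l n).
Proof.
  intro H. induction n as [|n IH]; [exact (tends_const N 1)|].
  exact (tends_mult N phi (fun x => Cpow (phi x) n) l _ H IH).
Qed.

Lemma tends_comp {T} (N : (T -> Prop) -> Prop) {FN : Filter N} (F : C -> C) phi l m :
  tends N phi l -> tends (cnear l) F m -> tends N (fun x => F (phi x)) m.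
Proof.
  intros H1 H2 e He. apply (tends_near N phi l (fun w => Cmod (F w - m) < e)%R); auto.
Qed.

(** Follows the syntax of the function and of its limit together, so the limit must be written in
    the same shape. What remains are nonvanishing denominators and limits absent from the
    context. *)
Ltac tends_step :=
  match goal with
  | H : tends ?N ?f ?l |- tends ?N ?f ?l => exact H
  | H : tends ?N ?f ?l |- tends ?N (fun x => ?f x) ?l => exact H
  | |- tends ?N (fun x => ?c) ?c => exact (tends_const N c)
  | |- tends ?N (fun x => Cplus (@?f x) (@?g x)) (Cplus ?l ?m) => apply (tends_plus N f g l m)
  | |- tends ?N (fun x => Cminus (@?f x) (@?g x)) (Cminus ?l ?m) => apply (tends_minus N f g l m)
  | |- tends ?N (fun x => Cmult (@?f x) (@?g x)) (Cmult ?l ?m) => apply (tends_mult N f g l m)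
  | |- tends ?N (fun x => Cdiv (@?f x) (@?g x)) (Cdiv ?l ?m) => apply (tends_div N f g l m)
  | |- tends ?N (fun x => Cinv (@?f x)) (Cinv ?l) => apply (tends_inv N f l)
  | |- tends ?N (fun x => Copp (@?f x)) (Copp ?l) => apply (tends_opp N f l)
  | |- tends ?N (fun x => Cconj (@?f x)) (Cconj ?l) => apply (tends_conj N f l)
  | |- tends ?N (fun x => Cpow (@?f x) ?n) (Cpow ?l ?n) => apply (tends_pow N f l n)
  end.
Ltac tends_auto := repeat tends_step.

(* A Caratheodory derivative relative to a coordinate [e]: taking [e] to be the identity of C
   or the inclusion of R in C gives complex derivatives and velocities of paths at once. *)
Definition hasd {T} (N : (T -> Prop) -> Prop) (e : T -> C) (t : T) (phi : T -> C) (d : C) : Prop :=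
  exists q : T -> C, tends N q d /\ N (fun s => phi s - phi t = q s * (e s - e t)).

Lemma hasd_tends {T} (N : (T -> Prop) -> Prop) {FN : Filter N} e t phi d :
  tends N e (e t) -> hasd N e t phi d -> tends N phi (phi t).
Proof.
  intros He [q [Hq H]].
  apply (tends_ext N (fun s => phi t + q s * (e s - e t))).
  - eapply filter_imp; [|exact H]. intros s E. rewrite <- E. ring.
  - assert (K : tends N (fun s => phi t + q s * (e s - e t)) (phi t + d * (e t - e t))).
    { tends_auto. }
    now replace (phi t + d * (e t - e t)) with (phi t) in K by ring.
Qed.

Lemma hasd_const {T} (N : (T -> Prop) -> Prop) {FN : Filter N} e t c :
  hasd N e t (fun _ => c) 0.
Proof.
  exists (fun _ => 0). split; [tends_auto|]. apply filter_forall. intro; ring.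
Qed.

Lemma hasd_coord {T} (N : (T -> Prop) -> Prop) {FN : Filter N} e t : hasd N e t e 1.
Proof.
  exists (fun _ => 1). split; [tends_auto|]. apply filter_forall. intro; ring.
Qed.

Lemma hasd_plus {T} (N : (T -> Prop) -> Prop) {FN : Filter N} e t phi psi d d' :
  hasd N e t phi d -> hasd N e t psi d' -> hasd N e t (fun s => phi s + psi s) (d + d').
Proof.
  intros [q [Hq H]] [q' [Hq' H']]. exists (fun s => q s + q' s).
  split; [tends_auto|].
  eapply filter_imp; [|apply filter_and; [exact H|exact H']]. cbv beta. intros s [E E'].
  replace (phi s + psi s - (phi t + psi t)) with ((phi s - phi t) + (psi s - psi t)) by ring.
  rewrite E, E'. ring.
Qed.

Lemma hasd_mult {T} (N : (T -> Prop) -> Prop) {FN : Filter N} e t phi psi d d' :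
  tends N e (e t) ->
  hasd N e t phi d -> hasd N e t psi d' ->
  hasd N e t (fun s => phi s * psi s) (d * psi t + phi t * d').
Proof.
  intros He Hp Hp'. assert (K := hasd_tends N e t psi d' He Hp').
  destruct Hp as [q [Hq H]]. destruct Hp' as [q' [Hq' H']].
  exists (fun s => q s * psi s + phi t * q' s).
  split; [tends_auto|].
  eapply filter_imp; [|apply filter_and; [exact H|exact H']]. cbv beta. intros s [E E'].
  replace (phi s * psi s - phi t * psi t)
    with ((phi s - phi t) * psi s + phi t * (psi s - psi t)) by ring.
  rewrite E, E'. ring.
Qed.

Lemma hasd_scal {T} (N : (T -> Prop) -> Prop) {FN : Filter N} e t c phi d :
  hasd N e t phi d -> hasd N e t (fun s => c * phi s) (c * d).
Proof.
  intros [q [Hq H]]. exists (fun s => c * q s).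
  split; [tends_auto|].
  eapply filter_imp; [|exact H]. cbv beta. intros s E.
  replace (c * phi s - c * phi t) with (c * (phi s - phi t)) by ring. rewrite E. ring.
Qed.

Lemma hasd_opp {T} (N : (T -> Prop) -> Prop) {FN : Filter N} e t phi d :
  hasd N e t phi d -> hasd N e t (fun s => - phi s) (- d).
Proof.
  intros [q [Hq H]]. exists (fun s => - q s).
  split; [tends_auto|].
  eapply filter_imp; [|exact H]. cbv beta. intros s E.
  replace (- phi s - - phi t) with (- (phi s - phi t)) by ring. rewrite E. ring.
Qed.

Lemma hasd_minus {T} (N : (T -> Prop) -> Prop) {FN : Filter N} e t phi psi d d' :
  hasd N e t phi d -> hasd N e t psi d' -> hasd N e t (fun s => phi s - psi s) (d - d').
Proof. intros H1 H2. apply hasd_plus; auto. now apply hasd_opp. Qed.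

Lemma hasd_comp {T} (N : (T -> Prop) -> Prop) {FN : Filter N} e t phi d F D :
  tends N e (e t) ->
  hasd N e t phi d -> hasd (cnear (phi t)) (fun z => z) (phi t) F D ->
  hasd N e t (fun s => F (phi s)) (D * d).
Proof.
  intros He Hp [Q [HQ H']]. assert (K := hasd_tends N e t phi d He Hp).
  destruct Hp as [q [Hq H]].
  exists (fun s => Q (phi s) * q s). split.
  - refine (tends_mult N _ _ _ _ _ Hq). now apply (tends_comp N Q phi (phi t)).
  - assert (K' := tends_near N phi (phi t) _ K H').
    eapply filter_imp; [|apply filter_and; [exact H|exact K']]. cbv beta. intros s [E E'].
    rewrite E', E. ring.
Qed.

Lemma hasd_ext {T} (N : (T -> Prop) -> Prop) {FN : Filter N} e t phi psi d :
  phi t = psi t -> N (fun s => phi s = psi s) -> hasd N e t phi d -> hasd N e t psi d.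
Proof.
  intros E0 E [q [Hq H]]. exists q. split; auto.
  eapply filter_imp; [|apply filter_and; [exact E|exact H]]. cbv beta. intros s [E1 E2].
  now rewrite <- E1, <- E0.
Qed.

(** * Complex derivatives and velocities of paths *)

Definition cdiff (F : C -> C) (z d : C) : Prop := hasd (cnear z) (fun w => w) z F d.
Definition pdiff (phi : R -> C) (t : R) (d : C) : Prop := hasd (locally t) RtoC t phi d.

Lemma tends_id z : tends (cnear z) (fun w => w) z.
Proof. intros e He. now apply cnear_ball. Qed.

Lemma tends_RtoC (t : R) : tends (locally t) RtoC (RtoC t).
Proof.
  intros e He. apply locally_R_iff. exists e. split; auto. intros s Hs.
  rewrite <- RtoC_minus, Cmod_R. exact Hs.
Qed.

Lemma hasd_inv {T} (N : (T -> Prop) -> Prop) {FN : Filter N} e t (phi : T -> C) d :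
  tends N e (e t) -> phi t <> 0 ->
  hasd N e t phi d -> hasd N e t (fun s => / phi s) (- (d / (phi t * phi t))).
Proof.
  intros He Hn Hp. assert (K := hasd_tends N e t phi d He Hp).
  destruct Hp as [q [Hq H]].
  exists (fun s => - (q s / (phi s * phi t))). split.
  - tends_auto. now apply Cmult_neq_0.
  - assert (Hk : (0 < Cmod (phi t))%R) by (now apply Cmod_gt_0).
    assert (K' := K _ Hk).
    eapply filter_imp; [|apply filter_and; [exact H|exact K']]. cbv beta. intros s [E E'].
    assert (phi s <> 0).
    { intro Z. rewrite Z in E'. replace (0 - phi t) with (- phi t) in E' by ring.
      rewrite Cmod_opp in E'. lra. }
    replace (/ phi s - / phi t) with (- ((phi s - phi t) / (phi s * phi t))) by (field; auto).
    rewrite E. field. auto.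
Qed.

Lemma hasd_div {T} (N : (T -> Prop) -> Prop) {FN : Filter N} e t (phi psi : T -> C) d d' :
  tends N e (e t) -> psi t <> 0 ->
  hasd N e t phi d -> hasd N e t psi d' ->
  hasd N e t (fun s => phi s / psi s) ((d * psi t - phi t * d') / (psi t * psi t)).
Proof.
  intros He Hn H1 H2.
  assert (K := hasd_mult N e t phi (fun s => / psi s) _ _ He H1 (hasd_inv N e t psi d' He Hn H2)).
  cbv beta in K.
  replace ((d * psi t - phi t * d') / (psi t * psi t))
    with (d * / psi t + phi t * - (d' / (psi t * psi t))) by (field; auto).
  exact K.
Qed.

Lemma hasd_eps {T} (N : (T -> Prop) -> Prop) {FN : Filter N} e t phi d :
  hasd N e t phi d <->
  (forall eps, (0 < eps)%R ->
    N (fun s => Cmod (phi s - phi t - d * (e s - e t)) <= eps * Cmod (e s - e t))%R).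
Proof.
  split.
  - intros [q [Hq H]] eps He.
    eapply filter_imp; [|apply filter_and; [exact H|exact (Hq eps He)]]. cbv beta.
    intros s [E E']. rewrite E. replace (q s * (e s - e t) - d * (e s - e t))
      with ((q s - d) * (e s - e t)) by ring.
    rewrite Cmod_mult. apply Rmult_le_compat_r; [apply Cmod_ge_0|lra].
  - intro H.
    (* Where [e s = e t] the quotient is filled with [d]; the estimate then forces [phi s = phi t],
       so the factorisation holds there as well. *)
    exists (fun s => if excluded_middle_informative (e s = e t) then d
                     else (phi s - phi t) / (e s - e t)). split.
    + intros eps He. eapply filter_imp; [|apply (H (eps / 2)%R ltac:(lra))]. cbv beta.
      intros s Hs. destruct (excluded_middle_informative (e s = e t)) as [E|E].
      * replace (d - d) with (RtoC 0) by ring. now rewrite Cmod_0.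
      * assert (Hn := Cminus_neq0 _ _ E).
        replace ((phi s - phi t) / (e s - e t) - d)
          with ((phi s - phi t - d * (e s - e t)) / (e s - e t)) by (field; auto).
        rewrite Cmod_div by auto. assert (Hk : (0 < Cmod (e s - e t))%R) by (now apply Cmod_gt_0).
        apply Rmult_lt_reg_r with (Cmod (e s - e t)); auto.
        unfold Rdiv. rewrite Rmult_assoc, Rinv_l, Rmult_1_r by lra. nra.
    + eapply filter_imp; [|apply (H 1%R ltac:(lra))]. cbv beta.
      intros s Hs. destruct (excluded_middle_informative (e s = e t)) as [E|E].
      * rewrite E in *. replace (e t - e t) with (RtoC 0) in * by ring.
        replace (phi s - phi t - d * 0) with (phi s - phi t) in Hs by ring.
        rewrite Cmod_0 in Hs. rewrite Rmult_0_r in Hs.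
        replace (d * 0) with (RtoC 0) by ring. apply Cmod_eq_0.
        apply Rle_antisym; [exact Hs|apply Cmod_ge_0].
      * field. now apply Cminus_neq0.
Qed.

Lemma cdiff_cts F z d : cdiff F z d -> tends (cnear z) F (F z).
Proof. intro H. refine (hasd_tends (cnear z) (fun w => w) z F d _ H). apply tends_id. Qed.

Lemma pdiff_cts phi t d : pdiff phi t d -> tends (locally t) phi (phi t).
Proof. intro H. refine (hasd_tends (locally t) RtoC t phi d _ H). apply tends_RtoC. Qed.

Lemma cderiv_cdiff F z d : cderiv F z d <-> cdiff F z d.
Proof.
  unfold cdiff. rewrite hasd_eps by apply cnear_filter. split.
  - intros [_ H] eps He.
    assert (K := H z (fun P HP => HP) (mkposreal eps He)).
    destruct K as [dd K]. exists (pos dd). split; [apply cond_pos|]. intros w Hw.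
    assert (K' := K w Hw). cbv beta in K'.
    change (norm (minus w z)) with (Cmod (w - z)) in K'. simpl in K'.
    eapply Rle_trans; [|exact K']. right.
    change (Cmod (F w - F z - d * (w - z)) = Cmod ((F w - F z) - (w - z) * d)).
    f_equal. ring.
  - intro H. split.
    + apply @is_linear_scal_l.
    + intros x Hx eps.
      assert (E : z = x) by (apply @is_filter_lim_locally_unique in Hx; exact Hx).
      subst x.
      destruct (H eps (cond_pos eps)) as [dd [Hd K]]. exists (mkposreal dd Hd).
      intros w Hw. assert (K' := K w Hw). cbv beta in K'.
      change (Cmod ((F w - F z) - (w - z) * d) <= eps * Cmod (w - z))%R.
      eapply Rle_trans; [|exact K']. right. f_equal. ring.
Qed.

Lemma cdiff_unique F z d d' : cdiff F z d -> cdiff F z d' -> d = d'.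
Proof.
  unfold cdiff. rewrite !hasd_eps by apply cnear_filter. intros H1 H2.
  apply NNPP. intro Hn.
  assert (Hk : (0 < Cmod (d - d'))%R) by (apply Cmod_gt_0; now apply Cminus_neq0).
  assert (Hh : (0 < Cmod (d - d') / 4)%R) by lra.
  destruct (filter_and (F := cnear z) _ _ (H1 _ Hh) (H2 _ Hh)) as [r [Hr K]].
  destruct (K (z + RtoC (r / 2))) as [Ka Kb].
  { replace (z + RtoC (r / 2) - z) with (RtoC (r / 2)) by ring.
    rewrite Cmod_R, Rabs_pos_eq; lra. }
  replace (z + RtoC (r / 2) - z) with (RtoC (r / 2)) in * by ring.
  set (u := F (z + RtoC (r / 2)) - F z) in *.
  assert (T : (Cmod (d - d') * (r / 2) <= Cmod (d - d') / 2 * (r / 2))%R).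
  { replace (Cmod (d - d') * (r / 2))%R with (Cmod ((u - d' * RtoC (r / 2)) - (u - d * RtoC (r / 2)))).
    - unfold Cminus at 1. eapply Rle_trans; [apply Cmod_triangle|]. rewrite Cmod_opp.
      rewrite Cmod_R, Rabs_pos_eq in Ka, Kb by lra. lra.
    - replace (u - d' * RtoC (r / 2) - (u - d * RtoC (r / 2))) with ((d - d') * RtoC (r / 2)) by ring.
      rewrite Cmod_mult, Cmod_R, Rabs_pos_eq; lra. }
  nra.
Qed.

Lemma pdiff_rderiv phi t d : rderiv phi t d <-> pdiff phi t d.
Proof.
  unfold pdiff. rewrite hasd_eps by apply locally_filter. split.
  - intros [_ H] eps He.
    (* Half of [eps], because the modulus is bounded by the sum of the deviations of the two
       coordinates. *)
    assert (K := H t (fun P HP => HP) (mkposreal (eps / 2) ltac:(lra))).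
    eapply filter_imp; [|exact K]. cbv beta. intros s Hs. simpl in Hs.
    rewrite <- RtoC_minus, Cmod_R.
    change (norm (minus s t)) with (Rabs (s - t)) in Hs.
    eapply Rle_trans; [apply Cmod_le_sum|].
    set (v := phi s - phi t - d * RtoC (s - t)).
    assert (E : (sqrt ((Rabs (fst v))^2 + (Rabs (snd v))^2) <= eps / 2 * Rabs (s - t))%R).
    { eapply Rle_trans; [|exact Hs]. right. unfold norm; simpl. unfold prod_norm; simpl.
      unfold norm, minus, plus, opp, scal; simpl. unfold abs, mult; simpl. unfold v; simpl.
      f_equal. f_equal; f_equal; try f_equal; f_equal; ring. }
    assert (A := sqrt_pos ((Rabs (fst v))^2 + (Rabs (snd v))^2)).
    assert (B1 : (Rabs (fst v) <= sqrt ((Rabs (fst v))^2 + (Rabs (snd v))^2))%R).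
    { rewrite <- (sqrt_Rsqr (Rabs (fst v))) at 1 by apply Rabs_pos. apply sqrt_le_1_alt.
      unfold Rsqr. assert (X := pow2_ge_0 (Rabs (snd v))). simpl in *. lra. }
    assert (B2 : (Rabs (snd v) <= sqrt ((Rabs (fst v))^2 + (Rabs (snd v))^2))%R).
    { rewrite <- (sqrt_Rsqr (Rabs (snd v))) at 1 by apply Rabs_pos. apply sqrt_le_1_alt.
      unfold Rsqr. assert (X := pow2_ge_0 (Rabs (fst v))). simpl in *. lra. }
    lra.
  - intro H. split.
    + apply @is_linear_scal_l.
    + intros x Hx eps.
      assert (E : t = x) by (apply @is_filter_lim_locally_unique in Hx; exact Hx).
      subst x.
      eapply filter_imp; [|exact (H eps (cond_pos eps))]. cbv beta. intros s Hs.
      rewrite <- RtoC_minus, Cmod_R in Hs.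
      change (norm (minus s t)) with (Rabs (s - t)).
      eapply Rle_trans; [|exact Hs]. right. unfold norm; simpl. unfold prod_norm; simpl.
      unfold norm, minus, plus, opp, scal; simpl. unfold abs, mult; simpl. unfold Cmod; simpl.
      rewrite !Rmult_1_r, <- !Rabs_mult, !(Rabs_pos_eq (_ * _)) by apply Rle_0_sqr.
      f_equal; f_equal; ring.
Qed.

(** * Integrals of complex-valued paths *)

Definition ctsR (phi : R -> C) : Prop := forall t : R, tends (locally t) phi (phi t).
Definition ctsC (F : C -> C) : Prop := forall z : C, tends (cnear z) F (F z).

Lemma continuous_of_eps (f : R -> R) (t : R) :
  (forall eps, (0 < eps)%R -> locally t (fun s => Rabs (f s - f t) < eps)%R) ->
  continuous f t.
Proof.
  intros H P [d HP]. unfold filtermap. eapply filter_imp; [|apply (H d (cond_pos d))].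
  intros s Hs. now apply HP.
Qed.

Lemma eps_of_continuous (f : R -> R) (t : R) :
  continuous f t ->
  forall eps, (0 < eps)%R -> locally t (fun s => Rabs (f s - f t) < eps)%R.
Proof.
  intros H eps He. apply (H (fun y => Rabs (y - f t) < eps)%R).
  exists (mkposreal eps He). intros y Hy. exact Hy.
Qed.

Lemma tends_fst (phi : R -> C) (t : R) :
  tends (locally t) phi (phi t) -> continuous (fun s => fst (phi s)) t.
Proof.
  intros H. apply continuous_of_eps. intros e He. eapply filter_imp; [|apply (H e He)].
  intros s Hs. cbv beta in *. eapply Rle_lt_trans; [|exact Hs].
  apply (fst_le_Cmod (phi s - phi t)).
Qed.

Lemma tends_snd (phi : R -> C) (t : R) :
  tends (locally t) phi (phi t) -> continuous (fun s => snd (phi s)) t.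
Proof.
  intros H. apply continuous_of_eps. intros e He. eapply filter_imp; [|apply (H e He)].
  intros s Hs. cbv beta in *. eapply Rle_lt_trans; [|exact Hs].
  apply (snd_le_Cmod (phi s - phi t)).
Qed.

Lemma tends_pair (f g : R -> R) (t : R) :
  continuous f t -> continuous g t ->
  tends (locally t) (fun s => (f s, g s) : C) (f t, g t).
Proof.
  intros H1 H2 e He.
  assert (He2 : (0 < e / 2)%R) by lra.
  eapply filter_imp; [|apply filter_and;
     [apply (eps_of_continuous f t H1 _ He2)|apply (eps_of_continuous g t H2 _ He2)]].
  intros s [Ha Hb]. cbv beta in *.
  eapply Rle_lt_trans; [apply Cmod_le_sum|]. simpl.
  replace (f s + - f t)%R with (f s - f t)%R by ring.
  replace (g s + - g t)%R with (g s - g t)%R by ring. lra.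
Qed.

Lemma is_derive_eps (f : R -> R) (t d : R) :
  is_derive f t d <->
  (forall eps, (0 < eps)%R ->
     locally t (fun s => Rabs (f s - f t - d * (s - t)) <= eps * Rabs (s - t)))%R.
Proof.
  split.
  - intros [_ H] eps He. assert (K := H t (fun P HP => HP) (mkposreal eps He)).
    eapply filter_imp; [|exact K]. intros s Hs. cbv beta in *. simpl in Hs.
    eapply Rle_trans; [|exact Hs]. right.
    unfold norm, minus, plus, opp, scal; simpl. unfold abs, mult; simpl. f_equal. ring.
  - intros H. split; [apply @is_linear_scal_l|]. intros x Hx eps.
    assert (E : t = x) by (apply @is_filter_lim_locally_unique in Hx; exact Hx). subst x.
    eapply filter_imp; [|exact (H eps (cond_pos eps))]. intros s Hs. cbv beta in *.
    eapply Rle_trans; [|exact Hs]. right.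
    unfold norm, minus, plus, opp, scal; simpl. unfold abs, mult; simpl. f_equal. ring.
Qed.

Lemma pdiff_fst phi t d : pdiff phi t d -> is_derive (fun s => fst (phi s)) t (fst d).
Proof.
  intros H. apply is_derive_eps. intros eps He.
  eapply filter_imp; [|exact (proj1 (hasd_eps _ _ _ _ _) H eps He)]. intros s Hs. cbv beta in *.
  rewrite <- RtoC_minus, Cmod_R in Hs.
  eapply Rle_trans; [|exact Hs]. eapply Rle_trans; [|apply fst_le_Cmod]. right.
  f_equal. simpl. ring.
Qed.

Lemma pdiff_snd phi t d : pdiff phi t d -> is_derive (fun s => snd (phi s)) t (snd d).
Proof.
  intros H. apply is_derive_eps. intros eps He.
  eapply filter_imp; [|exact (proj1 (hasd_eps _ _ _ _ _) H eps He)]. intros s Hs. cbv beta in *.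
  rewrite <- RtoC_minus, Cmod_R in Hs.
  eapply Rle_trans; [|exact Hs]. eapply Rle_trans; [|apply snd_le_Cmod]. right.
  f_equal. simpl. ring.
Qed.

(** The intermediate point is strictly inside, as the strict inequalities of the fold argument
    require. *)
Lemma mvt_strict (f df : R -> R) (a b : R) : (a < b)%R ->
  (forall t, (a <= t <= b)%R -> is_derive f t (df t)) ->
  exists c, (a < c < b)%R /\ (f b - f a = df c * (b - a))%R.
Proof.
  intros Hab H. destruct (MVT_cor2 f df a b Hab) as [c [E Hc]].
  - intros c Hc. apply is_derive_Reals. auto.
  - exists c. auto.
Qed.

Lemma pdiff_pair (f g : R -> R) (t a b : R) :
  is_derive f t a -> is_derive g t b -> pdiff (fun s => (f s, g s)) t (a, b).
Proof.
  rewrite !is_derive_eps. intros Hf Hg. apply hasd_eps; [apply locally_filter|].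
  intros e He. assert (He2 : (0 < e / 2)%R) by lra.
  eapply filter_imp; [|apply filter_and; [exact (Hf _ He2)|exact (Hg _ He2)]].
  intros s [Ha Hb]. cbv beta in *. rewrite <- RtoC_minus, Cmod_R.
  eapply Rle_trans; [apply Cmod_le_sum|]. simpl.
  replace (f s + - f t + - (a * (s - t) - b * 0))%R with (f s - f t - a * (s - t))%R by ring.
  replace (g s + - g t + - (a * 0 + b * (s - t)))%R with (g s - g t - b * (s - t))%R by ring.
  lra.
Qed.

Definition CInt (phi : R -> C) (a b : R) : C :=
  (RInt (fun t => fst (phi t)) a b, RInt (fun t => snd (phi t)) a b).

Lemma ctsR_ex_fst phi a b : ctsR phi -> ex_RInt (fun t => fst (phi t)) a b.
Proof. intro H. apply (ex_RInt_continuous (V := R_CompleteNormedModule)). intros z _. now apply tends_fst. Qed.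

Lemma ctsR_ex_snd phi a b : ctsR phi -> ex_RInt (fun t => snd (phi t)) a b.
Proof. intro H. apply (ex_RInt_continuous (V := R_CompleteNormedModule)). intros z _. now apply tends_snd. Qed.

Lemma CInt_ext phi psi a b : (forall t, phi t = psi t) -> CInt phi a b = CInt psi a b.
Proof. intro H. unfold CInt. f_equal; apply RInt_ext; intros t _; now rewrite H. Qed.

Lemma CInt_plus phi psi a b : ctsR phi -> ctsR psi ->
  CInt (fun t => phi t + psi t) a b = CInt phi a b + CInt psi a b.
Proof.
  intros H1 H2. unfold CInt, Cplus; simpl. f_equal; apply (RInt_plus (V := R_CompleteNormedModule));
    auto using ctsR_ex_fst, ctsR_ex_snd.
Qed.

Lemma CInt_scal c phi a b : ctsR phi -> CInt (fun t => c * phi t) a b = c * CInt phi a b.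
Proof.
  intros H. unfold CInt, Cmult; simpl.
  assert (H1 := ctsR_ex_fst phi a b H). assert (H2 := ctsR_ex_snd phi a b H).
  f_equal; apply is_RInt_unique.
  - apply (is_RInt_minus (V := R_NormedModule) (fun t => fst c * fst (phi t))%R (fun t => snd c * snd (phi t))%R);
      apply (is_RInt_scal (V := R_NormedModule)); now apply (RInt_correct (V := R_CompleteNormedModule)).
  - apply (is_RInt_plus (V := R_NormedModule) (fun t => fst c * snd (phi t))%R (fun t => snd c * fst (phi t))%R);
      apply (is_RInt_scal (V := R_NormedModule)); now apply (RInt_correct (V := R_CompleteNormedModule)).
Qed.

Lemma CInt_minus phi psi a b : ctsR phi -> ctsR psi ->
  CInt (fun t => phi t - psi t) a b = CInt phi a b - CInt psi a b.
Proof.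
  intros H1 H2. unfold CInt, Cminus, Cplus, Copp; simpl.
  f_equal; apply (RInt_minus (V := R_CompleteNormedModule));
    auto using ctsR_ex_fst, ctsR_ex_snd.
Qed.

Lemma CInt_Chasles phi a b c : ctsR phi -> CInt phi a b + CInt phi b c = CInt phi a c.
Proof.
  intros H. unfold CInt, Cplus; simpl. f_equal; apply (RInt_Chasles (V := R_CompleteNormedModule));
    auto using ctsR_ex_fst, ctsR_ex_snd.
Qed.

Lemma CInt_point phi a : CInt phi a a = 0.
Proof. unfold CInt. now rewrite !(RInt_point (V := R_CompleteNormedModule)). Qed.

Lemma CInt_swap phi a b : ctsR phi -> CInt phi b a = - CInt phi a b.
Proof.
  intros H. assert (K := CInt_Chasles phi a b a H). rewrite CInt_point in K.
  replace (CInt phi b a) with (CInt phi a b + CInt phi b a - CInt phi a b) by ring. rewrite K. ring.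
Qed.

Lemma CInt_FTC phi dphi a b :
  (forall t, pdiff phi t (dphi t)) -> ctsR dphi -> CInt dphi a b = phi b - phi a.
Proof.
  intros H Hc. unfold CInt, Cminus, Cplus, Copp; simpl. f_equal; apply is_RInt_unique.
  - apply (is_RInt_derive (V := R_CompleteNormedModule) (fun t => fst (phi t)) (fun t => fst (dphi t))).
    + intros t _. now apply pdiff_fst.
    + intros t _. now apply tends_fst.
  - apply (is_RInt_derive (V := R_CompleteNormedModule) (fun t => snd (phi t)) (fun t => snd (dphi t))).
    + intros t _. now apply pdiff_snd.
    + intros t _. now apply tends_snd.
Qed.

Lemma RInt_bound (f : R -> R) (a b M : R) :
  ex_RInt f a b -> (forall t, Rmin a b <= t <= Rmax a b -> Rabs (f t) <= M)%R ->
  (Rabs (RInt f a b) <= M * Rabs (b - a))%R.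
Proof.
  intros Hex H.
  destruct (Rle_or_lt a b) as [L|L].
  - rewrite (Rabs_pos_eq (b - a)) by lra.
    rewrite Rmin_left, Rmax_right in H by lra.
    replace (M * (b - a))%R with ((b - a) * M)%R by ring.
    now apply abs_RInt_le_const.
  - rewrite <- (opp_RInt_swap (V := R_CompleteNormedModule)) by (now apply ex_RInt_swap).
    rewrite Rmin_right, Rmax_left in H by lra.
    unfold opp; simpl. rewrite Rabs_Ropp, (Rabs_left (b - a)) by lra.
    replace (M * - (b - a))%R with ((a - b) * M)%R by ring.
    apply abs_RInt_le_const; auto; [lra|now apply ex_RInt_swap].
Qed.

(** The factor 2 comes from estimating real and imaginary parts separately; it is harmless, since
    the bound only serves limit arguments. *)
Lemma CInt_bound phi a b M : ctsR phi ->
  (forall t, Rmin a b <= t <= Rmax a b -> Cmod (phi t) <= M)%R ->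
  (Cmod (CInt phi a b) <= 2 * M * Rabs (b - a))%R.
Proof.
  intros Hc H. eapply Rle_trans; [apply Cmod_le_sum|]. unfold CInt; simpl.
  assert (H1 : (Rabs (RInt (fun t => fst (phi t)) a b) <= M * Rabs (b - a))%R).
  { apply RInt_bound; [now apply ctsR_ex_fst|]. intros t Ht.
    eapply Rle_trans; [apply fst_le_Cmod|auto]. }
  assert (H2 : (Rabs (RInt (fun t => snd (phi t)) a b) <= M * Rabs (b - a))%R).
  { apply RInt_bound; [now apply ctsR_ex_snd|]. intros t Ht.
    eapply Rle_trans; [apply snd_le_Cmod|auto]. }
  lra.
Qed.

Lemma ctsR_minus phi psi : ctsR phi -> ctsR psi -> ctsR (fun t => phi t - psi t).
Proof. intros H1 H2 t. apply (tends_minus (locally t)); auto. Qed.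
Lemma ctsR_mult phi psi : ctsR phi -> ctsR psi -> ctsR (fun t => phi t * psi t).
Proof. intros H1 H2 t. apply (tends_mult (locally t)); auto. Qed.
Lemma ctsR_const c : ctsR (fun _ => c).
Proof. intros t. apply (tends_const (locally t)). Qed.
Lemma ctsR_comp F phi : ctsC F -> ctsR phi -> ctsR (fun t => F (phi t)).
Proof. intros H1 H2 t. apply (tends_comp (locally t) F phi (phi t)); auto. Qed.
Lemma ctsR_inv (phi : R -> C) : (forall t, phi t <> 0) -> ctsR phi -> ctsR (fun t => / phi t).
Proof. intros Hn H t. apply (tends_inv (locally t)); auto. Qed.
Lemma ctsR_horiz (y : R) : ctsR (fun s => (s, y) : C).
Proof. intros t. apply (tends_pair (fun s => s) (fun _ => y)); [apply continuous_id|apply continuous_const]. Qed.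
Lemma ctsR_vert (x : R) : ctsR (fun s => (x, s) : C).
Proof. intros t. apply (tends_pair (fun _ => x) (fun s => s)); [apply continuous_const|apply continuous_id]. Qed.

(** A counterexample has a quarter that is again a counterexample; the nested quarters shrink to a
    point, where locality contradicts them. The predicate is arbitrary because the principle serves
    both Goursat's theorem and the compactness of discs. *)
Lemma bisection_2d (P : R -> R -> R -> R -> Prop) :
  (forall a b c d, a <= b -> c <= d ->
     P a ((a + b) / 2) c ((c + d) / 2) -> P ((a + b) / 2) b c ((c + d) / 2) ->
     P a ((a + b) / 2) ((c + d) / 2) d -> P ((a + b) / 2) b ((c + d) / 2) d -> P a b c d)%R ->
  (forall x y, exists del, 0 < del /\ forall a b c d, a <= x <= b -> c <= y <= d ->
     b - a < del -> d - c < del -> P a b c d)%R ->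
  forall a b c d, (a <= b)%R -> (c <= d)%R -> P a b c d.
Proof.
  intros Hsub Hloc a0 b0 c0 d0 Hab0 Hcd0. apply NNPP. intro Hbad.
  set (good := fun q : (R * R) * (R * R) => (fst (fst q) <= snd (fst q))%R /\
      (fst (snd q) <= snd (snd q))%R /\ ~ P (fst (fst q)) (snd (fst q)) (fst (snd q)) (snd (snd q))).
  assert (Hstep : forall q, exists q', good q -> good q' /\
     (fst (fst q) <= fst (fst q') /\ snd (fst q') <= snd (fst q) /\
      fst (snd q) <= fst (snd q') /\ snd (snd q') <= snd (snd q) /\
      snd (fst q') - fst (fst q') = (snd (fst q) - fst (fst q)) / 2 /\
      snd (snd q') - fst (snd q') = (snd (snd q) - fst (snd q)) / 2)%R).
  { intros [[a b] [c d]]. apply NNPP. intro Hno.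
    assert (G : good ((a, b), (c, d))).
    { apply NNPP. intro G. apply Hno. exists ((a, b), (c, d)). intro; contradiction. }
    apply Hno. clear Hno. destruct G as [G1 [G2 G3]]. simpl in *.
    assert (K : forall a' b' c' d', (a <= a' -> b' <= b -> c <= c' -> d' <= d ->
       b' - a' = (b - a) / 2 -> d' - c' = (d - c) / 2 -> ~ P a' b' c' d' ->
       exists q' : R * R * (R * R), good ((a, b), (c, d)) -> good q' /\
     (a <= fst (fst q') /\ snd (fst q') <= b /\
      c <= fst (snd q') /\ snd (snd q') <= d /\
      snd (fst q') - fst (fst q') = (b - a) / 2 /\
      snd (snd q') - fst (snd q') = (d - c) / 2))%R).
    { intros. exists ((a', b'), (c', d')). intros _. unfold good. simpl.
      repeat split; auto; lra. }
    apply NNPP. intro Hno. apply G3.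
    apply Hsub; auto; apply NNPP; intro Z; apply Hno;
      (eapply K; [| | | | | |exact Z]); lra. }
  set (nxt := fun q => proj1_sig (constructive_indefinite_description _ (Hstep q))).
  assert (Hnxt := fun q => proj2_sig (constructive_indefinite_description _ (Hstep q))).
  fold nxt in Hnxt. change (forall q, good q -> good (nxt q) /\
     (fst (fst q) <= fst (fst (nxt q)) /\ snd (fst (nxt q)) <= snd (fst q) /\
      fst (snd q) <= fst (snd (nxt q)) /\ snd (snd (nxt q)) <= snd (snd q) /\
      snd (fst (nxt q)) - fst (fst (nxt q)) = (snd (fst q) - fst (fst q)) / 2 /\
      snd (snd (nxt q)) - fst (snd (nxt q)) = (snd (snd q) - fst (snd q)) / 2)%R) in Hnxt.
  set (Q := nat_rect (fun _ => ((R * R) * (R * R))%type) ((a0, b0), (c0, d0)) (fun _ q => nxt q)).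
  assert (HG : forall n, good (Q n)).
  { induction n; [now repeat split|]. exact (proj1 (Hnxt _ IHn)). }
  assert (Hm := fun n => proj2 (Hnxt _ (HG n))).
  change (forall n : nat, (fst (fst (Q n)) <= fst (fst (Q (S n))) /\ snd (fst (Q (S n))) <= snd (fst (Q n)) /\
      fst (snd (Q n)) <= fst (snd (Q (S n))) /\ snd (snd (Q (S n))) <= snd (snd (Q n)) /\
      snd (fst (Q (S n))) - fst (fst (Q (S n))) = (snd (fst (Q n)) - fst (fst (Q n))) / 2 /\
      snd (snd (Q (S n))) - fst (snd (Q (S n))) = (snd (snd (Q n)) - fst (snd (Q n))) / 2)%R) in Hm.
  assert (Hnest : forall u v : nat -> R, (forall n, u n <= u (S n))%R -> (forall n, v (S n) <= v n)%R ->
     (forall n, u n <= v n)%R -> exists x, forall n, (u n <= x <= v n)%R).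
  { intros u v Hu Hv Huv.
    assert (Mu : forall n k, (u n <= u (n + k)%nat)%R).
    { intros n k. induction k; [rewrite Nat.add_0_r; lra|].
      rewrite Nat.add_succ_r. specialize (Hu (n + k)%nat). lra. }
    assert (Mv : forall n k, (v (n + k)%nat <= v n)%R).
    { intros n k. induction k; [rewrite Nat.add_0_r; lra|].
      rewrite Nat.add_succ_r. specialize (Hv (n + k)%nat). lra. }
    assert (Huv' : forall n m, (u n <= v m)%R).
    { intros n m. specialize (Mu n m). specialize (Mv m n). rewrite Nat.add_comm in Mv.
      specialize (Huv (n + m)%nat). lra. }
    destruct (completeness (fun r => exists n, r = u n)) as [x [Hx1 Hx2]].
    - exists (v 0%nat). intros r [n ->]. apply Huv'.
    - exists (u 0%nat). now exists 0%nat.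
    - exists x. intro n. split; [apply Hx1; now exists n|]. apply Hx2. intros r [m ->]. apply Huv'. }
  destruct (Hnest (fun n => fst (fst (Q n))) (fun n => snd (fst (Q n)))) as [x Hx];
    try (intro n; specialize (Hm n); cbv beta; tauto).
  { intro n. apply (HG n). }
  destruct (Hnest (fun n => fst (snd (Q n))) (fun n => snd (snd (Q n)))) as [y Hy];
    try (intro n; specialize (Hm n); cbv beta; tauto).
  { intro n. apply (HG n). }
  destruct (Hloc x y) as [del [Hdel HP]].
  assert (Hw : forall n, (snd (fst (Q n)) - fst (fst (Q n)) = (b0 - a0) * (/ 2) ^ n /\
                    snd (snd (Q n)) - fst (snd (Q n)) = (d0 - c0) * (/ 2) ^ n)%R).
  { induction n; [simpl; lra|]. destruct (Hm n) as (_ & _ & _ & _ & E1 & E2).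
    rewrite E1, E2. destruct IHn as [-> ->]. simpl. lra. }
  (* The added 1 keeps [L] positive and strictly above both sides, even for a degenerate
     rectangle. *)
  set (L := (Rmax (b0 - a0) (d0 - c0) + 1)%R).
  assert (HL1 : (b0 - a0 < L)%R) by (unfold L; generalize (Rmax_l (b0 - a0) (d0 - c0)); lra).
  assert (HL2 : (d0 - c0 < L)%R) by (unfold L; generalize (Rmax_r (b0 - a0) (d0 - c0)); lra).
  destruct (pow_lt_1_zero (/ 2)%R) with (y := (del / L)%R) as [N HN].
  { rewrite Rabs_pos_eq; lra. }
  { apply Rdiv_lt_0_compat; lra. }
  specialize (HN N (le_n _)). rewrite Rabs_pos_eq in HN by (apply pow_le; lra).
  assert (Hp : (0 < (/ 2) ^ N)%R) by (apply pow_lt; lra).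
  assert (HN' : (L * (/ 2) ^ N < del)%R).
  { apply Rmult_lt_compat_l with (r := L) in HN; [|lra].
    replace (L * (del / L))%R with del in HN by (field; lra). exact HN. }
  destruct (HG N) as [_ [_ Hn]]. apply Hn. destruct (Hw N) as [W1 W2].
  apply HP; [apply Hx|apply Hy| |]; rewrite ?W1, ?W2; nra.
Qed.

(** * Goursat's theorem *)

(** The contour integral of F dz around the rectangle [a, b] x [c, d], counterclockwise. *)
Definition RectInt (F : C -> C) (a b c d : R) : C :=
  CInt (fun x => F (x, c)) a b - CInt (fun x => F (x, d)) a b
  + Ci * (CInt (fun y => F (b, y)) c d - CInt (fun y => F (a, y)) c d).

Lemma ctsR_F_horiz F y : ctsC F -> ctsR (fun s => F (s, y)).
Proof. intro H. apply (ctsR_comp F (fun s => (s, y))); auto using ctsR_horiz. Qed.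

Lemma ctsR_F_vert F x : ctsC F -> ctsR (fun s => F (x, s)).
Proof. intro H. apply (ctsR_comp F (fun s => (x, s))); auto using ctsR_vert. Qed.

Lemma RectInt_split_x F a m b c d : ctsC F -> RectInt F a m c d + RectInt F m b c d = RectInt F a b c d.
Proof.
  intro H. unfold RectInt.
  rewrite <- (CInt_Chasles (fun x => F (x, c)) a m b), <- (CInt_Chasles (fun x => F (x, d)) a m b)
    by now apply ctsR_F_horiz.
  ring.
Qed.

Lemma RectInt_split_y F a b c m d : ctsC F -> RectInt F a b c m + RectInt F a b m d = RectInt F a b c d.
Proof.
  intro H. unfold RectInt.
  rewrite <- (CInt_Chasles (fun y => F (b, y)) c m d), <- (CInt_Chasles (fun y => F (a, y)) c m d)
    by now apply ctsR_F_vert.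
  ring.
Qed.

Lemma RectInt_swap_x F a b c d : ctsC F -> RectInt F b a c d = - RectInt F a b c d.
Proof.
  intro H. unfold RectInt.
  rewrite (CInt_swap (fun x => F (x, c)) a b), (CInt_swap (fun x => F (x, d)) a b)
    by now apply ctsR_F_horiz.
  ring.
Qed.

Lemma RectInt_swap_y F a b c d : ctsC F -> RectInt F a b d c = - RectInt F a b c d.
Proof.
  intro H. unfold RectInt.
  rewrite (CInt_swap (fun y => F (b, y)) c d), (CInt_swap (fun y => F (a, y)) c d)
    by now apply ctsR_F_vert.
  ring.
Qed.

Lemma RectInt_minus F G a b c d : ctsC F -> ctsC G ->
  RectInt (fun z => F z - G z) a b c d = RectInt F a b c d - RectInt G a b c d.
Proof.
  intros HF HG. unfold RectInt.
  rewrite !(CInt_minus (fun x => F (x, _)) (fun x => G (x, _)))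
    by auto using ctsR_F_horiz.
  rewrite !(CInt_minus (fun y => F (_, y)) (fun y => G (_, y)))
    by auto using ctsR_F_vert.
  ring.
Qed.

Lemma pdiff_comp phi t d F D :
  pdiff phi t d -> cdiff F (phi t) D -> pdiff (fun s => F (phi s)) t (D * d).
Proof. intros. apply (hasd_comp (locally t)); auto. apply tends_RtoC. Qed.

Lemma pdiff_horiz (y t : R) : pdiff (fun s => (s, y)) t 1.
Proof. apply (pdiff_pair (fun s => s) (fun _ => y) t 1 0); auto_derive; auto. Qed.

Lemma pdiff_vert (x t : R) : pdiff (fun s => (x, s)) t Ci.
Proof. apply (pdiff_pair (fun _ => x) (fun s => s) t 0 1); auto_derive; auto. Qed.

Lemma RectInt_prim F A a b c d : ctsC F -> (forall z, cdiff A z (F z)) -> RectInt F a b c d = 0.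
Proof.
  intros H HA. unfold RectInt.
  assert (K1 : forall y, CInt (fun x => F (x, y)) a b = A (b, y) - A (a, y)).
  { intro y. apply (CInt_FTC (fun s => A (s, y))); [|now apply ctsR_F_horiz].
    intro t. replace (F (t, y)) with (F (t, y) * 1) by ring.
    apply (pdiff_comp (fun s => (s, y))); auto using pdiff_horiz. }
  assert (K2 : forall x, Ci * CInt (fun y => F (x, y)) c d = A (x, d) - A (x, c)).
  { intro x. rewrite <- CInt_scal by now apply ctsR_F_vert.
    apply (CInt_FTC (fun s => A (x, s))).
    - intro t. replace (Ci * F (x, t)) with (F (x, t) * Ci) by ring.
      apply (pdiff_comp (fun s => (x, s))); auto using pdiff_vert.
    - apply ctsR_mult; [apply ctsR_const|now apply ctsR_F_vert]. }
  rewrite !K1. replace (Ci * (CInt (fun y => F (b, y)) c d - CInt (fun y => F (a, y)) c d))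
    with (Ci * CInt (fun y => F (b, y)) c d - Ci * CInt (fun y => F (a, y)) c d) by ring.
  rewrite !K2. ring.
Qed.

Lemma RectInt_bound F a b c d M : ctsC F -> (a <= b)%R -> (c <= d)%R ->
  (forall x y, a <= x <= b -> c <= y <= d -> Cmod (F (x, y)) <= M)%R ->
  (Cmod (RectInt F a b c d) <= 4 * M * ((b - a) + (d - c)))%R.
Proof.
  intros HF Hab Hcd H. unfold RectInt.
  assert (K1 : forall y, (c <= y <= d)%R -> (Cmod (CInt (fun x => F (x, y)) a b) <= 2 * M * (b - a))%R).
  { intros y Hy. rewrite <- (Rabs_pos_eq (b - a)) by lra.
    apply CInt_bound; [now apply ctsR_F_horiz|]. intros t Ht.
    rewrite Rmin_left, Rmax_right in Ht by lra. now apply H. }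
  assert (K2 : forall x, (a <= x <= b)%R -> (Cmod (CInt (fun y => F (x, y)) c d) <= 2 * M * (d - c))%R).
  { intros y Hy. rewrite <- (Rabs_pos_eq (d - c)) by lra.
    apply CInt_bound; [now apply ctsR_F_vert|]. intros t Ht.
    rewrite Rmin_left, Rmax_right in Ht by lra. now apply H. }
  eapply Rle_trans; [apply Cmod_triangle|]. rewrite Cmod_mult, Cmod_Ci, Rmult_1_l.
  unfold Cminus.
  eapply Rle_trans; [apply Rplus_le_compat; apply Cmod_triangle|]. rewrite !Cmod_opp.
  assert (A1 := K1 c ltac:(lra)). assert (A2 := K1 d ltac:(lra)).
  assert (A3 := K2 a ltac:(lra)). assert (A4 := K2 b ltac:(lra)). lra.
Qed.

Lemma cdiff_const c z : cdiff (fun _ => c) z 0.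
Proof. apply (hasd_const (cnear z)). Qed.
Lemma cdiff_id z : cdiff (fun w => w) z 1.
Proof. apply (hasd_coord (cnear z) (fun w => w)). Qed.
Lemma cdiff_plus F G z d e : cdiff F z d -> cdiff G z e -> cdiff (fun w => F w + G w) z (d + e).
Proof. apply (hasd_plus (cnear z)). Qed.
Lemma cdiff_minus F G z d e : cdiff F z d -> cdiff G z e -> cdiff (fun w => F w - G w) z (d - e).
Proof. apply (hasd_minus (cnear z)). Qed.
Lemma cdiff_scal c F z d : cdiff F z d -> cdiff (fun w => c * F w) z (c * d).
Proof. apply (hasd_scal (cnear z)). Qed.
Lemma cdiff_mult F G z d e :
  cdiff F z d -> cdiff G z e -> cdiff (fun w => F w * G w) z (d * G z + F z * e).
Proof. apply (hasd_mult (cnear z)). apply tends_id. Qed.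
Lemma cdiff_div F (G : C -> C) z d e : G z <> 0 ->
  cdiff F z d -> cdiff G z e -> cdiff (fun w => F w / G w) z ((d * G z - F z * e) / (G z * G z)).
Proof. apply (hasd_div (cnear z)). apply tends_id. Qed.
Lemma cdiff_comp F G z d e :
  cdiff F (G z) d -> cdiff G z e -> cdiff (fun w => F (G w)) z (d * e).
Proof. intros H1 H2. apply (hasd_comp (cnear z)); auto. apply tends_id. Qed.
Lemma cdiff_near F G z d : cnear z (fun w => F w = G w) -> cdiff F z d -> cdiff G z d.
Proof. intros H. apply (hasd_ext (cnear z)); auto. now apply cnear_self in H. Qed.

Lemma RectInt_affine al be a b c d : RectInt (fun w => al + be * w) a b c d = 0.
Proof.
  apply (RectInt_prim _ (fun w => al * w + be / 2 * (w * w))).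
  - intro z. tends_auto. apply tends_id.
  - intro z.
    replace (al + be * z) with (al * 1 + be / 2 * (1 * z + z * 1))
      by field.
    apply cdiff_plus; apply cdiff_scal; [apply cdiff_id|].
    apply cdiff_mult; apply cdiff_id.
Qed.

(** The sign of t - x0. The value 0 at x0 itself makes every nondegenerate interval that contains
    x0, even as an endpoint, see a jump of at least 1. *)
Definition step (x0 t : R) : R := if Rlt_dec t x0 then -1 else if Rlt_dec x0 t then 1 else 0.

Lemma step_bounds x0 t : (-1 <= step x0 t <= 1)%R.
Proof. unfold step. repeat destruct Rlt_dec; lra. Qed.

Lemma step_mono x0 s t : (s <= t)%R -> (step x0 s <= step x0 t)%R.
Proof. unfold step. repeat destruct Rlt_dec; lra. Qed.

Lemma step_jump x0 s t : (s <= x0 <= t)%R -> (s < t)%R -> (1 <= step x0 t - step x0 s)%R.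
Proof. unfold step. repeat destruct Rlt_dec; lra. Qed.

(* The exceptional point carries a point mass: the additive weight
   [(step b - step a) * (step d - step c) / 4] absorbs the failure of differentiability there. *)
Lemma goursat F z0 a b c d : ctsC F -> (forall z, z <> z0 -> exists D, cdiff F z D) ->
  (a <= b)%R -> (c <= d)%R -> RectInt F a b c d = 0.
Proof.
  intros HF HD Hab Hcd.
  set (mass := fun a b c d => ((step (fst z0) b - step (fst z0) a) *
                   (step (snd z0) d - step (snd z0) c) / 4)%R).
  assert (Mpos : forall a b c d, (a <= b)%R -> (c <= d)%R -> (0 <= mass a b c d)%R).
  { intros a' b' c' d' H1 H2. unfold mass. assert (X := step_mono (fst z0) _ _ H1).
    assert (Y := step_mono (snd z0) _ _ H2). nra. }
  (* The bound is exactly additive over the four quarters: each has half the semiperimeter, so four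
     squares of halves restore the square, and the mass telescopes. *)
  assert (Main : forall k, (0 < k)%R -> forall a b c d, (a <= b)%R -> (c <= d)%R ->
     (Cmod (RectInt F a b c d) <= k * ((b - a + (d - c)) * (b - a + (d - c)) + mass a b c d))%R).
  { intros k Hk. apply bisection_2d.
    - clear a b c d Hab Hcd. intros a b c d Hab Hcd H1 H2 H3 H4.
      rewrite <- (RectInt_split_y F a b c ((c + d) / 2) d HF),
        <- (RectInt_split_x F a ((a + b) / 2) b c _ HF), <- (RectInt_split_x F a ((a + b) / 2) b _ d HF).
      eapply Rle_trans; [apply Cmod_triangle|].
      eapply Rle_trans; [apply Rplus_le_compat; apply Cmod_triangle|].
      eapply Rle_trans; [apply Rplus_le_compat; apply Rplus_le_compat; eassumption|].
      right. unfold mass. field.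
    - intros x y. destruct (classic ((x, y) = z0)) as [E|E].
      + assert (Hc := HF z0 1%R ltac:(lra)). destruct Hc as [d0 [Hd0 Hc]].
        set (M := (Cmod (F z0) + 1)%R). assert (HM : (0 < M)%R) by (unfold M; generalize (Cmod_ge_0 (F z0)); lra).
        (* The width makes the semiperimeter at most k / (16 M), so that the crude estimate of the
           contour integral is at most k / 4, which the mass of at least 1/4 at the exceptional
           point absorbs. *)
        exists (Rmin (d0 / 2) (k / (32 * M)))%R. split.
        { apply Rmin_glb_lt; [lra|]. apply Rdiv_lt_0_compat; lra. }
        clear a b c d Hab Hcd. intros a b c d Hx Hy Hw Hh.
        assert (D1 := Rmin_l (d0 / 2) (k / (32 * M))). assert (D2 := Rmin_r (d0 / 2) (k / (32 * M))).
        assert (Hpos := Mpos a b c d ltac:(lra) ltac:(lra)).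
        assert (Hsq := Rle_0_sqr (b - a + (d - c))). unfold Rsqr in Hsq.
        assert (Hz : (0 <= k * ((b - a + (d - c)) * (b - a + (d - c)) + mass a b c d))%R)
          by (apply Rmult_le_pos; lra).
        (* A degenerate rectangle may carry no mass, but its contour integral is zero. *)
        destruct (Req_dec a b) as [Eab|Nab].
        { subst b. unfold RectInt. rewrite !CInt_point.
          replace (0 - 0 + Ci * (CInt (fun y0 => F (a, y0)) c d - CInt (fun y0 => F (a, y0)) c d))
            with (RtoC 0) by ring. rewrite Cmod_0. exact Hz. }
        destruct (Req_dec c d) as [Ecd|Ncd].
        { subst d. unfold RectInt. rewrite !CInt_point.
          replace (CInt (fun x0 => F (x0, c)) a b - CInt (fun x0 => F (x0, c)) a b + Ci * (0 - 0))
            with (RtoC 0) by ring. rewrite Cmod_0. exact Hz. }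
        assert (Hm : (1 / 4 <= mass a b c d)%R).
        { unfold mass. subst z0. simpl.
          assert (X := step_jump x a b Hx ltac:(lra)). assert (Y := step_jump y c d Hy ltac:(lra)). nra. }
        eapply Rle_trans; [apply (RectInt_bound F a b c d M); auto; try lra|].
        { intros x' y' Hx' Hy'.
          assert (Hc' := Hc (x', y')).
          assert (Hn : (Cmod ((x', y') - z0) < d0)%R).
          { eapply Rle_lt_trans; [apply Cmod_le_sum|]. subst z0. simpl.
            assert (Rabs (x' + - x) <= b - a)%R by (apply Rabs_le; lra).
            assert (Rabs (y' + - y) <= d - c)%R by (apply Rabs_le; lra). lra. }
          apply Hc' in Hn. assert (T := Cmod_rev_triangle (F (x', y')) (F z0)). unfold M. lra. }
        assert (Hs : (b - a + (d - c) <= k / (16 * M))%R).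
        { replace (k / (16 * M))%R with (k / (32 * M) + k / (32 * M))%R by (field; lra). lra. }
        apply Rle_trans with (4 * M * (k / (16 * M)))%R.
        { apply Rmult_le_compat_l; lra. }
        replace (4 * M * (k / (16 * M)))%R with (k * (1 / 4))%R by (field; lra).
        apply Rmult_le_compat_l; lra.
      + destruct (HD _ E) as [D HDz]. set (z := (x, y) : C) in *.
        assert (Heps := proj1 (hasd_eps _ _ _ _ _) HDz (k / 4)%R ltac:(lra)).
        destruct Heps as [d0 [Hd0 Heps]].
        exists (d0 / 2)%R. split; [lra|].
        clear a b c d Hab Hcd. intros a b c d Hx Hy Hw Hh.
        set (s := (b - a + (d - c))%R).
        assert (Hpos := Mpos a b c d ltac:(lra) ltac:(lra)).
        assert (HA : ctsC (fun w => (F z - D * z) + D * w)).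
        { intro w. tends_auto. apply tends_id. }
        (* Affine functions integrate to zero, so only the remainder of the first-order
           approximation has to be estimated. *)
        assert (HR := RectInt_minus F (fun w => (F z - D * z) + D * w) a b c d HF HA).
        rewrite RectInt_affine in HR.
        replace (RectInt F a b c d) with (RectInt F a b c d - 0) by ring. rewrite <- HR.
        apply Rle_trans with (4 * (k / 4 * s) * s)%R.
        { apply RectInt_bound; try lra.
          - intro w. apply (tends_minus (cnear w)); [apply HF|apply HA].
          - intros x' y' Hx' Hy'.
            assert (Hle : (Cmod ((x', y') - z) <= s)%R).
            { eapply Rle_trans; [apply Cmod_le_sum|]. simpl.
              assert (Rabs (x' + - x) <= b - a)%R by (apply Rabs_le; lra).
              assert (Rabs (y' + - y) <= d - c)%R by (apply Rabs_le; lra). unfold s. lra. }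
            assert (Hlt : (Cmod ((x', y') - z) < d0)%R) by (unfold s in Hle; lra).
            apply Heps in Hlt.
            replace (F (x', y') - (F z - D * z + D * (x', y')))
              with (F (x', y') - F z - D * ((x', y') - z)) by ring.
            eapply Rle_trans; [exact Hlt|]. apply Rmult_le_compat_l; lra. }
        replace (4 * (k / 4 * s) * s)%R with (k * (s * s))%R by field.
        apply Rmult_le_compat_l; lra. }
  apply Cmod_eq_0. apply Rle_antisym; [|apply Cmod_ge_0].
  apply le_epsilon. intros eps He. rewrite Rplus_0_l.
  set (s := (b - a + (d - c))%R). assert (Hs : (0 <= s * s)%R) by apply Rle_0_sqr.
  (* The mass never exceeds 1, hence the denominator s^2 + 1. *)
  assert (K := Main (eps / (s * s + 1))%R ltac:(apply Rdiv_lt_0_compat; lra) a b c d Hab Hcd).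
  fold s in K.
  assert (Hm : (mass a b c d <= 1)%R).
  { unfold mass. assert (X := step_mono (fst z0) _ _ Hab). assert (Y := step_mono (snd z0) _ _ Hcd).
    assert (X1 := step_bounds (fst z0) a). assert (X2 := step_bounds (fst z0) b).
    assert (Y1 := step_bounds (snd z0) c). assert (Y2 := step_bounds (snd z0) d). nra. }
  eapply Rle_trans; [exact K|].
  apply Rle_trans with (eps / (s * s + 1) * (s * s + 1))%R; [|right; field; lra].
  apply Rmult_le_compat_l; [|lra]. apply Rlt_le, Rdiv_lt_0_compat; lra.
Qed.

(** The primitive is the integral along a corner path from the origin. A vanishing rectangle
    integral turns its increment into an integral along a corner path starting at the point itself,
    where continuity of [F] applies. The point [z0] will be the base point of a difference
    quotient. *)
Lemma primitive_exists F z0 : ctsC F -> (forall z, z <> z0 -> exists D, cdiff F z D) ->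
  exists A, forall z, cdiff A z (F z).
Proof.
  intros HF HD.
  assert (HR : forall a b c d, RectInt F a b c d = 0).
  { intros a b c d. destruct (Rle_or_lt a b); destruct (Rle_or_lt c d).
    - now apply (goursat F z0).
    - rewrite RectInt_swap_y, (goursat F z0) by (auto; lra). ring.
    - rewrite RectInt_swap_x, (goursat F z0) by (auto; lra). ring.
    - rewrite RectInt_swap_x, RectInt_swap_y, (goursat F z0) by (auto; lra). ring. }
  exists (fun z => CInt (fun s => F (s, 0%R)) 0 (fst z) + Ci * CInt (fun s => F (fst z, s)) 0 (snd z)).
  intros [x y]. apply hasd_eps; [apply cnear_filter|]. intros eps He.
  destruct (HF (x, y) (eps / 4)%R ltac:(lra)) as [d [Hd HFd]].
  exists d. split; auto. intros [x' y'] Hw. simpl fst; simpl snd.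
  assert (E : CInt (fun s => F (s, 0%R)) 0 x' + Ci * CInt (fun s => F (x', s)) 0 y' -
    (CInt (fun s => F (s, 0%R)) 0 x + Ci * CInt (fun s => F (x, s)) 0 y) =
     CInt (fun s => F (s, y)) x x' + Ci * CInt (fun s => F (x', s)) y y').
  { assert (K := HR x x' 0 y). unfold RectInt in K.
    rewrite <- (CInt_Chasles (fun s => F (s, 0%R)) 0 x x') by now apply ctsR_F_horiz.
    rewrite <- (CInt_Chasles (fun s => F (x', s)) 0 y y') by now apply ctsR_F_vert.
    apply eq_of_Cminus. rewrite <- K. ring. }
  rewrite E.
  assert (E2 : CInt (fun s => F (s, y)) x x' + Ci * CInt (fun s => F (x', s)) y y' -
     F (x, y) * ((x', y') - (x, y)) =
     CInt (fun s => F (s, y) - F (x, y)) x x' + Ci * CInt (fun s => F (x', s) - F (x, y)) y y').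
  { assert (KC : forall a b, CInt (fun _ => F (x, y)) a b = F (x, y) * RtoC (b - a)).
    { intros a b. replace (F (x, y) * RtoC (b - a)) with (F (x, y) * RtoC b - F (x, y) * RtoC a)
        by (rewrite RtoC_minus; ring).
      apply (CInt_FTC (fun t => F (x, y) * RtoC t)); [|apply ctsR_const]. intro t.
      assert (Z := hasd_scal (locally t) RtoC t (F (x, y)) RtoC 1 (hasd_coord (locally t) RtoC t)).
      replace (F (x, y) * 1) with (F (x, y)) in Z by ring. exact Z. }
    rewrite (CInt_minus (fun s => F (s, y)) (fun _ => F (x, y))) by auto using ctsR_const, ctsR_F_horiz.
    rewrite (CInt_minus (fun s => F (x', s)) (fun _ => F (x, y))) by auto using ctsR_const, ctsR_F_vert.
    rewrite !KC.
    replace ((x', y') - (x, y)) with (RtoC (x' - x) + Ci * RtoC (y' - y)); 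
      [ring|].
    apply injective_projections; simpl; ring. }
  rewrite E2.
  assert (Hx : (Rabs (x' - x) <= Cmod ((x', y') - (x, y)))%R)
    by (apply (fst_le_Cmod ((x', y') - (x, y)))).
  assert (Hy : (Rabs (y' - y) <= Cmod ((x', y') - (x, y)))%R)
    by (apply (snd_le_Cmod ((x', y') - (x, y)))).
  assert (Hbx : forall s t u : R, (Rmin s t <= u <= Rmax s t)%R -> (Rabs (u - s) <= Rabs (t - s))%R).
  { intros s t u. unfold Rmin, Rmax. destruct Rle_dec; intros; unfold Rabs; repeat destruct Rcase_abs; lra. }
  assert (B1 : (Cmod (CInt (fun s => F (s, y) - F (x, y))%C x x') <= 2 * (eps / 4) * Rabs (x' - x))%R).
  { apply CInt_bound; [apply ctsR_minus; auto using ctsR_const, ctsR_F_horiz|].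
    intros t Ht. left. apply HFd. eapply Rle_lt_trans; [|exact Hw].
    eapply Rle_trans; [|exact Hx]. apply Hbx in Ht.
    replace ((t, y) - (x, y)) with (RtoC (t - x)); [now rewrite Cmod_R|].
    unfold RtoC, Cminus, Copp, Cplus; simpl; f_equal; ring. }
  assert (B2 : (Cmod (CInt (fun s => F (x', s) - F (x, y))%C y y') <= 2 * (eps / 4) * Rabs (y' - y))%R).
  { apply CInt_bound; [apply ctsR_minus; auto using ctsR_const, ctsR_F_vert|].
    intros t Ht. left. apply HFd. eapply Rle_lt_trans; [|exact Hw]. apply Hbx in Ht.
    unfold Cmod. apply sqrt_le_1_alt. simpl.
    assert (X := Rsqr_le_abs_1 _ _ Ht). unfold Rsqr in X. simpl in X. unfold Rminus in *. nra. }
  eapply Rle_trans; [apply Cmod_triangle|]. rewrite Cmod_mult, Cmod_Ci. nra.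
Qed.

(** * Cauchy's formula and the identity theorem *)

Definition hol (h dh : C -> C) : Prop := forall z, cdiff h z (dh z).

Lemma hol_cts h dh : hol h dh -> ctsC h.
Proof. intros H z. exact (cdiff_cts h z _ (H z)). Qed.

Definition zc (r t : R) : C := (r * cos t, r * sin t)%R.

Lemma zc_mod r t : (0 < r)%R -> Cmod (zc r t) = r.
Proof.
  intro H. unfold Cmod, zc; simpl.
  replace (r * cos t * (r * cos t * 1) + r * sin t * (r * sin t * 1))%R
    with (r * r * ((sin t)^2 + (cos t)^2))%R by ring.
  rewrite <- !Rsqr_pow2, sin2_cos2, Rmult_1_r. now apply sqrt_square, Rlt_le.
Qed.

Lemma zc_neq r t z : (Cmod z < r)%R -> zc r t - z <> 0.
Proof.
  intros H E. assert (0 < r)%R by (generalize (Cmod_ge_0 z); lra).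
  apply eq_of_Cminus in E. rewrite <- E, zc_mod in H by auto. lra.
Qed.

Lemma zc_neq0 r t : (0 < r)%R -> zc r t <> 0.
Proof. intros H E. apply (f_equal Cmod) in E. rewrite zc_mod, Cmod_0 in E; lra. Qed.

Lemma pdiff_zc r t : pdiff (zc r) t (Ci * zc r t).
Proof.
  replace (Ci * zc r t) with ((- (r * sin t))%R, (r * cos t)%R)
    by (apply injective_projections; simpl; ring).
  apply (pdiff_pair (fun s => r * cos s)%R (fun s => r * sin s)%R); auto_derive; auto; ring.
Qed.

Lemma ctsR_zc r : ctsR (zc r).
Proof. intro t. exact (pdiff_cts _ _ _ (pdiff_zc r t)). Qed.

Lemma zc_period r : zc r (2 * PI) = zc r 0.
Proof. unfold zc. now rewrite cos_2PI, sin_2PI, cos_0, sin_0. Qed.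

Lemma ctsR_bounded phi a b : (a <= b)%R -> ctsR phi ->
  exists M, (0 < M)%R /\ forall t, (a <= t <= b)%R -> (Cmod (phi t) <= M)%R.
Proof.
  intros Hab H.
  destruct (continuity_ab_maj (fun t => Rabs (fst (phi t)) + Rabs (snd (phi t)))%R a b Hab)
    as [m [Hm _]].
  - intros t _. apply continuity_pt_plus; apply (continuity_pt_comp _ Rabs);
      try apply Rcontinuity_abs; apply continuity_pt_filterlim.
    + now apply tends_fst.
    + now apply tends_snd.
  - exists (Rabs (fst (phi m)) + Rabs (snd (phi m)) + 1)%R. split.
    + generalize (Rabs_pos (fst (phi m))) (Rabs_pos (snd (phi m))). lra.
    + intros t Ht. eapply Rle_trans; [apply Cmod_le_sum|]. specialize (Hm t Ht). lra.
Qed.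

(** Differentiation under the integral sign: the kernel has a quadratic remainder uniformly in t, so
    the remainder of the integral is quadratic too. *)
Lemma kernel_diff phi (k : R -> C -> C) (k' : R -> C) (a b rho M : R) z :
  (a <= b)%R -> (0 < rho)%R -> (0 <= M)%R -> ctsR phi ->
  (forall w, (Cmod (w - z) < rho)%R -> ctsR (fun t => k t w)) -> ctsR k' ->
  (forall t w, (Cmod (w - z) < rho)%R ->
     (Cmod (k t w - k t z - (w - z) * k' t) <= M * (Cmod (w - z) * Cmod (w - z)))%R) ->
  cdiff (fun w => CInt (fun t => phi t * k t w) a b) z (CInt (fun t => phi t * k' t) a b).
Proof.
  intros Hab Hrho HM Hphi Hk Hk' Hb. apply hasd_eps; [apply cnear_filter|]. intros eps He.
  destruct (ctsR_bounded phi a b Hab Hphi) as [B [HB HBp]].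
  set (L := (2 * (B * M) * (b - a) + 1)%R).
  assert (HBM : (0 <= B * M)%R) by (apply Rmult_le_pos; lra).
  assert (HL0 : (0 <= 2 * (B * M) * (b - a))%R) by (apply Rmult_le_pos; lra).
  assert (HL : (0 < L)%R) by (unfold L; lra).
  exists (Rmin rho (eps / L))%R. split.
  { apply Rmin_glb_lt; auto. apply Rdiv_lt_0_compat; lra. }
  intros w Hw.
  assert (Hw1 : (Cmod (w - z) < rho)%R) by (eapply Rlt_le_trans; [exact Hw|apply Rmin_l]).
  assert (Hw2 : (Cmod (w - z) < eps / L)%R) by (eapply Rlt_le_trans; [exact Hw|apply Rmin_r]).
  assert (Hz : (Cmod (z - z) < rho)%R)
    by (replace (z - z) with (RtoC 0) by ring; now rewrite Cmod_0).
  assert (Hkw := Hk w Hw1). assert (Hkz := Hk z Hz).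
  assert (E : CInt (fun t => phi t * k t w) a b - CInt (fun t => phi t * k t z) a b -
     CInt (fun t => phi t * k' t) a b * (w - z) =
     CInt (fun t => phi t * (k t w - k t z - (w - z) * k' t)) a b).
  { rewrite (CInt_ext (fun t => phi t * (k t w - k t z - (w - z) * k' t))
       (fun t => (phi t * k t w - phi t * k t z) - (w - z) * (phi t * k' t)))
      by (intro; ring).
    rewrite (CInt_minus (fun t => phi t * k t w - phi t * k t z) (fun t => (w - z) * (phi t * k' t))).
    - rewrite (CInt_minus (fun t => phi t * k t w) (fun t => phi t * k t z)),
        (CInt_scal (w - z) (fun t => phi t * k' t)) by auto using ctsR_mult. ring.
    - apply ctsR_minus; auto using ctsR_mult.
    - apply ctsR_mult; auto using ctsR_mult, ctsR_const. }
  rewrite E. set (u := Cmod (w - z)) in *.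
  assert (Hu : (0 <= u)%R) by apply Cmod_ge_0.
  apply Rle_trans with (2 * (B * (M * (u * u))) * Rabs (b - a))%R.
  - apply CInt_bound.
    + apply ctsR_mult; auto. apply ctsR_minus; [apply ctsR_minus; auto|].
      apply ctsR_mult; auto using ctsR_const.
    + intros t Ht. rewrite Rmin_left, Rmax_right in Ht by lra. rewrite Cmod_mult.
      apply Rmult_le_compat; try apply Cmod_ge_0; auto.
  - rewrite Rabs_pos_eq by lra.
    replace (2 * (B * (M * (u * u))) * (b - a))%R with (2 * (B * M) * (b - a) * u * u)%R by ring.
    apply Rmult_le_compat_r; auto.
    apply Rle_trans with (L * (eps / L))%R; [|right; field; lra].
    apply Rle_trans with (L * u)%R; [apply Rmult_le_compat_r; unfold L; lra|].
    apply Rmult_le_compat_l; lra.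
Qed.

(** Cauchy integrals against dt. Since dz = i z dt on the circle, the density h(z) z yields 2 pi h,
    without the factor i. The two integrals after this one are its first and second derivatives in
    z. *)
Definition cauchy1 (phi : R -> C) (r : R) (z : C) : C :=
  CInt (fun t => phi t * / (zc r t - z)) 0 (2 * PI).
Definition cauchy2 (phi : R -> C) (r : R) (z : C) : C :=
  CInt (fun t => phi t * (/ (zc r t - z) * / (zc r t - z))) 0 (2 * PI).
Definition cauchy3 (phi : R -> C) (r : R) (z : C) : C :=
  CInt (fun t => phi t * (RtoC 2 * (/ (zc r t - z) * / (zc r t - z) * / (zc r t - z)))) 0 (2 * PI).

Lemma ctsR_kernel r z : (Cmod z < r)%R -> ctsR (fun t => / (zc r t - z)).
Proof.
  intro H. apply ctsR_inv; [intro; now apply zc_neq|].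
  apply ctsR_minus; [apply ctsR_zc|apply ctsR_const].
Qed.

Lemma kernel_bound r z t : (Cmod z < r)%R -> (Cmod (/ (zc r t - z)) <= / (r - Cmod z))%R.
Proof.
  intro H. rewrite Cmod_inv by now apply zc_neq.
  apply Rinv_le_contravar; [lra|].
  assert (T := Cmod_rev_triangle (zc r t) z). rewrite zc_mod in T; auto.
  generalize (Cmod_ge_0 z). lra.
Qed.

Lemma two_PI_pos : (0 < 2 * PI)%R.
Proof. generalize PI_RGT_0. lra. Qed.

Lemma cauchy1_diff phi r z : ctsR phi -> (Cmod z < r)%R -> cdiff (cauchy1 phi r) z (cauchy2 phi r z).
Proof.
  (* Within (r - |z|) / 2 of z the distance to the circle is still at least 1 / A, so [A] bounds
     both kernels. *)
  intros Hphi Hz. set (A := (2 / (r - Cmod z))%R).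
  assert (HA : (0 < A)%R) by (apply Rdiv_lt_0_compat; lra).
  assert (Hball : forall w, (Cmod (w - z) < (r - Cmod z) / 2)%R -> (Cmod w < (r + Cmod z) / 2)%R).
  { intros w Hw. assert (T := Cmod_rev_triangle w z). lra. }
  apply (kernel_diff phi (fun t w => / (zc r t - w)) (fun t => / (zc r t - z) * / (zc r t - z))
    0 (2 * PI) ((r - Cmod z) / 2) (A * A * A)); auto.
  - apply Rlt_le, two_PI_pos.
  - lra.
  - apply Rmult_le_pos; [apply Rmult_le_pos|]; lra.
  - intros w Hw. apply Hball in Hw. apply ctsR_kernel. lra.
  - apply ctsR_mult; now apply ctsR_kernel.
  - intros t w Hw. apply Hball in Hw.
    assert (N1 : zc r t - w <> 0) by (apply zc_neq; lra).
    assert (N2 : zc r t - z <> 0) by (apply zc_neq; lra).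
    assert (B1 : (Cmod (/ (zc r t - w)) <= A)%R).
    { eapply Rle_trans; [apply kernel_bound; lra|]. unfold A.
      replace (2 / (r - Cmod z))%R with (/ ((r - Cmod z) / 2))%R by (field; lra).
      apply Rinv_le_contravar; lra. }
    assert (B2 : (Cmod (/ (zc r t - z)) <= A)%R).
    { eapply Rle_trans; [apply kernel_bound; lra|]. unfold A.
      replace (2 / (r - Cmod z))%R with (/ ((r - Cmod z) / 2))%R by (field; lra).
      apply Rinv_le_contravar; lra. }
    replace (/ (zc r t - w) - / (zc r t - z) - (w - z) * (/ (zc r t - z) * / (zc r t - z)))
      with ((/ (zc r t - w) * / (zc r t - z) * / (zc r t - z)) * ((w - z) * (w - z)))
      by (field; auto).
    rewrite Cmod_mult, (Cmod_mult (w - z)).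
    apply Rmult_le_compat_r; [apply Rmult_le_pos; apply Cmod_ge_0|].
    rewrite !Cmod_mult. repeat apply Rmult_le_compat; auto; try apply Cmod_ge_0.
    apply Rmult_le_pos; apply Cmod_ge_0.
Qed.

Lemma cauchy2_diff phi r z : ctsR phi -> (Cmod z < r)%R -> cdiff (cauchy2 phi r) z (cauchy3 phi r z).
Proof.
  intros Hphi Hz. set (A := (2 / (r - Cmod z))%R).
  assert (HA : (0 < A)%R) by (apply Rdiv_lt_0_compat; lra).
  assert (Hball : forall w, (Cmod (w - z) < (r - Cmod z) / 2)%R -> (Cmod w < (r + Cmod z) / 2)%R).
  { intros w Hw. assert (T := Cmod_rev_triangle w z). lra. }
  apply (kernel_diff phi (fun t w => / (zc r t - w) * / (zc r t - w))
    (fun t => RtoC 2 * (/ (zc r t - z) * / (zc r t - z) * / (zc r t - z)))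
    0 (2 * PI) ((r - Cmod z) / 2) (A * A * A * (3 * A))); auto.
  - apply Rlt_le, two_PI_pos.
  - lra.
  - apply Rmult_le_pos; [apply Rmult_le_pos; [apply Rmult_le_pos|]|]; lra.
  - intros w Hw. apply Hball in Hw. apply ctsR_mult; apply ctsR_kernel; lra.
  - apply ctsR_mult; [apply ctsR_const|]. repeat apply ctsR_mult; now apply ctsR_kernel.
  - intros t w Hw. apply Hball in Hw.
    assert (N1 : zc r t - w <> 0) by (apply zc_neq; lra).
    assert (N2 : zc r t - z <> 0) by (apply zc_neq; lra).
    assert (B1 : (Cmod (/ (zc r t - w)) <= A)%R).
    { eapply Rle_trans; [apply kernel_bound; lra|]. unfold A.
      replace (2 / (r - Cmod z))%R with (/ ((r - Cmod z) / 2))%R by (field; lra).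
      apply Rinv_le_contravar; lra. }
    assert (B2 : (Cmod (/ (zc r t - z)) <= A)%R).
    { eapply Rle_trans; [apply kernel_bound; lra|]. unfold A.
      replace (2 / (r - Cmod z))%R with (/ ((r - Cmod z) / 2))%R by (field; lra).
      apply Rinv_le_contravar; lra. }
    (* With a and b the kernels at w and z, the remainder is a b^2 (a + 2 b) (w - z)^2; this is the
       origin of the constant 3 A^4. *)
    replace (/ (zc r t - w) * / (zc r t - w) - / (zc r t - z) * / (zc r t - z) -
       (w - z) * (RtoC 2 * (/ (zc r t - z) * / (zc r t - z) * / (zc r t - z))))
      with ((/ (zc r t - w) * / (zc r t - z) * / (zc r t - z)) *
          (/ (zc r t - w) + RtoC 2 * / (zc r t - z)) * ((w - z) * (w - z)))
      by (field; auto).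
    rewrite Cmod_mult, (Cmod_mult (w - z)).
    apply Rmult_le_compat_r; [apply Rmult_le_pos; apply Cmod_ge_0|].
    rewrite Cmod_mult. apply Rmult_le_compat; try apply Cmod_ge_0.
    + rewrite !Cmod_mult. repeat apply Rmult_le_compat; auto; try apply Cmod_ge_0.
      apply Rmult_le_pos; apply Cmod_ge_0.
    + eapply Rle_trans; [apply Cmod_triangle|]. rewrite Cmod_mult, Cmod_R, Rabs_pos_eq by lra. lra.
Qed.

(** The real mean value theorem is applied to each coordinate, which costs the factor 2. With M = 0
    it says that paths of zero velocity have equal ends, its most frequent use. *)
Lemma path_mean_value phi dphi M :
  (forall t, (0 <= t <= 1)%R -> pdiff phi t (dphi t)) ->
  (forall t, (0 <= t <= 1)%R -> (Cmod (dphi t) <= M)%R) ->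
  (Cmod (phi 1%R - phi 0%R) <= 2 * M)%R.
Proof.
  intros H HM.
  destruct (mvt_strict (fun t => fst (phi t)) (fun t => fst (dphi t)) 0 1) as [c [Hc E]]; [lra| |].
  { intros t Ht. now apply pdiff_fst, H. }
  destruct (mvt_strict (fun t => snd (phi t)) (fun t => snd (dphi t)) 0 1) as [c' [Hc' E']]; [lra| |].
  { intros t Ht. now apply pdiff_snd, H. }
  eapply Rle_trans; [apply Cmod_le_sum|]. simpl. unfold Rminus in *. rewrite E, E'.
  replace (1 + - 0)%R with 1%R by ring. rewrite !Rmult_1_r.
  assert (X := fst_le_Cmod (dphi c)). assert (Y := snd_le_Cmod (dphi c')).
  assert (X1 := HM c ltac:(lra)). assert (Y1 := HM c' ltac:(lra)). lra.
Qed.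

Lemma pdiff_seg z0 z1 t : pdiff (fun s => z0 + RtoC s * (z1 - z0)) t (z1 - z0).
Proof.
  assert (Z : pdiff (fun s => z0 + RtoC s * (z1 - z0)) t (0 + (1 * (z1 - z0) + RtoC t * 0)));
    [|replace (0 + (1 * (z1 - z0) + RtoC t * 0)) with (z1 - z0) in Z by ring; exact Z].
  apply (hasd_plus (locally t)); [apply (hasd_const (locally t))|].
  apply (hasd_mult (locally t) RtoC t RtoC (fun _ => z1 - z0));
    [apply tends_RtoC|apply (hasd_coord (locally t))|apply (hasd_const (locally t))].
Qed.

(** The derivative in z is the integral of an exact derivative around a closed circle, hence zero;
    the integral is therefore constant on the disc and is evaluated at the centre. *)
Lemma cauchy1_one r z : (Cmod z < r)%R -> cauchy1 (zc r) r z = RtoC (2 * PI).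
Proof.
  intro Hz. assert (Hr : (0 < r)%R) by (generalize (Cmod_ge_0 z); lra).
  assert (H0 : forall w, (Cmod w < r)%R -> cauchy2 (zc r) r w = 0).
  { intros w Hw.
    assert (E : CInt (fun t => - (Ci * zc r t / ((zc r t - w) * (zc r t - w)))) 0 (2 * PI) =
      / (zc r (2 * PI) - w) - / (zc r 0 - w)).
    { apply (CInt_FTC (fun t => / (zc r t - w))).
      - intro t. apply (hasd_inv (locally t)); [apply tends_RtoC|now apply zc_neq|].
        replace (Ci * zc r t) with (Ci * zc r t - 0) by ring.
        apply (hasd_minus (locally t)); [apply pdiff_zc|apply (hasd_const (locally t))].
      - intro t. assert (Q := ctsR_zc r t). tends_auto. apply Cmult_neq_0; now apply zc_neq. }
    rewrite zc_period in E. replace (/ (zc r 0 - w) - / (zc r 0 - w)) with (RtoC 0) in E by ring.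
    unfold cauchy2.
    rewrite (CInt_ext _ (fun t => Ci * (- (Ci * zc r t / ((zc r t - w) * (zc r t - w)))))).
    - rewrite CInt_scal, E; [ring|]. intro t. assert (Q := ctsR_zc r t). tends_auto.
      apply Cmult_neq_0; now apply zc_neq.
    - intro t. replace (Ci * - (Ci * zc r t / ((zc r t - w) * (zc r t - w))))
        with (- (Ci * Ci) * (zc r t / ((zc r t - w) * (zc r t - w)))) by (field; now apply zc_neq).
      replace (- (Ci * Ci)) with (RtoC 1) by (apply injective_projections; simpl; ring).
      field. now apply zc_neq. }
  assert (E0 : cauchy1 (zc r) r 0 = RtoC (2 * PI)).
  { unfold cauchy1. rewrite (CInt_ext _ (fun _ => 1)).
    - rewrite (CInt_FTC RtoC (fun _ => 1)).
      + rewrite <- RtoC_minus. f_equal. ring.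
      + intro t. apply (hasd_coord (locally t)).
      + apply ctsR_const.
    - intro t. replace (zc r t - 0) with (zc r t) by ring. field. now apply zc_neq0. }
  rewrite <- E0. apply eq_of_Cminus, Cmod_eq_0, Rle_antisym; [|apply Cmod_ge_0].
  apply Rle_trans with (2 * 0)%R; [|lra].
  assert (P := path_mean_value (fun s => cauchy1 (zc r) r (0 + RtoC s * (z - 0))) (fun _ => 0) 0).
  cbv beta in P. replace (0 + 1 * (z - 0)) with z in P by ring.
  replace (0 + 0 * (z - 0)) with (RtoC 0) in P by ring. apply P.
  - intros t Ht. assert (Hm : (Cmod (0 + RtoC t * (z - 0)) < r)%R).
    { replace (0 + RtoC t * (z - 0)) with (RtoC t * z) by ring.
      rewrite Cmod_mult, Cmod_R, Rabs_pos_eq by lra. assert (X := Cmod_ge_0 z). nra. }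
    assert (Z := pdiff_comp (fun s => 0 + RtoC s * (z - 0)) t _ (cauchy1 (zc r) r) _
      (pdiff_seg 0 z t) (cauchy1_diff _ r _ (ctsR_zc r) Hm)).
    rewrite H0 in Z by auto. replace (0 * (z - 0)) with (RtoC 0) in Z by ring. exact Z.
  - intros. rewrite Cmod_0. lra.
Qed.

(** The difference quotient of [h] at z, completed by [dh z], is continuous everywhere and
    differentiable away from z. It therefore has a primitive, and its integral around the circle is
    zero. *)
Lemma cauchy_formula h dh r z : hol h dh -> (Cmod z < r)%R ->
  cauchy1 (fun t => h (zc r t) * zc r t) r z = RtoC (2 * PI) * h z.
Proof.
  intros Hh Hz. assert (Hr : (0 < r)%R) by (generalize (Cmod_ge_0 z); lra).
  set (q := fun w => if excluded_middle_informative (w = z) then dh z else (h w - h z) / (w - z)).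
  assert (Hq : ctsC q /\ forall w, w <> z -> exists D, cdiff q w D).
  { assert (Hd : forall w, w <> z -> exists D, cdiff q w D).
    { intros w Hw. eexists. eapply cdiff_near.
      2: { apply (cdiff_div (fun v => h v - h z) (fun v => v - z)).
           - now apply Cminus_neq0.
           - apply cdiff_minus; [apply Hh|apply cdiff_const].
           - apply cdiff_minus; [apply cdiff_id|apply cdiff_const]. }
      exists (Cmod (w - z)). split; [apply Cmod_gt_0; now apply Cminus_neq0|].
      intros v Hv. unfold q. destruct excluded_middle_informative as [E|E]; auto.
      subst v. rewrite Cmod_sub_sym in Hv. lra. }
    split; auto. intro w. destruct (classic (w = z)) as [->|Hn].
    - unfold q at 2. destruct excluded_middle_informative as [_|E]; [|congruence].
      destruct (Hh z) as [p [Hp Hp']].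
      intros e He. eapply filter_imp; [|apply filter_and; [exact Hp'|exact (Hp e He)]].
      cbv beta. intros v [E1 E2]. unfold q.
      destruct excluded_middle_informative as [E|E].
      + replace (dh z - dh z) with (RtoC 0) by ring. now rewrite Cmod_0.
      + replace ((h v - h z) / (v - z)) with (p v); auto. rewrite E1. field.
        now apply Cminus_neq0.
    - destruct (Hd w Hn) as [D HD]. exact (cdiff_cts _ _ _ HD). }
  destruct Hq as [Hqc Hqd].
  destruct (primitive_exists q z Hqc Hqd) as [A HA].
  assert (Hz0 : CInt (fun t => q (zc r t) * (Ci * zc r t)) 0 (2 * PI) = 0).
  { rewrite (CInt_FTC (fun t => A (zc r t))).
    - rewrite zc_period. ring.
    - intro t. apply (pdiff_comp (zc r)); [apply pdiff_zc|apply HA].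
    - apply ctsR_mult; [apply ctsR_comp; auto using ctsR_zc|].
      apply ctsR_mult; auto using ctsR_const, ctsR_zc. }
  assert (Hch : ctsR (fun t => h (zc r t) * zc r t)).
  { apply ctsR_mult; [apply ctsR_comp; [exact (hol_cts h dh Hh)|]|]; apply ctsR_zc. }
  assert (Hzk := ctsR_kernel r z Hz).
  assert (E : CInt (fun t => q (zc r t) * (Ci * zc r t)) 0 (2 * PI) =
     Ci * (cauchy1 (fun t => h (zc r t) * zc r t) r z - h z * cauchy1 (zc r) r z)).
  { unfold cauchy1. rewrite <- CInt_scal by (apply ctsR_mult; auto using ctsR_zc).
    rewrite <- CInt_minus by (apply ctsR_mult; auto using ctsR_const; apply ctsR_mult; auto using ctsR_zc).
    rewrite <- CInt_scal.
    - apply CInt_ext. intro t. unfold q. assert (Hn := zc_neq r t z Hz).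
      destruct excluded_middle_informative as [E|E].
      + exfalso. apply Hn. rewrite E. ring.
      + field. auto.
    - apply ctsR_minus; apply ctsR_mult; auto using ctsR_const; apply ctsR_mult; auto using ctsR_zc. }
  rewrite cauchy1_one in E by auto. rewrite Hz0 in E.
  assert (E' : Ci * (Ci * (cauchy1 (fun t => h (zc r t) * zc r t) r z - h z * RtoC (2 * PI))) = 0)
    by (rewrite <- E; ring).
  assert (E2 : cauchy1 (fun t => h (zc r t) * zc r t) r z - h z * RtoC (2 * PI) = 0).
  { replace (cauchy1 (fun t => h (zc r t) * zc r t) r z - h z * RtoC (2 * PI)) with
     (- (Ci * (Ci * (cauchy1 (fun t => h (zc r t) * zc r t) r z - h z * RtoC (2 * PI)))));
     [rewrite E'; ring|].
    replace (Ci * (Ci * (cauchy1 (fun t => h (zc r t) * zc r t) r z - h z * RtoC (2 * PI))))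
      with ((Ci * Ci) * (cauchy1 (fun t => h (zc r t) * zc r t) r z - h z * RtoC (2 * PI))) by ring.
    replace (Ci * Ci) with (- RtoC 1) by (apply injective_projections; simpl; ring). ring. }
  apply eq_of_Cminus in E2. rewrite E2. ring.
Qed.

Lemma RtoC_2PI_neq0 : RtoC (2 * PI) <> 0.
Proof. intro H. apply RtoC_inj in H. generalize two_PI_pos. lra. Qed.

(** Cauchy's formula makes [h] a Cauchy integral near each point; by uniqueness of derivatives [dh]
    is the differentiated integral, which can be differentiated once more. *)
Lemma hol_derivative h dh : hol h dh -> exists d2, hol dh d2.
Proof.
  intro Hh.
  assert (K : forall z, exists d, cdiff dh z d).
  { intro z. set (r := (Cmod z + 1)%R). assert (Hz : (Cmod z < r)%R) by (unfold r; lra).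
    set (phi := fun t => h (zc r t) * zc r t).
    assert (Hphi : ctsR phi).
    { apply ctsR_mult; [apply ctsR_comp; [exact (hol_cts h dh Hh)|]|]; apply ctsR_zc. }
    assert (Hopen : forall w, (Cmod w < r)%R -> cnear w (fun v => (Cmod v < r)%R)).
    { intros w Hw. exists (r - Cmod w)%R. split; [lra|]. intros v Hv.
      assert (T := Cmod_rev_triangle v w). lra. }
    assert (E : forall w, (Cmod w < r)%R -> / RtoC (2 * PI) * cauchy2 phi r w = dh w).
    { intros w Hw. apply (cdiff_unique h w); [|apply Hh].
      eapply cdiff_near; [|apply (cdiff_scal _ (cauchy1 phi r)); apply cauchy1_diff; auto].
      eapply filter_imp; [|apply (Hopen w Hw)]. intros v Hv. cbv beta.
      unfold phi. rewrite (cauchy_formula h dh r v Hh Hv). field. apply RtoC_2PI_neq0. }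
    exists (/ RtoC (2 * PI) * cauchy3 phi r z).
    eapply cdiff_near; [|apply (cdiff_scal _ (cauchy2 phi r)); apply cauchy2_diff; auto].
    eapply filter_imp; [|apply (Hopen z Hz)]. intros v Hv. now apply E. }
  exists (fun z => proj1_sig (constructive_indefinite_description _ (K z))).
  intro z. exact (proj2_sig (constructive_indefinite_description _ (K z))).
Qed.

(** T n is 2 pi times the n-th Taylor quotient at 0, written as a Cauchy integral: T n w = T n 0 + w
    T (n+1) w. Accumulating zeros force T n 0 = 0 for every n, so 2 pi h z = z^n T n z, which decays
    like (|z| / r)^n. *)
Lemma identity_at_0 h dh : hol h dh ->
  (forall e, (0 < e)%R -> exists z : C, z <> 0 /\ (Cmod z < e)%R /\ h z = 0) ->
  forall z, h z = 0.
Proof.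
  (* Radius |z| + 1 puts z at distance at least 1 from the circle, so the kernel is bounded by 1. *)
  intros Hh Hac z. set (r := (Cmod z + 1)%R).
  assert (Hz : (Cmod z < r)%R) by (unfold r; lra).
  assert (Hr : (0 < r)%R) by (generalize (Cmod_ge_0 z); unfold r; lra).
  set (phi := fun n t => h (zc r t) * zc r t * Cpow (/ zc r t) n).
  assert (Hci : ctsR (fun t => / zc r t)).
  { apply ctsR_inv; [intro; now apply zc_neq0|apply ctsR_zc]. }
  assert (Hch : ctsR (fun t => h (zc r t) * zc r t)).
  { apply ctsR_mult; [apply ctsR_comp; [exact (hol_cts h dh Hh)|]|]; apply ctsR_zc. }
  assert (Hphi : forall n, ctsR (phi n)).
  { intro n. apply ctsR_mult; auto. intro t. apply (tends_pow (locally t)). apply Hci. }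
  set (T := fun n w => cauchy1 (phi n) r w).
  assert (HT0 : forall w, (Cmod w < r)%R -> T 0%nat w = RtoC (2 * PI) * h w).
  { intros w Hw. rewrite <- (cauchy_formula h dh r w Hh Hw). unfold T, cauchy1. apply CInt_ext.
    intro t. unfold phi. simpl. ring. }
  assert (H0r : (Cmod 0 < r)%R) by now rewrite Cmod_0.
  assert (HTS : forall n w, (Cmod w < r)%R -> T n w = T n 0 + w * T (S n) w).
  { intros n w Hw. unfold T, cauchy1.
    rewrite <- CInt_scal by (apply ctsR_mult; auto; now apply ctsR_kernel).
    rewrite <- CInt_plus.
    - apply CInt_ext. intro t. unfold phi. simpl.
      assert (N0 := zc_neq0 r t Hr). assert (N1 := zc_neq r t w Hw).
      assert (N2 := zc_neq r t 0 H0r). field. auto.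
    - apply ctsR_mult; auto. now apply ctsR_kernel.
    - apply ctsR_mult; [apply ctsR_const|]. apply ctsR_mult; auto. now apply ctsR_kernel. }
  assert (HT : forall n, (forall w, (Cmod w < r)%R -> w <> 0 -> h w = 0 -> T n w = 0) /\ T n 0 = 0).
  { induction n.
    - assert (Q : forall w, (Cmod w < r)%R -> w <> 0 -> h w = 0 -> T 0%nat w = 0).
      { intros w Hw _ E. rewrite HT0, E by auto. ring. }
      split; auto.
      apply NNPP. intro Hn. assert (Hp := proj1 (Cmod_gt_0 _) Hn).
      destruct (cdiff_cts _ _ _ (cauchy1_diff (phi 0%nat) r 0 (Hphi 0%nat) H0r) _ Hp) as [d [Hd Hc]].
      destruct (Hac (Rmin d r)) as [w [W1 [W2 W3]]]; [now apply Rmin_glb_lt|].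
      specialize (Hc w). replace (w - 0) with w in Hc by ring.
      specialize (Hc (Rlt_le_trans _ _ _ W2 (Rmin_l _ _))).
      fold (T 0%nat w) in Hc. fold (T 0%nat 0) in Hc.
      rewrite (Q w) in Hc; auto; [|eapply Rlt_le_trans; [exact W2|apply Rmin_r]].
      replace (0 - T 0%nat 0) with (- T 0%nat 0) in Hc by ring. rewrite Cmod_opp in Hc. lra.
    - destruct IHn as [IH1 IH2].
      assert (Q : forall w, (Cmod w < r)%R -> w <> 0 -> h w = 0 -> T (S n) w = 0).
      { intros w Hw Hn E. assert (X := HTS n w Hw). rewrite IH2, (IH1 w Hw Hn E) in X.
        replace (T (S n) w) with ((0 + w * T (S n) w) / w) by (field; auto).
        rewrite <- X. field. auto. }
      split; auto.
      apply NNPP. intro Hn. assert (Hp := proj1 (Cmod_gt_0 _) Hn).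
      destruct (cdiff_cts _ _ _ (cauchy1_diff (phi (S n)) r 0 (Hphi (S n)) H0r) _ Hp) as [d [Hd Hc]].
      destruct (Hac (Rmin d r)) as [w [W1 [W2 W3]]]; [now apply Rmin_glb_lt|].
      specialize (Hc w). replace (w - 0) with w in Hc by ring.
      specialize (Hc (Rlt_le_trans _ _ _ W2 (Rmin_l _ _))).
      fold (T (S n) w) in Hc. fold (T (S n) 0) in Hc.
      rewrite (Q w) in Hc; auto; [|eapply Rlt_le_trans; [exact W2|apply Rmin_r]].
      replace (0 - T (S n) 0) with (- T (S n) 0) in Hc by ring. rewrite Cmod_opp in Hc. lra. }
  assert (HTp : forall n, T 0%nat z = Cpow z n * T n z).
  { induction n; [simpl; ring|]. rewrite IHn, (HTS n z Hz), (proj2 (HT n)). simpl. ring. }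
  destruct (ctsR_bounded _ 0 (2 * PI) (Rlt_le _ _ two_PI_pos) Hch) as [B [HB HBd]].
  assert (HTb : forall n, (Cmod (T n z) <= 2 * (B * (/ r) ^ n) * (2 * PI))%R).
  { intro n. unfold T, cauchy1.
    assert (Y := CInt_bound (fun t => phi n t * / (zc r t - z)) 0 (2 * PI) (B * (/ r) ^ n)).
    rewrite Rminus_0_r, (Rabs_pos_eq (2 * PI)) in Y by (apply Rlt_le, two_PI_pos).
    apply Y.
    - apply ctsR_mult; auto. now apply ctsR_kernel.
    - intros t Ht. rewrite Rmin_left, Rmax_right in Ht by (apply Rlt_le, two_PI_pos).
      unfold phi. rewrite Cmod_mult, (Cmod_mult _ (Cpow _ _)), Cmod_pow, Cmod_inv, zc_mod
        by auto using zc_neq0.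
      rewrite <- (Rmult_1_r (B * (/ r) ^ n)).
      assert (Hp : (0 <= (/ r) ^ n)%R) by (apply pow_le, Rlt_le, Rinv_0_lt_compat; auto).
      apply Rmult_le_compat; try apply Cmod_ge_0.
      + apply Rmult_le_pos; auto. apply Cmod_ge_0.
      + apply Rmult_le_compat_r; auto.
      + eapply Rle_trans; [apply kernel_bound; auto|]. unfold r.
        replace (Cmod z + 1 - Cmod z)%R with 1%R by ring. rewrite Rinv_1. lra. }
  assert (HT0z : T 0%nat z = 0).
  { apply Cmod_eq_0, Rle_antisym; [|apply Cmod_ge_0].
    apply le_epsilon. intros e He. rewrite Rplus_0_l.
    set (M := (2 * B * (2 * PI))%R).
    assert (HM : (0 < M)%R) by (unfold M; generalize two_PI_pos; intro; apply Rmult_lt_0_compat; lra).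
    assert (Hq : (0 <= Cmod z * / r < 1)%R).
    { split.
      - apply Rmult_le_pos; [apply Cmod_ge_0|]. now apply Rlt_le, Rinv_0_lt_compat.
      - apply Rmult_lt_reg_r with r; auto. rewrite Rmult_assoc, Rinv_l; lra. }
    destruct (pow_lt_1_zero (Cmod z * / r)%R) with (y := (e / M)%R) as [N HN].
    { rewrite Rabs_pos_eq; lra. }
    { apply Rdiv_lt_0_compat; lra. }
    specialize (HN N (le_n _)). rewrite Rabs_pos_eq in HN by (apply pow_le; lra).
    rewrite (HTp N), Cmod_mult, Cmod_pow.
    apply Rle_trans with (Cmod z ^ N * (2 * (B * (/ r) ^ N) * (2 * PI)))%R.
    { apply Rmult_le_compat_l; auto. apply pow_le, Cmod_ge_0. }
    replace (Cmod z ^ N * (2 * (B * (/ r) ^ N) * (2 * PI)))%R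
      with (M * (Cmod z * / r) ^ N)%R by (rewrite Rpow_mult_distr; unfold M; ring).
    apply Rlt_le, Rlt_le_trans with (M * (e / M))%R; [now apply Rmult_lt_compat_l|].
    right. field. lra. }
  rewrite HT0 in HT0z by auto.
  replace (h z) with (/ RtoC (2 * PI) * (RtoC (2 * PI) * h z)) by (field; apply RtoC_2PI_neq0).
  rewrite HT0z. ring.
Qed.

Lemma identity_theorem h dh z0 : hol h dh ->
  (forall e, (0 < e)%R -> exists z, z <> z0 /\ (Cmod (z - z0) < e)%R /\ h z = 0) ->
  forall z, h z = 0.
Proof.
  intros Hh Hac z.
  replace z with (z0 + (z - z0)) by ring.
  apply (identity_at_0 (fun w => h (z0 + w)) (fun w => dh (z0 + w))).
  - intro w. replace (dh (z0 + w)) with (dh (z0 + w) * (0 + 1)) by ring.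
    apply (cdiff_comp h (fun w => z0 + w)); [apply Hh|].
    apply cdiff_plus; [apply cdiff_const|apply cdiff_id].
  - intros e He. destruct (Hac e He) as [w [H1 [H2 H3]]]. exists (w - z0).
    split; [now apply Cminus_neq0|]. split; auto.
    now replace (z0 + (w - z0)) with w by ring.
Qed.

(** * Compactness and local inverses *)

(** Compactness of closed discs as an induction principle: what is inherited by subsets, stable
    under unions of two sets and true near every point holds for every disc. It replaces the
    extraction of finite subcovers. *)
Lemma compact_induction (P : (C -> Prop) -> Prop) :
  (forall A B : C -> Prop, (forall z, A z -> B z) -> P B -> P A) ->
  (forall A B, P A -> P B -> P (fun z => A z \/ B z)) ->
  (forall z, exists e, (0 < e)%R /\ P (fun w => (Cmod (w - z) < e)%R)) ->
  forall r, P (fun w => (Cmod w <= r)%R).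
Proof.
  intros Hm Hu Hl r.
  set (box := fun a b c d (z : C) => (a <= fst z <= b)%R /\ (c <= snd z <= d)%R).
  destruct (Rlt_or_le r 0) as [Hr|Hr].
  { destruct (Hl 0) as [e [He H]]. eapply Hm; [|exact H]. intros z Hz. cbv beta in Hz.
    exfalso. generalize (Cmod_ge_0 z). lra. }
  apply (Hm _ (box (- r) r (- r) r)%R).
  { intros z Hz. assert (X := fst_le_Cmod z). assert (Y := snd_le_Cmod z).
    split; apply Rabs_le_between; lra. }
  apply (bisection_2d (fun a b c d => P (box a b c d))); try lra.
  - intros a b c d Hab Hcd H1 H2 H3 H4.
    eapply Hm; [|exact (Hu _ _ (Hu _ _ H1 H2) (Hu _ _ H3 H4))].
    intros z [Hx Hy]. unfold box. cbv beta.
    destruct (Rle_or_lt (fst z) ((a + b) / 2)); destruct (Rle_or_lt (snd z) ((c + d) / 2));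
      [left;left|right;left|left;right|right;right]; split; lra.
  - intros x y. destruct (Hl (x, y)) as [e [He H]]. exists (e / 2)%R. split; [lra|].
    intros a b c d Hx Hy Hw Hh. eapply Hm; [|exact H]. intros z [H1 H2].
    eapply Rle_lt_trans; [apply Cmod_le_sum|]. simpl.
    assert (Rabs (fst z + - x) <= b - a)%R by (apply Rabs_le; lra).
    assert (Rabs (snd z + - y) <= d - c)%R by (apply Rabs_le; lra). lra.
Qed.

(** Near a preimage of [w] the set [K] is absent; near any other point [f] keeps its distance from
    [w] by continuity. *)
Lemma compact_away f (w : C) (K : C -> Prop) r : ctsC f ->
  (forall z, f z = w -> cnear z (fun v => ~ K v)) ->
  exists del, (0 < del)%R /\ forall z, (Cmod z <= r)%R -> K z -> (del <= Cmod (f z - w))%R.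
Proof.
  intros Hf HK.
  apply (compact_induction (fun A => exists del, (0 < del)%R /\
     forall z, A z -> K z -> (del <= Cmod (f z - w))%R)).
  - intros A B HAB [d [Hd H]]. exists d. auto.
  - intros A B [d [Hd H]] [d' [Hd' H']]. exists (Rmin d d').
    split; [now apply Rmin_glb_lt|]. intros z [Hz|Hz] Hk.
    + eapply Rle_trans; [apply Rmin_l|auto].
    + eapply Rle_trans; [apply Rmin_r|auto].
  - intro z. destruct (classic (f z = w)) as [E|E].
    + destruct (HK z E) as [e [He H]]. exists e. split; auto. exists 1%R. split; [lra|].
      intros v Hv Kv. exfalso. exact (H v Hv Kv).
    + set (m := Cmod (f z - w)). assert (Hm : (0 < m)%R) by (apply Cmod_gt_0; now apply Cminus_neq0).
      destruct (Hf z (m / 2)%R ltac:(lra)) as [e [He H]]. exists e. split; auto.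
      exists (m / 2)%R. split; [lra|]. intros v Hv _. apply H in Hv.
      assert (T := Cmod_sub_triangle (f z) (f v) w). rewrite (Cmod_sub_sym (f z) (f v)) in T.
      fold m in T. lra.
Qed.

Lemma compact_finite (Z : C -> Prop) r :
  (forall z, cnear z (fun w => Z w -> w = z)) ->
  exists l, forall z, (Cmod z <= r)%R -> Z z -> In z l.
Proof.
  intros HZ.
  apply (compact_induction (fun A => exists l, forall z, A z -> Z z -> In z l)).
  - intros A B HAB [l H]. exists l. auto.
  - intros A B [l H] [l' H']. exists (l ++ l'). intros z [Hz|Hz] Hk; apply in_or_app; auto.
  - intro z. destruct (HZ z) as [e [He H]]. exists e. split; auto. exists (z :: nil).
    intros w Hw Zw. left. symmetry. auto.
Qed.

(** Without a minimum, every point of the disc has a neighbourhood on which some attained value lies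
    strictly below. Compactness leaves one attained value strictly below all of them, including
    itself. *)
Lemma compact_min (phi : C -> R) z0 r : (0 < r)%R ->
  (forall z, (Cmod (z - z0) <= r)%R -> forall e, (0 < e)%R ->
     cnear z (fun v => (Rabs (phi v - phi z) < e)%R)) ->
  exists m, (Cmod (m - z0) <= r)%R /\ forall z, (Cmod (z - z0) <= r)%R -> (phi m <= phi z)%R.
Proof.
  intros Hr Hc. apply NNPP. intro Hno.
  assert (Hlt : forall z, (Cmod (z - z0) <= r)%R ->
     exists z', (Cmod (z' - z0) <= r)%R /\ (phi z' < phi z)%R).
  { intros z Hz. apply NNPP. intro Hn. apply Hno. exists z. split; auto. intros v Hv.
    apply Rnot_lt_le. intro. apply Hn. now exists v. }
  assert (K : exists m, (Cmod (m - z0) <= r)%R /\ forall z, (Cmod z <= Cmod z0 + r)%R ->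
     (Cmod (z - z0) <= r)%R -> (phi m < phi z)%R).
  { apply (compact_induction (fun A => exists m, (Cmod (m - z0) <= r)%R /\ forall z, A z ->
     (Cmod (z - z0) <= r)%R -> (phi m < phi z)%R)).
    - intros A B HAB [m [Hm H]]. exists m. auto.
    - intros A B [m [Hm H]] [m' [Hm' H']].
      destruct (Rle_or_lt (phi m) (phi m')) as [L|L].
      + exists m. split; auto. intros z [Hz|Hz] Hd; auto. specialize (H' z Hz Hd). lra.
      + exists m'. split; auto. intros z [Hz|Hz] Hd; auto. specialize (H z Hz Hd). lra.
    - intro z. destruct (Rle_or_lt (Cmod (z - z0)) r) as [L|L].
      + destruct (Hlt z L) as [z' [H1 H2]].
        destruct (Hc z L (phi z - phi z')%R ltac:(lra)) as [e [He H]].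
        exists e. split; auto. exists z'. split; auto. intros v Hv _. apply H in Hv.
        apply Rabs_lt_between in Hv. lra.
      + exists (Cmod (z - z0) - r)%R. split; [lra|]. exists z0. split.
        * replace (z0 - z0) with (RtoC 0) by ring. rewrite Cmod_0. lra.
        * intros v Hv Hv'. exfalso. assert (T := Cmod_sub_triangle z v z0).
          rewrite (Cmod_sub_sym z v) in T. lra. }
  destruct K as [m [Hm H]]. specialize (H m).
  assert (T := Cmod_triangle (m - z0) z0). replace (m - z0 + z0) with m in T by ring.
  assert (Hm2 : (Cmod m <= Cmod z0 + r)%R) by lra. specialize (H Hm2 Hm). lra.
Qed.

(** Strict differentiability: the estimate is uniform in both points, which yields local
    injectivity. Every real-linear map of the plane has the form d -> a d + conj(b d); its
    determinant is |a|^2 - |b|^2. *)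
Definition sdiff (F : C -> C) (z0 a b : C) : Prop :=
  forall eps, (0 < eps)%R -> exists del, (0 < del)%R /\ forall z z',
    (Cmod (z - z0) < del)%R -> (Cmod (z' - z0) < del)%R ->
    (Cmod (F z' - F z - (a * (z' - z) + Cconj (b * (z' - z)))) <= eps * Cmod (z' - z))%R.

Lemma strict_diff F dF z0 :
  cnear z0 (fun z => cdiff F z (dF z)) -> tends (cnear z0) dF (dF z0) ->
  sdiff F z0 (dF z0) 0.
Proof.
  intros H1 H2 eps He.
  destruct (filter_and (F := cnear z0) _ _ H1 (H2 (eps / 2)%R ltac:(lra))) as [d [Hd H]].
  exists d. split; auto. intros z z' Hz Hz'.
  set (c := dF z0).
  assert (P := path_mean_value (fun s => F (z + RtoC s * (z' - z)) - c * (z + RtoC s * (z' - z)))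
    (fun s => (dF (z + RtoC s * (z' - z)) - c) * (z' - z)) (eps / 2 * Cmod (z' - z))).
  cbv beta in P.
  replace (z + RtoC 1 * (z' - z)) with z' in P by ring.
  replace (z + RtoC 0 * (z' - z)) with z in P by ring.
  replace (F z' - F z - (c * (z' - z) + Cconj (0 * (z' - z))))
    with (F z' - c * z' - (F z - c * z)).
  2: { replace (0 * (z' - z)) with (RtoC 0) by ring.
       replace (Cconj 0) with (RtoC 0) by (apply injective_projections; simpl; ring). ring. }
  replace (eps * Cmod (z' - z))%R with (2 * (eps / 2 * Cmod (z' - z)))%R by field.
  assert (Hseg : forall t, (0 <= t <= 1)%R -> (Cmod (z + RtoC t * (z' - z) - z0) < d)%R).
  { intros t Ht. replace (z + RtoC t * (z' - z) - z0)
      with (RtoC (1 - t) * (z - z0) + RtoC t * (z' - z0)) by (rewrite RtoC_minus; ring).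
    eapply Rle_lt_trans; [apply Cmod_triangle|].
    rewrite !Cmod_mult, !Cmod_R, !Rabs_pos_eq by lra.
    destruct (Rle_or_lt (Cmod (z - z0)) (Cmod (z' - z0))); nra. }
  apply P.
  - intros t Ht. destruct (H _ (Hseg t Ht)) as [Ha _].
    assert (S := pdiff_seg z z' t).
    replace ((dF (z + RtoC t * (z' - z)) - c) * (z' - z))
      with (dF (z + RtoC t * (z' - z)) * (z' - z) - c * (z' - z)) by ring.
    apply (hasd_minus (locally t)).
    + now apply (pdiff_comp (fun s => z + RtoC s * (z' - z))).
    + now apply (hasd_scal (locally t)).
  - intros t Ht. destruct (H _ (Hseg t Ht)) as [_ Hb]. fold c in Hb.
    rewrite Cmod_mult. apply Rmult_le_compat_r; [apply Cmod_ge_0|lra].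
Qed.

Lemma Rabs_sub_mult x y d : (0 <= d)%R -> (Rabs (x - y) * d = Rabs (x * d - y * d))%R.
Proof.
  intro H. replace (x * d - y * d)%R with ((x - y) * d)%R by ring.
  rewrite Rabs_mult. now rewrite (Rabs_pos_eq d).
Qed.

Lemma reallinear_lower a b d :
  (Rabs (Cmod a - Cmod b) * Cmod d <= Cmod (a * d + Cconj (b * d)))%R.
Proof.
  rewrite Rabs_sub_mult by apply Cmod_ge_0.
  assert (T1 := Cmod_rev_triangle (a * d) (- Cconj (b * d))).
  assert (T2 := Cmod_rev_triangle (- Cconj (b * d)) (a * d)).
  rewrite (Cmod_sub_sym (- _)) in T2.
  replace (a * d - - Cconj (b * d)) with (a * d + Cconj (b * d)) in * by ring.
  rewrite Cmod_opp, Cmod_conj, !Cmod_mult in *. apply Rabs_le. lra.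
Qed.

(** Cramer's rule: the equation and its conjugate form a linear system for d and conj d whose
    determinant D = |a|^2 - |b|^2 is real and nonzero. *)
Lemma reallinear_onto (a b e : C) : Cmod a <> Cmod b ->
  exists d, a * d + Cconj (b * d) = e.
Proof.
  intro H. set (D := a * Cconj a - b * Cconj b).
  assert (HD : D <> 0).
  { intro E. apply H. unfold D in E. rewrite <- !Cmod2_conj, <- RtoC_minus in E.
    apply RtoC_inj in E. assert (A := Cmod_ge_0 a). assert (B := Cmod_ge_0 b). nra. }
  assert (HDc : Cconj D = D).
  { unfold D. rewrite Cminus_conj, !Cmult_conj, !Cconj_conj. ring. }
  exists ((Cconj a * e - Cconj b * Cconj e) / D).
  unfold Cdiv. rewrite !Cmult_conj, Cinv_conj, HDc, Cminus_conj, !Cmult_conj, !Cconj_conj by auto.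
  replace (a * ((Cconj a * e - Cconj b * Cconj e) * / D) + Cconj b * ((a * Cconj e - b * e) * / D))
    with (D * / D * e) by (unfold D; ring).
  rewrite Cinv_r by auto. ring.
Qed.

(** Injectivity is the lower bound for the real-linear part minus the strict remainder. For
    surjectivity, |F - w| is minimised on a closed disc; the minimum is interior, and a short step
    along the solution of the linearised equation would lower any nonzero minimum. *)
Lemma local_homeo F z0 a b : sdiff F z0 a b -> Cmod a <> Cmod b ->
  exists kap r1, (0 < kap)%R /\ (0 < r1)%R /\
    (forall z z', (Cmod (z - z0) < r1)%R -> (Cmod (z' - z0) < r1)%R ->
       (kap * Cmod (z' - z) <= Cmod (F z' - F z))%R) /\
    (forall r, (0 < r <= r1)%R -> exists rho, (0 < rho)%R /\
       forall w, (Cmod (w - F z0) < rho)%R -> exists z, (Cmod (z - z0) < r)%R /\ F z = w).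
Proof.
  intros HF Hab. set (c := Rabs (Cmod a - Cmod b)).
  assert (Hc : (0 < c)%R) by (apply Rabs_pos_lt; lra).
  destruct (HF (c / 2)%R ltac:(lra)) as [r1 [Hr1 HS]].
  assert (HL : forall z z', (Cmod (z - z0) < r1)%R -> (Cmod (z' - z0) < r1)%R ->
       (c / 2 * Cmod (z' - z) <= Cmod (F z' - F z))%R).
  { intros z z' Hz Hz'. assert (X := HS z z' Hz Hz').
    assert (Y := reallinear_lower a b (z' - z)). fold c in Y.
    rewrite Cmod_sub_sym in X.
    assert (T := Cmod_rev_triangle (a * (z' - z) + Cconj (b * (z' - z))) (F z' - F z)). lra. }
  exists (c / 2)%R, r1. split; [lra|]. split; [auto|]. split; [exact HL|].
  (* With this radius the minimiser m satisfies |F m - F z0| < c r / 4, while on the circle of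
     radius r / 2 the lower bound gives at least c r / 4; so m is interior. *)
  intros r Hr. exists (c * r / 8)%R. split; [apply Rdiv_lt_0_compat; [apply Rmult_lt_0_compat|]; lra|].
  intros w Hw.
  assert (Hcont : forall z, (Cmod (z - z0) <= r / 2)%R -> forall e, (0 < e)%R ->
     cnear z (fun v => (Rabs (Cmod (F v - w) - Cmod (F z - w)) < e)%R)).
  { intros z Hz e He. set (L := (Cmod a + Cmod b + c / 2 + 1)%R).
    assert (HLp : (0 < L)%R) by (unfold L; generalize (Cmod_ge_0 a) (Cmod_ge_0 b); lra).
    exists (Rmin (r / 2) (e / L))%R. split.
    { apply Rmin_glb_lt; [lra|]. apply Rdiv_lt_0_compat; lra. }
    intros v Hv. assert (V1 := Rlt_le_trans _ _ _ Hv (Rmin_l _ _)).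
    assert (V2 := Rlt_le_trans _ _ _ Hv (Rmin_r _ _)).
    assert (T := Cmod_sub_triangle v z z0).
    assert (X := HS z v ltac:(lra) ltac:(lra)).
    assert (Y : (Cmod (F v - F z) <= (Cmod a + Cmod b + c / 2) * Cmod (v - z))%R).
    { assert (T2 := Cmod_rev_triangle (F v - F z) (a * (v - z) + Cconj (b * (v - z)))).
      assert (T3 := Cmod_triangle (a * (v - z)) (Cconj (b * (v - z)))).
      rewrite Cmod_conj, !Cmod_mult in T3. lra. }
    apply Rle_lt_trans with (Cmod (F v - F z)).
    { assert (A1 := Cmod_sub_triangle (F v) (F z) w).
      assert (A2 := Cmod_sub_triangle (F z) (F v) w). rewrite (Cmod_sub_sym (F z) (F v)) in A2.
      apply Rabs_le. lra. }
    eapply Rle_lt_trans; [exact Y|].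
    apply Rle_lt_trans with (L * Cmod (v - z))%R.
    { apply Rmult_le_compat_r; [apply Cmod_ge_0|unfold L; lra]. }
    apply Rlt_le_trans with (L * (e / L))%R; [now apply Rmult_lt_compat_l|right; field; lra]. }
  destruct (compact_min (fun z => Cmod (F z - w)) z0 (r / 2) ltac:(lra) Hcont) as [m [Hm Hmin]].
  assert (Hz0 : (Cmod (z0 - z0) = 0)%R) by (replace (z0 - z0) with (RtoC 0) by ring; apply Cmod_0).
  assert (H0 := Hmin z0 ltac:(lra)). cbv beta in H0. rewrite (Cmod_sub_sym (F z0)) in H0.
  assert (Hin : (Cmod (m - z0) < r / 2)%R).
  { apply Rnot_le_lt. intro L.
    assert (X := HL z0 m ltac:(lra) ltac:(lra)).
    assert (T := Cmod_sub_triangle (F m) w (F z0)).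
    assert (c / 2 * (r / 2) <= c / 2 * Cmod (m - z0))%R by (apply Rmult_le_compat_l; lra). lra. }
  exists m. split; [lra|].
  apply NNPP. intro Hne. set (e := w - F m).
  assert (He : (0 < Cmod e)%R) by (apply Cmod_gt_0, Cminus_neq0; auto).
  destruct (reallinear_onto a b e Hab) as [d Hd].
  assert (Hdl : (c * Cmod d <= Cmod e)%R) by (rewrite <- Hd; apply reallinear_lower).
  assert (Hdp := Cmod_ge_0 d).
  (* A fraction of the full step [d] that stays in the disc. The linear part shrinks the error to (1
     - t)|e| and the remainder adds at most t |e| / 2. *)
  set (t := Rmin 1 ((r / 2 - Cmod (m - z0)) / (Cmod d + 1))%R).
  assert (Ht : (0 < t)%R) by (apply Rmin_glb_lt; [lra|apply Rdiv_lt_0_compat; lra]).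
  assert (Ht1 : (t <= 1)%R) by apply Rmin_l.
  assert (Ht2 : (t * Cmod d <= r / 2 - Cmod (m - z0))%R).
  { apply Rle_trans with (t * (Cmod d + 1))%R; [apply Rmult_le_compat_l; lra|].
    apply Rle_trans with ((r / 2 - Cmod (m - z0)) / (Cmod d + 1) * (Cmod d + 1))%R.
    - apply Rmult_le_compat_r; [lra|apply Rmin_r].
    - right. field. lra. }
  set (m' := m + RtoC t * d).
  assert (Hmm : m' - m = RtoC t * d) by (unfold m'; ring).
  assert (Hmd : (Cmod (m' - m) = t * Cmod d)%R)
    by (rewrite Hmm, Cmod_mult, Cmod_R, Rabs_pos_eq; lra).
  assert (Hm' : (Cmod (m' - z0) <= r / 2)%R).
  { assert (T := Cmod_sub_triangle m' m z0). lra. }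
  assert (X := HS m m' ltac:(lra) ltac:(lra)).
  assert (Y := Hmin m' Hm'). cbv beta in Y.
  assert (EL : a * (m' - m) + Cconj (b * (m' - m)) = RtoC t * e).
  { rewrite Hmm, <- Hd. replace (b * (RtoC t * d)) with (RtoC t * (b * d)) by ring.
    rewrite (Cmult_conj (RtoC t)).
    replace (Cconj (RtoC t)) with (RtoC t) by (apply injective_projections; simpl; ring). ring. }
  rewrite EL, Hmd in X.
  assert (Z : (Cmod (F m' - w) <= (1 - t) * Cmod e + c / 2 * (t * Cmod d))%R).
  { replace (F m' - w) with ((F m' - F m - RtoC t * e) + RtoC (- (1 - t)) * e)
      by (unfold e; rewrite RtoC_opp, RtoC_minus; ring).
    eapply Rle_trans; [apply Cmod_triangle|].
    rewrite (Cmod_mult _ e), Cmod_R, Rabs_Ropp, Rabs_pos_eq by lra. lra. }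
  assert (F m - w = - e) by (unfold e; ring).
  assert (W : (Cmod (F m - w) = Cmod e)%R) by (rewrite H, Cmod_opp; reflexivity).
  assert (t * (c * Cmod d) <= t * Cmod e)%R by (apply Rmult_le_compat_l; lra).
  assert (0 < t * Cmod e)%R by (now apply Rmult_lt_0_compat). lra.
Qed.

(** In Caratheodory form the derivative of the inverse is immediate: if p is the quotient of [F] at
    [q w], then 1 / (p o q) is the quotient of [q] at w. *)
Lemma local_inverse F dF z0 r0 : (0 < r0)%R ->
  cnear z0 (fun z => cdiff F z (dF z)) -> tends (cnear z0) dF (dF z0) -> dF z0 <> 0 ->
  exists r rho q, (0 < r <= r0)%R /\ (0 < rho)%R /\
    (forall z, (Cmod (z - z0) < r)%R -> (Cmod (F z - F z0) < rho)%R -> q (F z) = z) /\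
    (forall w, (Cmod (w - F z0) < rho)%R ->
       (Cmod (q w - z0) < r)%R /\ F (q w) = w /\ cdiff q w (/ dF (q w))).
Proof.
  intros Hr0 H1 H2 Hn.
  destruct (local_homeo F z0 (dF z0) 0 (strict_diff F dF z0 H1 H2)) as
    [kap [r1 [Hkap [Hr1 [Hinj Hsur]]]]].
  { rewrite Cmod_0. apply Cmod_gt_0 in Hn. lra. }
  assert (Hk : (0 < Cmod (dF z0))%R) by now apply Cmod_gt_0.
  destruct (filter_and (F := cnear z0) _ _ H1 (H2 _ Hk)) as [d [Hd H]].
  set (r := Rmin r0 (Rmin r1 d)).
  assert (Hr : (0 < r)%R) by (repeat apply Rmin_glb_lt; auto).
  assert (R0 : (r <= r0)%R) by apply Rmin_l.
  assert (R1 : (r <= r1)%R) by (eapply Rle_trans; [apply Rmin_r|apply Rmin_l]).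
  assert (R2 : (r <= d)%R) by (eapply Rle_trans; [apply Rmin_r|apply Rmin_r]).
  destruct (Hsur r (conj Hr R1)) as [rho [Hrho Hs]].
  (* The default value [z0] is taken only by values without a preimage in the ball, none of which
     lies within [rho] of [F z0]. *)
  set (q := fun w => match excluded_middle_informative (exists z, (Cmod (z - z0) < r)%R /\ F z = w) with
    | left E => proj1_sig (constructive_indefinite_description _ E) | right _ => z0 end).
  assert (Hq : forall w, (Cmod (w - F z0) < rho)%R -> (Cmod (q w - z0) < r)%R /\ F (q w) = w).
  { intros w Hw. unfold q. destruct excluded_middle_informative as [E|E].
    - exact (proj2_sig (constructive_indefinite_description _ E)).
    - exfalso. apply E, Hs, Hw. }
  assert (Hinj' : forall z z', (Cmod (z - z0) < r)%R -> (Cmod (z' - z0) < r)%R -> F z = F z' -> z = z').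
  { intros z z' Hz Hz' E. assert (X := Hinj z z' ltac:(lra) ltac:(lra)).
    rewrite E in X. replace (F z' - F z') with (RtoC 0) in X by ring. rewrite Cmod_0 in X.
    symmetry. apply eq_of_Cminus, Cmod_eq_0, Rle_antisym; [|apply Cmod_ge_0]. nra. }
  exists r, rho, q. split; [split; auto|]. split; [auto|]. split.
  - intros z Hz Hw. apply Hinj'; auto; apply Hq; auto.
  - intros w Hw. destruct (Hq w Hw) as [Q1 Q2]. split; [auto|]. split; [auto|].
    assert (Hopen : cnear w (fun v => (Cmod (v - F z0) < rho)%R)).
    { exists (rho - Cmod (w - F z0))%R. split; [lra|]. intros v Hv.
      assert (T := Cmod_sub_triangle v w (F z0)). lra. }
    assert (Hqc : tends (cnear w) q (q w)).
    { intros e He. eapply filter_imp; [|apply filter_and; [exact Hopen|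
        apply (cnear_ball w (kap * e)); now apply Rmult_lt_0_compat]].
      intros v [V1 V2]. destruct (Hq v V1) as [V3 V4].
      assert (X := Hinj (q w) (q v) ltac:(lra) ltac:(lra)). rewrite V4, Q2 in X.
      apply Rmult_lt_reg_l with kap; auto. lra. }
    destruct (H (q w) ltac:(lra)) as [[p [Hp Hp']] Hdn].
    assert (HdFn : dF (q w) <> 0).
    { intro E. rewrite E in Hdn. replace (0 - dF z0) with (- dF z0) in Hdn by ring.
      rewrite Cmod_opp in Hdn. lra. }
    assert (Hpq := tends_comp (cnear w) p q (q w) (dF (q w)) Hqc Hp).
    exists (fun v => / p (q v)). split.
    + now apply (tends_inv (cnear w)).
    + assert (Hpn : cnear w (fun v => p (q v) <> 0)).
      { apply (tends_near (cnear w) (fun v => p (q v)) (dF (q w)) (fun c => c <> 0) Hpq).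
        exists (Cmod (dF (q w))). split; [now apply Cmod_gt_0|]. intros v Hv E. subst v.
        replace (0 - dF (q w)) with (- dF (q w)) in Hv by ring. rewrite Cmod_opp in Hv. lra. }
      eapply filter_imp; [|apply filter_and; [apply filter_and; [exact Hopen|exact Hpn]|
         exact (tends_near (cnear w) q (q w) _ Hqc Hp')]].
      cbv beta. intros v [[V1 V2] V3]. destruct (Hq v V1) as [V4 V5]. rewrite V5, Q2 in V3.
      rewrite V3. field. auto.
Qed.

(** * Folds of a saddle function *)

Open Scope R_scope.

Lemma is_derive_continuity_pt f t d : is_derive f t d -> continuity_pt f t.
Proof.
  intro H. apply continuity_pt_filterlim. apply (ex_derive_continuous f). now exists d.
Qed.

Lemma ivt_value (f : R -> R) a b y : a < b ->
  (forall t, a <= t <= b -> continuity_pt f t) -> f a < y < f b -> exists c, a < c < b /\ f c = y.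
Proof.
  intros Hab Hc Hy.
  destruct (IVT_interv (fun t => f t - y) a b) as [c [H1 H2]]; try lra.
  - intros t Ht. apply continuity_pt_minus; [auto|].
    apply continuity_pt_const. intros u w. reflexivity.
  - exists c. split; [|lra].
    destruct (Req_dec c a) as [->|]; [lra|]. destruct (Req_dec c b) as [->|]; lra.
Qed.

Lemma ivt_value_decr (f : R -> R) a b y : a < b ->
  (forall t, a <= t <= b -> continuity_pt f t) -> f b < y < f a -> exists c, a < c < b /\ f c = y.
Proof.
  intros Hab Hc Hy.
  destruct (ivt_value (fun t => - f t) a b (- y) Hab) as [c [H1 H2]]; try lra.
  - intros t Ht. now apply continuity_pt_opp, Hc.
  - exists c. split; lra.
Qed.

Lemma continuity_pt_of_eps (f : R -> R) t :
  (forall e, 0 < e -> exists d, 0 < d /\ forall s, Rabs (s - t) < d -> Rabs (f s - f t) < e) ->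
  continuity_pt f t.
Proof.
  intros H. apply continuity_pt_filterlim. apply continuous_of_eps. intros e He.
  apply locally_R_iff. auto.
Qed.

Lemma continuity_pt_eps (f : R -> R) t : continuity_pt f t ->
  forall e, 0 < e -> exists d, 0 < d /\ forall s, Rabs (s - t) < d -> Rabs (f s - f t) < e.
Proof.
  intros H e He. apply continuity_pt_filterlim in H.
  exact (proj1 (locally_R_iff _ _) (eps_of_continuous f t H e He)).
Qed.

Definition cts2 (w : R -> R -> R) (x y : R) : Prop :=
  forall e, 0 < e -> exists d, 0 < d /\ forall x' y',
    Rabs (x' - x) < d -> Rabs (y' - y) < d -> Rabs (w x' y' - w x y) < e.

Lemma cts2_fst w x y : cts2 w x y -> continuity_pt (fun s => w s y) x.
Proof.
  intros H. apply continuity_pt_of_eps. intros e He. destruct (H e He) as [d [Hd K]].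
  exists d. split; auto. intros s Hs. apply K; auto. now rewrite Rminus_diag, Rabs_R0.
Qed.

Lemma cts2_snd w x y : cts2 w x y -> continuity_pt (fun s => w x s) y.
Proof.
  intros H. apply continuity_pt_of_eps. intros e He. destruct (H e He) as [d [Hd K]].
  exists d. split; auto. intros s Hs. apply K; auto. now rewrite Rminus_diag, Rabs_R0.
Qed.

Lemma continuity_pt_pos f t : continuity_pt f t -> 0 < f t ->
  exists d, 0 < d /\ forall s, Rabs (s - t) < d -> 0 < f s.
Proof.
  intros H Hp. destruct (continuity_pt_eps f t H (f t) Hp) as [d [Hd K]].
  exists d. split; auto. intros s Hs. specialize (K s Hs). apply Rabs_lt_between in K. lra.
Qed.

(* [m x] is the minimum of the convex function [v x]; since [v] is strictly concave in [x],
   freezing the minimizing ordinate shows that [m] lies strictly below its tangents. *)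
Lemma fold_real (v vx vy : R -> R -> R) x0 y0 r :
  0 < r ->
  (forall x y, Rabs (x - x0) < r -> Rabs (y - y0) < r -> is_derive (fun s => v s y) x (vx x y)) ->
  (forall x y, Rabs (x - x0) < r -> Rabs (y - y0) < r -> is_derive (fun s => v x s) y (vy x y)) ->
  (forall x y, Rabs (x - x0) < r -> Rabs (y - y0) < r -> cts2 vx x y) ->
  (forall x y, Rabs (x - x0) < r -> Rabs (y - y0) < r -> cts2 vy x y) ->
  (forall x y y', Rabs (x - x0) < r -> Rabs (y - y0) < r -> Rabs (y' - y0) < r ->
     y < y' -> vy x y < vy x y') ->
  (forall x x' y, Rabs (x - x0) < r -> Rabs (x' - x0) < r -> Rabs (y - y0) < r ->
     x < x' -> vx x' y < vx x y) ->
  vy x0 y0 = 0 ->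
  exists eps rho (m dm : R -> R), 0 < eps <= r /\ 0 < rho < r /\ m x0 = v x0 y0 /\
    (forall x, Rabs (x - x0) < eps -> is_derive m x (dm x)) /\
    (forall x x', Rabs (x - x0) < eps -> Rabs (x' - x0) < eps -> x <> x' ->
       m x' < m x + dm x * (x' - x)) /\
    (forall x, Rabs (x - x0) < eps ->
       exists y, Rabs (y - y0) < rho /\ vy x y = 0 /\ v x y = m x) /\
    (forall x y, Rabs (x - x0) < eps -> Rabs (y - y0) < rho -> vy x y = 0 -> v x y = m x) /\
    (forall x c, Rabs (x - x0) < eps -> Rabs (c - v x0 y0) < eps -> m x < c ->
       exists y1 y2, y1 < y2 /\ Rabs (y1 - y0) < rho /\ Rabs (y2 - y0) < rho /\
         v x y1 = c /\ v x y2 = c /\ forall y, Rabs (y - y0) < rho -> v x y = c -> y = y1 \/ y = y2) /\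
    (forall x c, Rabs (x - x0) < eps -> Rabs (c - v x0 y0) < eps -> c < m x ->
       forall y, Rabs (y - y0) < rho -> v x y <> c).
Proof.
  intros Hr Dx Dy Cx Cy My Mx H0.
  set (rho := r / 2). set (a := y0 - rho). set (b := y0 + rho).
  assert (Hx00 : Rabs (x0 - x0) < r) by (rewrite Rminus_diag, Rabs_R0; lra).
  assert (Hy00 : Rabs (y0 - y0) < r) by (rewrite Rminus_diag, Rabs_R0; lra).
  assert (Hab : forall y, a <= y <= b -> Rabs (y - y0) < r)
    by (intros y Hy; apply Rabs_def1; unfold a, b, rho in Hy; lra).
  assert (Hara : a <= a <= b) by (unfold a, b, rho; lra).
  assert (Harb : a <= b <= b) by (unfold a, b, rho; lra).
  assert (Ha0 : vy x0 a < 0) by (rewrite <- H0; apply My; auto; unfold a, rho; lra).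
  assert (Hb0 : 0 < vy x0 b) by (rewrite <- H0 at 1; apply My; auto; unfold b, rho; lra).
  assert (Mono1 : forall x u w, Rabs (x - x0) < r -> a <= u <= b -> a <= w <= b -> u < w ->
     vy x u >= 0 -> v x u < v x w).
  { intros x u w Hx Hu Hw Huw Hs. destruct (mvt_strict (fun s => v x s) (vy x) u w Huw) as [c [Hc E]].
    - intros t Ht. apply Dy; auto. apply Hab. lra.
    - assert (vy x u < vy x c) by (apply My; [lra|apply Hab; lra|apply Hab; lra|lra]). nra. }
  assert (Mono2 : forall x u w, Rabs (x - x0) < r -> a <= u <= b -> a <= w <= b -> u < w ->
     vy x w <= 0 -> v x w < v x u).
  { intros x u w Hx Hu Hw Huw Hs. destruct (mvt_strict (fun s => v x s) (vy x) u w Huw) as [c [Hc E]].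
    - intros t Ht. apply Dy; auto. apply Hab. lra.
    - assert (vy x c < vy x w) by (apply My; [lra|apply Hab; lra|apply Hab; lra|lra]). nra. }
  assert (Ga : v x0 y0 < v x0 a) by (apply Mono2; auto; unfold a, b, rho; lra).
  assert (Gb : v x0 y0 < v x0 b) by (apply Mono1; auto; unfold a, b, rho; lra).
  destruct (continuity_pt_pos (fun s => - vy s a) x0) as [e1 [He1 E1]];
    [apply continuity_pt_opp, cts2_fst, Cy; auto|lra|].
  destruct (continuity_pt_pos (fun s => vy s b) x0) as [e2 [He2 E2]];
    [apply cts2_fst, Cy; auto|lra|].
  (* Half the smaller rise from the value at y0 to the two end values. For x near x0 the ends lose
     less than [g], so every level within [g] of the base value stays below both ends. *)
  set (g := Rmin (v x0 a - v x0 y0) (v x0 b - v x0 y0) / 2).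
  assert (Hg : 0 < g) by (unfold g; apply Rdiv_lt_0_compat; [apply Rmin_glb_lt|]; lra).
  assert (Hg1 : 2 * g <= v x0 a - v x0 y0)
    by (unfold g; generalize (Rmin_l (v x0 a - v x0 y0) (v x0 b - v x0 y0)); lra).
  assert (Hg2 : 2 * g <= v x0 b - v x0 y0)
    by (unfold g; generalize (Rmin_r (v x0 a - v x0 y0) (v x0 b - v x0 y0)); lra).
  destruct (continuity_pt_eps (fun s => v s a) x0) with (e := g) as [e3 [He3 E3]]; auto.
  { eapply is_derive_continuity_pt. apply Dx; auto. }
  destruct (continuity_pt_eps (fun s => v s b) x0) with (e := g) as [e4 [He4 E4]]; auto.
  { eapply is_derive_continuity_pt. apply Dx; auto. }
  set (eps := Rmin r (Rmin (Rmin e1 e2) (Rmin g (Rmin e3 e4)))).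
  assert (Heps : 0 < eps) by (unfold eps; repeat apply Rmin_glb_lt; auto).
  assert (Hall : eps <= r /\ eps <= e1 /\ eps <= e2 /\ eps <= g /\ eps <= e3 /\ eps <= e4).
  { unfold eps, Rmin. repeat destruct Rle_dec; lra. }
  destruct Hall as (L0 & L1 & L2 & Lg & L3 & L4).
  assert (Hys : forall x, exists y, Rabs (x - x0) < eps -> a < y < b /\ vy x y = 0).
  { intro x. destruct (Rlt_dec (Rabs (x - x0)) eps) as [Hx|Hx]; [|exists 0; contradiction].
    assert (X1 := E1 x ltac:(lra)). assert (X2 := E2 x ltac:(lra)). cbv beta in X1, X2.
    destruct (ivt_value (vy x) a b 0) as [c [Hc Ec]]; try lra.
    - unfold a, b, rho; lra.
    - intros t Ht. apply (cts2_snd vy), Cy; [lra|auto].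
    - now exists c. }
  set (ys := fun x => proj1_sig (constructive_indefinite_description _ (Hys x))).
  assert (Hysp : forall x, Rabs (x - x0) < eps -> a < ys x < b /\ vy x (ys x) = 0)
    by (intro x; exact (proj2_sig (constructive_indefinite_description _ (Hys x)))).
  assert (Huniq : forall x y, Rabs (x - x0) < eps -> a <= y <= b -> vy x y = 0 -> y = ys x).
  { intros x y Hx Hy E. destruct (Hysp x Hx) as [K1 K2].
    destruct (Rtotal_order y (ys x)) as [L|[L|L]]; auto; exfalso.
    - assert (vy x y < vy x (ys x)) by (apply My; [lra|apply Hab; lra|apply Hab; lra|lra]). lra.
    - assert (vy x (ys x) < vy x y) by (apply My; [lra|apply Hab; lra|apply Hab; lra|lra]). lra. }
  assert (Hmin : forall x y, Rabs (x - x0) < eps -> a <= y <= b -> v x (ys x) <= v x y).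
  { intros x y Hx Hy. destruct (Hysp x Hx) as [K1 K2].
    destruct (Rtotal_order y (ys x)) as [L|[L|L]].
    - left. apply Mono2; auto; lra.
    - subst y. lra.
    - left. apply Mono1; auto; lra. }
  (* The derivative in y has strict opposite signs at ys x - e' and ys x + e'; the signs persist for
     nearby abscissae and trap the minimiser between them. *)
  assert (Hysc : forall x, Rabs (x - x0) < eps -> continuity_pt ys x).
  { intros x Hx. destruct (Hysp x Hx) as [K1 K2].
    apply continuity_pt_of_eps. intros e He.
    set (e' := Rmin e (Rmin (ys x - a) (b - ys x)) / 2).
    assert (P : 0 < e' /\ e' < e /\ e' < ys x - a /\ e' < b - ys x).
    { unfold e', Rmin. repeat destruct Rle_dec; lra. }
    destruct P as (P1 & P2 & P3 & P4).
    destruct (continuity_pt_pos (fun s => - vy s (ys x - e')) x) as [d1 [Hd1 Q1]].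
    { apply continuity_pt_opp, cts2_fst, Cy; [lra|apply Hab; lra]. }
    { assert (vy x (ys x - e') < vy x (ys x)) by (apply My; [lra|apply Hab; lra|apply Hab; lra|lra]). lra. }
    destruct (continuity_pt_pos (fun s => vy s (ys x + e')) x) as [d2 [Hd2 Q2]].
    { apply cts2_fst, Cy; [lra|apply Hab; lra]. }
    { assert (vy x (ys x) < vy x (ys x + e')) by (apply My; [lra|apply Hab; lra|apply Hab; lra|lra]). lra. }
    exists (Rmin (Rmin d1 d2) (eps - Rabs (x - x0))). split.
    { repeat apply Rmin_glb_lt; lra. }
    intros s Hs.
    assert (S : Rabs (s - x) < d1 /\ Rabs (s - x) < d2 /\ Rabs (s - x) < eps - Rabs (x - x0)).
    { revert Hs. unfold Rmin. repeat destruct Rle_dec; lra. }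
    destruct S as (S1 & S2 & S3).
    assert (Hs0 : Rabs (s - x0) < eps).
    { replace (s - x0) with ((s - x) + (x - x0)) by ring. eapply Rle_lt_trans; [apply Rabs_triang|lra]. }
    destruct (Hysp s Hs0) as [K3 K4]. specialize (Q1 s S1). specialize (Q2 s S2). cbv beta in Q1, Q2.
    apply Rabs_def1.
    - apply Rnot_le_lt. intro L.
      destruct (Req_dec (ys s) (ys x + e')) as [E|N]; [rewrite <- E in Q2; lra|].
      assert (vy s (ys x + e') < vy s (ys s)) by (apply My; [lra|apply Hab; lra|apply Hab; lra|lra]). lra.
    - apply Rnot_le_lt. intro L.
      destruct (Req_dec (ys s) (ys x - e')) as [E|N]; [rewrite <- E in Q1; lra|].
      assert (vy s (ys s) < vy s (ys x - e')) by (apply My; [lra|apply Hab; lra|apply Hab; lra|lra]). lra. }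
  set (m := fun x => v x (ys x)). set (dm := fun x => vx x (ys x)).
  assert (Hrr : forall y, Rabs (y - y0) < rho <-> a < y < b).
  { intro y. unfold a, b. split.
    - intro H. apply Rabs_lt_between in H. lra.
    - intro H. apply Rabs_def1; lra. }
  assert (Hys0 : ys x0 = y0).
  { symmetry. apply Huniq; auto; [rewrite Rminus_diag, Rabs_R0; lra|unfold a, b, rho; lra]. }
  exists eps, rho, m, dm. split; [lra|]. split; [unfold rho; lra|].
  split; [unfold m; now rewrite Hys0|].
  split; [|split; [|split; [|split; [|split]]]].
  (* Envelope argument: m s - m x is at most the increment of v with the ordinate ys x frozen, and
     at least the increment with ys s frozen. Both have slope close to vx at (x, ys x), so no
     derivative of the minimiser is required. *)
  - intros x Hx. apply is_derive_eps. intros e He. apply locally_R_iff.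
    destruct (Hysp x Hx) as [K1 K2].
    destruct (Cx x (ys x) ltac:(lra) ltac:(apply Hab; lra) e He) as [d [Hd Q]].
    destruct (continuity_pt_eps ys x (Hysc x Hx) d Hd) as [d' [Hd' Q']].
    exists (Rmin (Rmin d d') (eps - Rabs (x - x0))). split.
    { repeat apply Rmin_glb_lt; lra. }
    intros s Hs.
    assert (S : Rabs (s - x) < d /\ Rabs (s - x) < d' /\ Rabs (s - x) < eps - Rabs (x - x0)).
    { revert Hs. unfold Rmin. repeat destruct Rle_dec; lra. }
    destruct S as (S1 & S2 & S3). specialize (Q' s S2).
    assert (Hs0 : Rabs (s - x0) < eps).
    { replace (s - x0) with ((s - x) + (x - x0)) by ring. eapply Rle_lt_trans; [apply Rabs_triang|lra]. }
    destruct (Hysp s Hs0) as [K3 K4].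
    assert (Inc : forall y, Rabs (y - ys x) < d -> a <= y <= b ->
       exists k, Rabs (k - dm x) < e /\ v s y - v x y = k * (s - x)).
    { intros y Hy Hy'. destruct (Rtotal_order x s) as [L|[L|L]].
      - destruct (mvt_strict (fun t => v t y) (fun t => vx t y) x s L) as [c [Hc E]].
        + intros t Ht. apply Dx; [|now apply Hab].
          apply Rabs_lt_between in Hx. apply Rabs_lt_between in Hs0. apply Rabs_def1; lra.
        + exists (vx c y). split; auto. apply Q; auto.
          apply Rabs_lt_between in S1. apply Rabs_def1; lra.
      - subst s. exists (dm x). split; [rewrite Rminus_diag, Rabs_R0; lra|ring].
      - destruct (mvt_strict (fun t => v t y) (fun t => vx t y) s x L) as [c [Hc E]].
        + intros t Ht. apply Dx; [|now apply Hab].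
          apply Rabs_lt_between in Hx. apply Rabs_lt_between in Hs0. apply Rabs_def1; lra.
        + exists (vx c y). split; [|lra]. apply Q; auto.
          apply Rabs_lt_between in S1. apply Rabs_def1; lra. }
    destruct (Inc (ys x)) as [k1 [B1 F1]]; [rewrite Rminus_diag, Rabs_R0; lra|lra|].
    destruct (Inc (ys s)) as [k2 [B2 F2]]; [auto|lra|].
    assert (U := Hmin s (ys x) Hs0 ltac:(lra)). assert (L := Hmin x (ys s) Hx ltac:(lra)).
    assert (W1 : Rabs (k1 * (s - x) - dm x * (s - x)) <= e * Rabs (s - x)).
    { replace (k1 * (s - x) - dm x * (s - x)) with ((k1 - dm x) * (s - x)) by ring.
      rewrite Rabs_mult. apply Rmult_le_compat_r; [apply Rabs_pos|lra]. }
    assert (W2 : Rabs (k2 * (s - x) - dm x * (s - x)) <= e * Rabs (s - x)).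
    { replace (k2 * (s - x) - dm x * (s - x)) with ((k2 - dm x) * (s - x)) by ring.
      rewrite Rabs_mult. apply Rmult_le_compat_r; [apply Rabs_pos|lra]. }
    apply Rabs_le_between in W1. apply Rabs_le_between in W2. unfold m.
    apply Rabs_le. lra.
  - intros x x' Hx Hx' Hn. destruct (Hysp x Hx) as [K1 K2].
    eapply Rle_lt_trans; [apply (Hmin x' (ys x) Hx'); lra|]. unfold m, dm.
    destruct (Rtotal_order x x') as [L|[L|L]]; [|contradiction|].
    + destruct (mvt_strict (fun t => v t (ys x)) (fun t => vx t (ys x)) x x' L) as [c [Hc E]].
      * intros t Ht. apply Dx; [|apply Hab; lra].
        apply Rabs_lt_between in Hx. apply Rabs_lt_between in Hx'. apply Rabs_def1; lra.
      * assert (vx c (ys x) < vx x (ys x)).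
        { apply Mx; [lra| |apply Hab; lra|lra].
          apply Rabs_lt_between in Hx. apply Rabs_lt_between in Hx'. apply Rabs_def1; lra. }
        nra.
    + destruct (mvt_strict (fun t => v t (ys x)) (fun t => vx t (ys x)) x' x L) as [c [Hc E]].
      * intros t Ht. apply Dx; [|apply Hab; lra].
        apply Rabs_lt_between in Hx. apply Rabs_lt_between in Hx'. apply Rabs_def1; lra.
      * assert (vx x (ys x) < vx c (ys x)).
        { apply Mx; [|lra|apply Hab; lra|lra].
          apply Rabs_lt_between in Hx. apply Rabs_lt_between in Hx'. apply Rabs_def1; lra. }
        nra.
  - intros x Hx. destruct (Hysp x Hx) as [K1 K2]. exists (ys x). split; [now apply Hrr|auto].
  - intros x y Hx Hy E. apply Hrr in Hy. unfold m. rewrite <- (Huniq x y); auto. lra.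
  - intros x c Hx Hc Hm. destruct (Hysp x Hx) as [K1 K2].
    assert (X3 := E3 x ltac:(lra)). assert (X4 := E4 x ltac:(lra)). cbv beta in X3, X4.
    apply Rabs_lt_between in X3. apply Rabs_lt_between in X4. apply Rabs_lt_between in Hc.
    assert (Hcy : forall t, a <= t <= b -> continuity_pt (fun s => v x s) t).
    { intros t Ht. eapply is_derive_continuity_pt. apply Dy; [lra|auto]. }
    destruct (ivt_value_decr (fun s => v x s) a (ys x) c) as [y1 [Y1 Z1]]; [lra| |unfold m in Hm; lra|].
    { intros t Ht. apply Hcy. lra. }
    destruct (ivt_value (fun s => v x s) (ys x) b c) as [y2 [Y2 Z2]]; [lra| |unfold m in Hm; lra|].
    { intros t Ht. apply Hcy. lra. }
    exists y1, y2. split; [lra|]. split; [apply Hrr; lra|]. split; [apply Hrr; lra|].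
    split; [auto|]. split; [auto|].
    intros y Hy E. apply Hrr in Hy. unfold m in Hm.
    destruct (Rtotal_order y (ys x)) as [L|[L|L]].
    + left. destruct (Rtotal_order y y1) as [L'|[L'|L']]; auto; exfalso.
      * assert (v x y1 < v x y).
        { apply Mono2; auto; try lra. rewrite <- K2. left. apply My; [lra|apply Hab; lra|apply Hab; lra|lra]. }
        lra.
      * assert (v x y < v x y1).
        { apply Mono2; auto; try lra. rewrite <- K2. left. apply My; [lra|apply Hab; lra|apply Hab; lra|lra]. }
        lra.
    + subst y. lra.
    + right. destruct (Rtotal_order y y2) as [L'|[L'|L']]; auto; exfalso.
      * assert (v x y < v x y2).
        { apply Mono1; auto; try lra. rewrite <- K2. left. apply My; [lra|apply Hab; lra|apply Hab; lra|lra]. }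
        lra.
      * assert (v x y2 < v x y).
        { apply Mono1; auto; try lra. rewrite <- K2. left. apply My; [lra|apply Hab; lra|apply Hab; lra|lra]. }
        lra.
  - intros x c Hx Hc Hm y Hy E. apply Hrr in Hy. assert (X := Hmin x y Hx ltac:(lra)).
    unfold m in Hm. lra.
Qed.

(** * The shear at a critical point *)

Open Scope C_scope.

Lemma pdiff_conj phi t d : pdiff phi t d -> pdiff (fun s => Cconj (phi s)) t (Cconj d).
Proof.
  intros [q [Hq H]]. exists (fun s => Cconj (q s)). split; [exact (tends_conj (locally t) q d Hq)|].
  eapply filter_imp; [|exact H]. cbv beta. intros s E.
  rewrite <- Cminus_conj, E, Cmult_conj. f_equal.
  rewrite <- RtoC_minus. apply injective_projections; simpl; ring.
Qed.

(** The Jacobian equals |h'|^2 - |g'|^2. *)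
Lemma Sset_iff f h g dh dg z : hol h dh -> hol g dg ->
  (forall z, f z = h z + Cconj (g z)) -> (Sset f z <-> Cmod (dh z) = Cmod (dg z)).
Proof.
  intros Hh Hg Hf. destruct z as [x y].
  assert (Dx : pdiff (fun s => f (s, y)) x (dh (x, y) * 1 + Cconj (dg (x, y) * 1))).
  { apply (hasd_ext (locally x) RtoC x (fun s => h (s, y) + Cconj (g (s, y)))).
    - now rewrite Hf.
    - apply filter_forall. intro s. now rewrite Hf.
    - apply (hasd_plus (locally x)).
      + apply (pdiff_comp (fun s => (s, y))); [apply pdiff_horiz|apply Hh].
      + apply pdiff_conj. apply (pdiff_comp (fun s => (s, y))); [apply pdiff_horiz|apply Hg]. }
  assert (Dy : pdiff (fun s => f (x, s)) y (dh (x, y) * Ci + Cconj (dg (x, y) * Ci))).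
  { apply (hasd_ext (locally y) RtoC y (fun s => h (x, s) + Cconj (g (x, s)))).
    - now rewrite Hf.
    - apply filter_forall. intro s. now rewrite Hf.
    - apply (hasd_plus (locally y)).
      + apply (pdiff_comp (fun s => (x, s))); [apply pdiff_vert|apply Hh].
      + apply pdiff_conj. apply (pdiff_comp (fun s => (x, s))); [apply pdiff_vert|apply Hg]. }
  assert (E1 : ux f (x, y) = fst (dh (x, y) * 1 + Cconj (dg (x, y) * 1)))
    by exact (is_derive_unique _ _ _ (pdiff_fst _ _ _ Dx)).
  assert (E2 : vx f (x, y) = snd (dh (x, y) * 1 + Cconj (dg (x, y) * 1)))
    by exact (is_derive_unique _ _ _ (pdiff_snd _ _ _ Dx)).
  assert (E3 : uy f (x, y) = fst (dh (x, y) * Ci + Cconj (dg (x, y) * Ci)))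
    by exact (is_derive_unique _ _ _ (pdiff_fst _ _ _ Dy)).
  assert (E4 : vy f (x, y) = snd (dh (x, y) * Ci + Cconj (dg (x, y) * Ci)))
    by exact (is_derive_unique _ _ _ (pdiff_snd _ _ _ Dy)).
  unfold Sset, Jac. rewrite E1, E2, E3, E4.
  assert (A := Cmod2_alt (dh (x, y))). assert (B := Cmod2_alt (dg (x, y))).
  assert (A0 := Cmod_ge_0 (dh (x, y))). assert (B0 := Cmod_ge_0 (dg (x, y))).
  unfold Re, Im in *. simpl in *.
  set (a := fst (dh (x, y))) in *. set (b := snd (dh (x, y))) in *.
  set (c := fst (dg (x, y))) in *. set (d := snd (dg (x, y))) in *.
  set (m := Cmod (dh (x, y))) in *. set (n := Cmod (dg (x, y))) in *.
  split; intro H.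
  - assert (m * m = n * n)%R by nra. nra.
  - rewrite H in A. nra.
Qed.

Definition dQ (u : C) (dh dg : C -> C) (z : C) : C := u * dh z + Cconj u * dg z.
Definition dP (u : C) (dh dg : C -> C) (z : C) : C := u * dh z - Cconj u * dg z.
(** The numerator of psi': where g' does not vanish, psi' = W / g'^2. *)
Definition wronsk (dh dg d2h d2g : C -> C) (z : C) : C := d2h z * dg z - dh z * d2g z.

(** The second condition is Im p'' <> 0 up to the positive factor 2 |u|^2. Criticality is left out,
    which makes the condition open. *)
Definition fold_point (u : C) (dh dg d2h d2g : C -> C) (z : C) : Prop :=
  dQ u dh dg z <> 0 /\ snd (wronsk dh dg d2h d2g z / Cpow (dQ u dh dg z) 3) <> 0%R.

Lemma fst_Cdiv_zero (a b : C) : b <> 0 -> (fst (a / b) = 0%R <-> fst (a * Cconj b) = 0%R).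
Proof.
  intro Hb. assert (H : a * Cconj b = RtoC (Cmod b ^ 2) * (a / b)).
  { rewrite Cmod2_conj. field. auto. }
  assert (Hk : (0 < Cmod b)%R) by now apply Cmod_gt_0.
  rewrite H. replace (fst (RtoC (Cmod b ^ 2) * (a / b))) with (Cmod b ^ 2 * fst (a / b)%C)%R
    by (simpl; ring).
  split; [intros ->; ring|]. intro E. apply Rmult_integral in E. destruct E as [E|E]; auto.
  exfalso. apply pow_nonzero with (n := 2%nat) in E; auto. lra.
Qed.

(** The identity behind it is Re(P' conj Q') = |u|^2 (|h'|^2 - |g'|^2). *)
Lemma critical_iff (u : C) dh dg z : u <> 0 -> dQ u dh dg z <> 0 ->
  (Cmod (dh z) = Cmod (dg z) <-> fst (dP u dh dg z / dQ u dh dg z) = 0%R).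
Proof.
  intros Hu HQ. rewrite fst_Cdiv_zero by auto.
  replace (fst (dP u dh dg z * Cconj (dQ u dh dg z)))
    with (Cmod u ^ 2 * (Cmod (dh z) ^ 2 - Cmod (dg z) ^ 2))%R.
  2: { rewrite !Cmod2_alt. unfold dP, dQ, Re, Im. simpl. ring. }
  assert (Hk : (0 < Cmod u)%R) by now apply Cmod_gt_0.
  assert (A := Cmod_ge_0 (dh z)). assert (B := Cmod_ge_0 (dg z)).
  split; intro H.
  - rewrite H. ring.
  - apply Rmult_integral in H. destruct H as [H|H]; nra.
Qed.

(** Coordinates of a value in the frame rotated and scaled by [u], in which f acts as the shear. *)
Definition cx (u w : C) : R := fst (u * w).
Definition cy (u w : C) : R := snd (u * w).

(** P'/Q' is p' read at z, so a further division of this derivative by Q' gives p''. *)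
Lemma dilatation_diff u dh dg d2h d2g z : hol dh d2h -> hol dg d2g -> dQ u dh dg z <> 0 ->
  cdiff (fun z => dP u dh dg z / dQ u dh dg z) z
    (RtoC 2 * (u * Cconj u) * wronsk dh dg d2h d2g z / (dQ u dh dg z * dQ u dh dg z)).
Proof.
  intros Hdh Hdg Hz.
  assert (X := cdiff_div (dP u dh dg) (dQ u dh dg) z (u * d2h z - Cconj u * d2g z)
    (u * d2h z + Cconj u * d2g z) Hz).
  match type of X with _ -> _ -> cdiff _ _ ?d => replace d
    with (RtoC 2 * (u * Cconj u) * wronsk dh dg d2h d2g z / (dQ u dh dg z * dQ u dh dg z)) in X end.
  - apply X.
    + apply cdiff_minus; apply cdiff_scal; auto.
    + apply cdiff_plus; apply cdiff_scal; auto.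
  - unfold wronsk, dP, dQ. f_equal. ring.
Qed.

(** [M] is the graph of critical values in the frame of [u], and [sg] tells which side is covered
    twice: the upper one for 1, the lower one for -1. On that side lie the tangents, since sg M is
    strictly below its own. The neighbourhood [U] contains the ball of radius [r] and is confined to
    the ball of radius [r0]; [eps] is the size of the box of values under control. *)
Record fold_chart (f dh dg d2h d2g : C -> C) (u z0 : C) (r0 : R)
   (U : C -> Prop) (r eps sg : R) (M dM : R -> R) : Prop := {
  fc_r : (0 < r)%R;
  fc_eps : (0 < eps)%R;
  fc_sg : sg = 1%R \/ sg = (-1)%R;
  fc_in : forall z, (Cmod (z - z0) < r)%R -> U z;
  fc_out : forall z, U z -> (Cmod (z - z0) < r0)%R;
  fc_fold : forall z, U z -> fold_point u dh dg d2h d2g z;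
  fc_base : M (cx u (f z0)) = cy u (f z0);
  fc_der : forall x, (Rabs (x - cx u (f z0)) < eps)%R -> is_derive M x (dM x);
  fc_conv : forall x x', (Rabs (x - cx u (f z0)) < eps)%R ->
     (Rabs (x' - cx u (f z0)) < eps)%R -> x <> x' ->
     (sg * M x' < sg * (M x + dM x * (x' - x)))%R;
  fc_two : forall w, (Rabs (cx u w - cx u (f z0)) < eps)%R ->
     (Rabs (cy u w - cy u (f z0)) < eps)%R ->
     (0 < sg * (cy u w - M (cx u w)))%R ->
     count_eq (fun z => U z /\ f z = w) 2;
  fc_none : forall w, (Rabs (cx u w - cx u (f z0)) < eps)%R ->
     (Rabs (cy u w - cy u (f z0)) < eps)%R ->
     (sg * (cy u w - M (cx u w)) < 0)%R ->
     forall z, U z -> f z <> w;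
  fc_crit : forall z, U z -> Cmod (dh z) = Cmod (dg z) -> cy u (f z) = M (cx u (f z));
  fc_curve : forall x, (Rabs (x - cx u (f z0)) < eps)%R ->
     exists z, U z /\ Cmod (dh z) = Cmod (dg z) /\ cx u (f z) = x /\ cy u (f z) = M x }.

Lemma tends_near_neq0 {T} (N : (T -> Prop) -> Prop) {FN : Filter N} (phi : T -> C) (l : C) :
  tends N phi l -> l <> 0 -> N (fun x => phi x <> 0).
Proof.
  intros H Hl. apply Cmod_gt_0 in Hl. eapply filter_imp; [|exact (H _ Hl)]. cbv beta.
  intros x Hx E. rewrite E in Hx. replace (0 - l) with (- l) in Hx by ring.
  rewrite Cmod_opp in Hx. lra.
Qed.

Lemma cts2_of_tends (F : C -> C) x y : tends (cnear (x, y)) F (F (x, y)) ->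
  forall s, cts2 (fun a b => s * fst (F (a, b)))%R x y /\ cts2 (fun a b => s * snd (F (a, b)))%R x y.
Proof.
  intros H s.
  assert (K : forall e, (0 < e)%R -> exists d, (0 < d)%R /\ forall x' y', (Rabs (x' - x) < d)%R ->
     (Rabs (y' - y) < d)%R -> (Rabs s * Cmod (F (x', y') - F (x, y))%C < e)%R).
  { intros e He. assert (Hs := Rabs_pos s).
    destruct (H (e / (Rabs s + 1))%R) as [d [Hd K]]; [apply Rdiv_lt_0_compat; lra|].
    exists (d / 2)%R. split; [lra|]. intros x' y' Hx Hy.
    assert (Hw : (Cmod ((x', y') - (x, y)) < d)%R).
    { eapply Rle_lt_trans; [apply Cmod_le_sum|]. simpl. unfold Rminus in *. lra. }
    apply K in Hw. assert (X := Cmod_ge_0 (F (x', y') - F (x, y))).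
    apply Rle_lt_trans with ((Rabs s + 1) * Cmod (F (x', y') - F (x, y))%C)%R;
      [apply Rmult_le_compat_r; lra|].
    apply Rlt_le_trans with ((Rabs s + 1) * (e / (Rabs s + 1)))%R;
      [apply Rmult_lt_compat_l; lra|right; field; lra]. }
  split; intros e He; destruct (K e He) as [d [Hd K']]; exists d; (split; [auto|]);
    intros x' y' Hx Hy; (eapply Rle_lt_trans; [|exact (K' x' y' Hx Hy)]);
    rewrite <- Rmult_minus_distr_l, Rabs_mult; (apply Rmult_le_compat_l; [apply Rabs_pos|]).
  - apply (fst_le_Cmod (F (x', y') - F (x, y))).
  - apply (snd_le_Cmod (F (x', y') - F (x, y))).
Qed.

Lemma cdiff_dx (F : C -> C) x y d s : cdiff F (x, y) d ->
  is_derive (fun t => s * fst (F (t, y)))%R x (s * fst d)%R /\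
  is_derive (fun t => s * snd (F (t, y)))%R x (s * snd d)%R.
Proof.
  intro H. assert (P := pdiff_comp (fun t => (t, y)) x 1 F d (pdiff_horiz y x) H).
  replace (d * 1) with d in P by ring. split; apply is_derive_scal.
  - exact (pdiff_fst _ _ _ P).
  - exact (pdiff_snd _ _ _ P).
Qed.

Lemma cdiff_dy (F : C -> C) x y d s : cdiff F (x, y) d ->
  is_derive (fun t => s * fst (F (x, t)))%R y (s * - snd d)%R /\
  is_derive (fun t => s * snd (F (x, t)))%R y (s * fst d)%R.
Proof.
  intro H. assert (P := pdiff_comp (fun t => (x, t)) y Ci F d (pdiff_vert x y) H).
  split; apply is_derive_scal.
  - replace (- snd d)%R with (fst (d * Ci)) by (simpl; ring). exact (pdiff_fst _ _ _ P).
  - replace (fst d) with (snd (d * Ci)) by (simpl; ring). exact (pdiff_snd _ _ _ P).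
Qed.

Lemma Cmod_pair_lt x y (c : C) e : (Rabs (x - fst c) < e / 2)%R -> (Rabs (y - snd c) < e / 2)%R ->
  (Cmod ((x, y) - c) < e)%R.
Proof.
  intros Hx Hy. eapply Rle_lt_trans; [apply Cmod_le_sum|]. simpl. unfold Rminus in *. lra.
Qed.

(** In the coordinate Q the real fold lemma applies to v = sg Im p: by the Cauchy-Riemann equations
    v_y = sg Re p' and v_x = sg Im p', so the points with v_y = 0 are exactly the critical ones. *)
Lemma fold_chart_exists f h g dh dg d2h d2g (u z0 : C) r0 :
  hol h dh -> hol g dg -> hol dh d2h -> hol dg d2g -> ctsC d2h -> ctsC d2g ->
  (forall z, f z = h z + Cconj (g z)) -> u <> 0 -> (0 < r0)%R ->
  Cmod (dh z0) = Cmod (dg z0) -> fold_point u dh dg d2h d2g z0 ->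
  exists U r eps sg M dM, fold_chart f dh dg d2h d2g u z0 r0 U r eps sg M dM.
Proof.
  intros Hh Hg Hdh Hdg Ch Cg Hf Hu Hr0 Hcrit [HQ0 HI0].
  set (Q := fun z => u * h z + Cconj u * g z). set (P := fun z => u * h z - Cconj u * g z).
  set (W := wronsk dh dg d2h d2g). set (q1 := dQ u dh dg). set (p1 := dP u dh dg).
  assert (HQ : hol Q q1) by (intro z; apply cdiff_plus; apply cdiff_scal; auto).
  assert (HP : hol P p1) by (intro z; apply cdiff_minus; apply cdiff_scal; auto).
  assert (Hq1 : forall z, cdiff q1 z (u * d2h z + Cconj u * d2g z))
    by (intro z; apply cdiff_plus; apply cdiff_scal; auto).
  assert (Hp1 : forall z, cdiff p1 z (u * d2h z - Cconj u * d2g z))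
    by (intro z; apply cdiff_minus; apply cdiff_scal; auto).
  assert (Cq1 : ctsC q1) by exact (hol_cts _ _ Hq1).
  assert (CW : ctsC W).
  { intro z. unfold W, wronsk. assert (X1 := hol_cts _ _ Hdh z). assert (X2 := hol_cts _ _ Hdg z).
    assert (X3 := Ch z). assert (X4 := Cg z). tends_auto. }
  set (k := fun z => snd (W z / Cpow (q1 z) 3)).
  assert (HR : forall z, q1 z <> 0 ->
     cdiff (fun z => p1 z / q1 z) z (RtoC 2 * (u * Cconj u) * W z / (q1 z * q1 z))).
  { intros z Hz. now apply dilatation_diff. }
  assert (Hfst : forall z, cx u (f z) = fst (Q z)).
  { intro z. unfold cx. rewrite Hf. unfold Q. simpl. ring. }
  assert (Hsnd : forall z, cy u (f z) = snd (P z)).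
  { intro z. unfold cy. rewrite Hf. unfold P. simpl. ring. }
  (* The sign opposite to that of Im p'' makes v_xx negative and v_yy = - v_xx positive. *)
  assert (Hsg : exists sg, (sg = 1 \/ sg = -1)%R /\ (sg * k z0 < 0)%R).
  { destruct (Rtotal_order (k z0) 0) as [L|[L|L]].
    - exists 1%R. split; [auto|lra].
    - contradiction.
    - exists (-1)%R. split; [auto|lra]. }
  destruct Hsg as [sg [Hsg Hsk]].
  assert (Hneark : cnear z0 (fun z => q1 z <> 0 /\ (sg * k z < 0)%R)).
  { apply (filter_and (F := cnear z0)); [exact (tends_near_neq0 _ q1 _ (Cq1 z0) HQ0)|].
    assert (T : tends (cnear z0) (fun z => W z / Cpow (q1 z) 3) (W z0 / Cpow (q1 z0) 3)).
    { assert (X1 := CW z0). assert (X2 := Cq1 z0).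
      apply (tends_div (cnear z0) W (fun z => Cpow (q1 z) 3)); auto.
      - now apply Cpow_nz.
      - now apply (tends_pow (cnear z0)). }
    assert (Hp : (0 < - (sg * k z0))%R) by lra.
    eapply filter_imp; [|exact (T _ Hp)]. cbv beta. intros z Hz.
    assert (X := snd_le_Cmod (W z / Cpow (q1 z) 3 - W z0 / Cpow (q1 z0) 3)).
    change (snd (W z / Cpow (q1 z) 3 - W z0 / Cpow (q1 z0) 3)) with (k z - k z0)%R in X.
    assert (Y : (Rabs (k z - k z0) < - (sg * k z0))%R) by lra.
    apply Rabs_lt_between in Y. destruct Hsg; subst sg; lra. }
  destruct Hneark as [d [Hd Hnk]].
  destruct (local_inverse Q q1 z0 (Rmin r0 d)) as (r & rho & q & [Hr Hrr] & Hrho & Hq1q & Hq2q).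
  { now apply Rmin_glb_lt. }
  { apply filter_forall. exact HQ. }
  { apply Cq1. }
  { exact HQ0. }
  assert (Hrr0 : (r <= r0)%R) by (eapply Rle_trans; [exact Hrr|apply Rmin_l]).
  assert (Hrd : (r <= d)%R) by (eapply Rle_trans; [exact Hrr|apply Rmin_r]).
  set (x0 := fst (Q z0)). set (y0 := snd (Q z0)).
  assert (Hbox : forall x y, (Rabs (x - x0) < rho / 2)%R -> (Rabs (y - y0) < rho / 2)%R ->
     (Cmod ((x, y) - Q z0) < rho)%R).
  { intros x y. apply Cmod_pair_lt. }
  set (p := fun w => P (q w)).
  set (dp := fun w => p1 (q w) / q1 (q w)).
  set (ddp := fun w => RtoC 2 * (u * Cconj u) * (W (q w) / Cpow (q1 (q w)) 3)).
  assert (Hgood : forall w, (Cmod (w - Q z0) < rho)%R -> q1 (q w) <> 0 /\ (sg * k (q w) < 0)%R).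
  { intros w Hw. apply Hnk. destruct (Hq2q w Hw). lra. }
  assert (Dp : forall w, (Cmod (w - Q z0) < rho)%R -> cdiff p w (dp w)).
  { intros w Hw. destruct (Hq2q w Hw) as (_ & _ & Y).
    unfold dp, Cdiv. apply (cdiff_comp P q); auto. }
  assert (Ddp : forall w, (Cmod (w - Q z0) < rho)%R -> cdiff dp w (ddp w)).
  { intros w Hw. destruct (Hq2q w Hw) as (_ & _ & Y). destruct (Hgood w Hw) as [G1 _].
    assert (X := cdiff_comp (fun z => p1 z / q1 z) q w _ _ (HR _ G1) Y).
    replace (ddp w) with (RtoC 2 * (u * Cconj u) * W (q w) / (q1 (q w) * q1 (q w)) * / q1 (q w));
      [exact X|]. unfold ddp. simpl. field. auto. }
  assert (Huu : exists c, (0 < c)%R /\ forall w, snd (ddp w) = (c * k (q w))%R).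
  { exists (2 * Cmod u ^ 2)%R. split.
    - apply Cmod_gt_0 in Hu. nra.
    - intro w. unfold ddp, k. rewrite <- Cmod2_conj. simpl. ring. }
  destruct Huu as [c [Hc Hck]].
  assert (Hneg : forall w, (Cmod (w - Q z0) < rho)%R -> (sg * snd (ddp w) < 0)%R).
  { intros w Hw. rewrite Hck. destruct (Hgood w Hw) as [_ G2]. nra. }
  assert (Hq0 : q (Q z0) = z0).
  { apply Hq1q; replace (z0 - z0) with (RtoC 0) by ring;
      replace (Q z0 - Q z0) with (RtoC 0) by ring; rewrite Cmod_0; auto. }
  destruct (fold_real (fun x y => sg * snd (p (x, y)))%R (fun x y => sg * snd (dp (x, y)))%R
     (fun x y => sg * fst (dp (x, y)))%R x0 y0 (rho / 2)) as
    (eps & rho' & m & dm & [He1 He2] & [Hr1 Hr2] & Hm0 & Hder & Hconv & Hcurve & Hcr & Htwo & Hnone).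
  { lra. }
  { intros x y Hx Hy. apply cdiff_dx, Dp; auto. }
  { intros x y Hx Hy. apply cdiff_dy, Dp; auto. }
  { intros x y Hx Hy. apply cts2_of_tends. eapply cdiff_cts. apply Ddp; auto. }
  { intros x y Hx Hy. apply cts2_of_tends. eapply cdiff_cts. apply Ddp; auto. }
  { intros x y y' Hx Hy Hy' L.
    destruct (mvt_strict (fun t => sg * fst (dp (x, t)))%R (fun t => sg * - snd (ddp (x, t)))%R y y' L)
      as [t [Ht E]].
    - intros t Ht. apply cdiff_dy, Ddp, Hbox; auto.
      apply Rabs_lt_between in Hy. apply Rabs_lt_between in Hy'. apply Rabs_def1; lra.
    - assert (N := Hneg (x, t)). assert (0 < sg * - snd (ddp (x, t)))%R.
      { assert (sg * snd (ddp (x, t)) < 0)%R; [|lra]. apply N, Hbox; auto.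
        apply Rabs_lt_between in Hy. apply Rabs_lt_between in Hy'. apply Rabs_def1; lra. }
      cbv beta in E. nra. }
  { intros x x' y Hx Hx' Hy L.
    destruct (mvt_strict (fun t => sg * snd (dp (t, y)))%R (fun t => sg * snd (ddp (t, y)))%R x x' L)
      as [t [Ht E]].
    - intros t Ht. apply cdiff_dx, Ddp, Hbox; auto.
      apply Rabs_lt_between in Hx. apply Rabs_lt_between in Hx'. apply Rabs_def1; lra.
    - assert (N : (sg * snd (ddp (t, y)) < 0)%R).
      { apply Hneg, Hbox; auto.
        apply Rabs_lt_between in Hx. apply Rabs_lt_between in Hx'. apply Rabs_def1; lra. }
      cbv beta in E. nra. }
  { replace (x0, y0) with (Q z0) by (unfold x0, y0; now destruct (Q z0)).
    unfold dp. rewrite Hq0. assert (Ec := proj1 (critical_iff u dh dg z0 Hu HQ0) Hcrit).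
    fold p1 q1 in Ec. rewrite Ec. ring. }
  assert (Hss : (sg * sg = 1)%R) by (destruct Hsg; subst sg; ring).
  (* A box in the coordinate Q rather than a disc about z0: over each abscissa it contains exactly
     the vertical segment on which the real lemma counts solutions. *)
  set (U := fun z => (Cmod (z - z0) < r)%R /\ (Rabs (fst (Q z) - x0) < eps)%R /\
     (Rabs (snd (Q z) - y0) < rho')%R).
  assert (HU1 : forall z, U z -> q (Q z) = z).
  { intros z (H1 & H2 & H3). apply Hq1q; auto. replace (Q z) with (fst (Q z), snd (Q z))
      by (now destruct (Q z)). apply Hbox; lra. }
  assert (HU1' : forall z, U z -> (Cmod (Q z - Q z0) < rho)%R).
  { intros z (H1 & H2 & H3). replace (Q z) with (fst (Q z), snd (Q z))
      by (now destruct (Q z)). apply Hbox; lra. }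
  assert (HU2 : forall x y, (Rabs (x - x0) < eps)%R -> (Rabs (y - y0) < rho')%R ->
     U (q (x, y)) /\ Q (q (x, y)) = (x, y)).
  { intros x y Hx Hy. destruct (Hq2q (x, y)) as (H1 & H2 & _); [apply Hbox; lra|].
    split; auto. unfold U. rewrite H2. auto. }
  assert (Hxf : cx u (f z0) = x0) by apply Hfst.
  assert (Hyf : (cy u (f z0) = sg * m x0)%R).
  { rewrite Hsnd, Hm0. replace (x0, y0) with (Q z0) by (unfold x0, y0; now destruct (Q z0)).
    unfold p. rewrite Hq0, <- Rmult_assoc, Hss. ring. }
  assert (Hv0 : (sg * snd (p (x0, y0)) = m x0)%R) by (symmetry; exact Hm0).
  assert (Huinj : forall a b, u * a = u * b -> a = b).
  { intros a b E. replace a with (/ u * (u * a)) by (field; auto). rewrite E. field; auto. }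
  assert (HUval : forall z, U z -> (sg * snd (p (fst (Q z), snd (Q z))) = sg * cy u (f z))%R).
  { intros z Hz. replace (fst (Q z), snd (Q z)) with (Q z) by (now destruct (Q z)).
    unfold p. rewrite (HU1 z Hz), Hsnd. reflexivity. }
  assert (Hcval : forall w : C, (Rabs (cy u w - cy u (f z0)) < eps)%R ->
     (Rabs (sg * cy u w - sg * snd (p (x0, y0))) < eps)%R).
  { intros w Hw. rewrite Hv0. replace (m x0) with (sg * cy u (f z0))%R
      by (rewrite Hyf, <- Rmult_assoc, Hss; ring).
    rewrite <- Rmult_minus_distr_l, Rabs_mult.
    replace (Rabs sg) with 1%R; [lra|]. destruct Hsg; subst sg.
    - now rewrite Rabs_R1.
    - rewrite Rabs_left; lra. }
  assert (HUin : exists r', (0 < r')%R /\ forall z, (Cmod (z - z0) < r')%R -> U z).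
  { assert (Hmn : (0 < Rmin eps rho')%R) by (apply Rmin_glb_lt; lra).
    destruct (hol_cts _ _ HQ z0 _ Hmn) as [r' [Hr' K]].
    exists (Rmin r r'). split; [now apply Rmin_glb_lt|]. intros z Hz.
    assert (Z1 := Rlt_le_trans _ _ _ Hz (Rmin_l _ _)).
    assert (Z2 := K z (Rlt_le_trans _ _ _ Hz (Rmin_r _ _))). cbv beta in Z2.
    assert (A1 := fst_le_Cmod (Q z - Q z0)). assert (A2 := snd_le_Cmod (Q z - Q z0)).
    change (fst (Q z - Q z0)) with (fst (Q z) - x0)%R in A1.
    change (snd (Q z - Q z0)) with (snd (Q z) - y0)%R in A2.
    assert (B1 := Rmin_l eps rho'). assert (B2 := Rmin_r eps rho').
    split; [auto|split; lra]. }
  destruct HUin as [r' [Hr' HUin]].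
  exists U, r', eps, sg, (fun x => sg * m x)%R, (fun x => sg * dm x)%R.
  constructor; rewrite ?Hxf; auto.
  - intros z (H1 & _). lra.
  - intros z Hz. assert (Z := HU1 z Hz). destruct (Hgood (Q z) (HU1' z Hz)) as [G1 G2].
    rewrite Z in G1, G2. split; auto. unfold k in G2. fold W q1. intro E. rewrite E in G2. lra.
  - intros x Hx. apply is_derive_scal. auto.
  - intros x x' Hx Hx' Hn. rewrite Rmult_assoc, <- Rmult_plus_distr_l, <- !Rmult_assoc, Hss, !Rmult_1_l.
    now apply Hconv.
  - intros w Hw1 Hw2 Hpos.
    destruct (Htwo (cx u w) (sg * cy u w)%R Hw1 (Hcval w Hw2)) as
      (y1 & y2 & Y12 & Y1 & Y2 & V1 & V2 & Huniq).
    { rewrite Rmult_minus_distr_l, <- Rmult_assoc, Hss in Hpos. lra. }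
    destruct (HU2 _ y1 Hw1 Y1) as [A1 B1]. destruct (HU2 _ y2 Hw1 Y2) as [A2 B2].
    assert (Heq : forall y, (Rabs (y - y0) < rho')%R -> (sg * snd (p (cx u w, y)) = sg * cy u w)%R ->
        f (q (cx u w, y)) = w).
    { intros y Hy V. destruct (HU2 _ y Hw1 Hy) as [A0 B0]. apply Huinj.
      apply injective_projections.
      - change (cx u (f (q (cx u w, y))) = cx u w). rewrite Hfst, B0. reflexivity.
      - change (cy u (f (q (cx u w, y))) = cy u w). rewrite Hsnd. change (P (q (cx u w, y))) with (p (cx u w, y)).
        apply (f_equal (Rmult sg)) in V. rewrite <- !Rmult_assoc, Hss, !Rmult_1_l in V. exact V. }
    exists (q (cx u w, y1) :: q (cx u w, y2) :: nil). split; [|split; [reflexivity|]].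
    + constructor; [|constructor; [simpl; tauto|constructor]].
      intros [E|[]]. apply (f_equal Q) in E. rewrite B1, B2 in E. inversion E. lra.
    + intro z. split.
      * intros [Uz Ez]. assert (Z := HUval z Uz). rewrite Ez in Z.
        assert (Fz := Hfst z). rewrite Ez in Fz.
        destruct (Huniq (snd (Q z))) as [E|E].
        -- destruct Uz as (_ & _ & Uz). exact Uz.
        -- rewrite Fz. exact Z.
        -- left. rewrite <- E, Fz. replace (fst (Q z), snd (Q z)) with (Q z) by (now destruct (Q z)). auto.
        -- right; left. rewrite <- E, Fz. replace (fst (Q z), snd (Q z)) with (Q z) by (now destruct (Q z)). auto.
      * intros [E|[E|[]]]; subst z; auto.
  - intros w Hw1 Hw2 Hneg' z Uz Ez.
    apply (Hnone (cx u w) (sg * cy u w)%R Hw1 (Hcval w Hw2)) with (y := snd (Q z)).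
    + rewrite Rmult_minus_distr_l, <- Rmult_assoc, Hss in Hneg'. lra.
    + destruct Uz as (_ & _ & Uz). exact Uz.
    + subst w. rewrite <- (HUval z Uz), Hfst. reflexivity.
  - intros z Uz Hz. destruct (Hgood (Q z) (HU1' z Uz)) as [G1 _]. rewrite (HU1 z Uz) in G1.
    assert (E := proj1 (critical_iff u dh dg z Hu G1) Hz).
    assert (V := Hcr (fst (Q z)) (snd (Q z))). rewrite (HUval z Uz) in V.
    rewrite Hfst, <- V, <- Rmult_assoc, Hss; [ring| | |].
    + apply Uz. + apply Uz.
    + replace (fst (Q z), snd (Q z)) with (Q z) by (now destruct (Q z)).
      unfold dp. rewrite (HU1 z Uz). fold p1 q1 in E. rewrite E. ring.
  - intros x Hx. destruct (Hcurve x Hx) as (y & Y1 & Y2 & Y3).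
    destruct (HU2 x y Hx Y1) as [A1 B1]. exists (q (x, y)). split; auto.
    assert (G := HU1' _ A1). destruct (Hgood _ G) as [G1 _]. rewrite (HU1 _ A1) in G1.
    split; [|split].
    + apply (critical_iff u dh dg _ Hu G1). fold p1 q1.
      change (p1 (q (x, y)) / q1 (q (x, y))) with (dp (x, y)).
      destruct Hsg; subst sg; lra.
    + rewrite Hfst, B1. reflexivity.
    + rewrite Hsnd, <- Y3, <- Rmult_assoc, Hss. unfold p. ring.
Qed.

(** * Proper maps, preimage counts and components *)

Lemma harmonic_cts f h g dh dg : hol h dh -> hol g dg ->
  (forall z, f z = h z + Cconj (g z)) -> ctsC f.
Proof.
  intros Hh Hg Hf z. rewrite Hf.
  apply (tends_ext (cnear z) (fun z => h z + Cconj (g z))).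
  - apply filter_forall. intro w. now rewrite Hf.
  - assert (X := hol_cts _ _ Hh z). assert (Y := hol_cts _ _ Hg z). tends_auto.
Qed.

(** If no radius works, points z_n with |z_n| > n and f(z_n) within 1 / (n + 1) of [w0] exhibit [w0]
    as a cluster value. *)
Lemma proper_off_cluster f w0 : ~ cluster_inf f w0 ->
  exists r del, (0 < del)%R /\ forall z, (Cmod (f z - w0) < del)%R -> (Cmod z <= r)%R.
Proof.
  intro H. apply NNPP. intro Hno. apply H.
  assert (K : forall n : nat, exists z, (Cmod (f z - w0) < / (INR n + 1))%R /\ (INR n < Cmod z)%R).
  { intro n. apply NNPP. intro Hn. apply Hno. exists (INR n), (/ (INR n + 1))%R. split.
    - apply Rinv_0_lt_compat. generalize (pos_INR n). lra.
    - intros z Hz. apply Rnot_lt_le. intro L. apply Hn. now exists z. }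
  exists (fun n => proj1_sig (constructive_indefinite_description _ (K n))).
  assert (Z : forall n, let z := proj1_sig (constructive_indefinite_description _ (K n)) in
     (Cmod (f z - w0) < / (INR n + 1))%R /\ (INR n < Cmod z)%R)
    by (intro n; exact (proj2_sig (constructive_indefinite_description _ (K n)))).
  split.
  - apply is_lim_seq_le_p_loc with INR.
    + exists 0%nat. intros n _. left. apply Z.
    + apply is_lim_seq_INR.
  - intros eps He. destruct (archimed_cor1 eps He) as [n0 [Hn0 Hp]].
    exists n0. intros n Hn. eapply Rlt_trans; [apply Z|]. eapply Rle_lt_trans; [|exact Hn0].
    apply Rinv_le_contravar; [now apply lt_0_INR|]. apply le_INR in Hn. lra.
Qed.

Lemma proper_not_cluster f w0 r del w : (0 < del)%R ->
  (forall z, (Cmod (f z - w0) < del)%R -> (Cmod z <= r)%R) ->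
  (Cmod (w - w0) < del)%R -> ~ cluster_inf f w.
Proof.
  intros Hd H Hw [zs [H1 H2]].
  destruct (H2 (del - Cmod (w - w0))%R ltac:(lra)) as [n0 Hn0].
  apply is_lim_seq_spec in H1. destruct (H1 r) as [n1 Hn1].
  specialize (Hn0 (max n0 n1) (Nat.le_max_l _ _)). specialize (Hn1 (max n0 n1) (Nat.le_max_r _ _)).
  assert (T := Cmod_sub_triangle (f (zs (max n0 n1))) w w0).
  specialize (H (zs (max n0 n1)) ltac:(lra)). lra.
Qed.

(** Properness confines the preimages of nearby values to one disc, where compactness applies. This
    is the way in which properties of the fibre over [w0] pass to nearby fibres, with [K] the set to
    be kept out. *)
Lemma preimages_away f w0 (K : C -> Prop) : ctsC f -> ~ cluster_inf f w0 ->
  (forall z, f z = w0 -> cnear z (fun v => ~ K v)) ->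
  cnear w0 (fun w => ~ cluster_inf f w /\ forall z, f z = w -> ~ K z).
Proof.
  intros Hf Hc HK. destruct (proper_off_cluster f w0 Hc) as (r & d & Hd & Hr).
  destruct (compact_away f w0 K r Hf HK) as (d' & Hd' & Ha).
  exists (Rmin d d'). split; [now apply Rmin_glb_lt|]. intros w Hw. split.
  - apply (proper_not_cluster f w0 r d); auto. eapply Rlt_le_trans; [exact Hw|apply Rmin_l].
  - intros z E Kz. subst w.
    assert (X := Ha z (Hr z (Rlt_le_trans _ _ _ Hw (Rmin_l _ _))) Kz).
    assert (Y := Rlt_le_trans _ _ _ Hw (Rmin_r _ _)). lra.
Qed.

(** * Counting preimages *)

Lemma complete_preimage f w : finite_valence f ->
  exists l, NoDup l /\ forall z, f z = w <-> In z l.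
Proof.
  intros [M HM]. apply NNPP. intro Hno.
  assert (K : forall n, exists l, NoDup l /\ length l = n /\ forall z, In z l -> f z = w).
  { induction n as [|n [l (H1 & H2 & H3)]].
    - exists nil. split; [constructor|]. split; [reflexivity|]. intros z [].
    - assert (E : exists z, f z = w /\ ~ In z l).
      { apply NNPP. intro Hn. apply Hno. exists l. split; auto. intro z. split; auto.
        intro E. apply NNPP. intro Hi. apply Hn. now exists z. }
      destruct E as [z [E1 E2]]. exists (z :: l). split; [now constructor|].
      split; [simpl; now rewrite H2|]. intros v [<-|Hv]; auto. }
  destruct (K (S M)) as [l (H1 & H2 & H3)]. assert (X := HM w l H1 H3). lia.
Qed.

Lemma count_eq_ext (P Q : C -> Prop) n : (forall z, P z <-> Q z) -> count_eq P n -> count_eq Q n.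
Proof.
  intros H (l & H1 & H2 & H3). exists l. split; auto. split; auto. intro z. now rewrite <- H.
Qed.

Lemma count_eq_0 (P : C -> Prop) : (forall z, ~ P z) -> count_eq P 0.
Proof.
  intro H. exists nil. split; [constructor|]. split; [reflexivity|]. intro z. split; [|intros []].
  intro Hz. exact (H z Hz).
Qed.

Lemma count_eq_union (P Q : C -> Prop) n m : count_eq P n -> count_eq Q m ->
  (forall z, P z -> Q z -> False) -> count_eq (fun z => P z \/ Q z) (n + m).
Proof.
  intros (l & H1 & H2 & H3) (l' & H1' & H2' & H3') Hd. exists (l ++ l'). split; [|split].
  - apply NoDup_app; auto. intros z Hz Hz'. apply (Hd z); [now apply H3|now apply H3'].
  - now rewrite length_app, H2, H2'.
  - intro z. rewrite in_app_iff, H3, H3'. tauto.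
Qed.

Lemma count_eq_bigunion {I : Type} (l : list I) (A : I -> C -> Prop) (n : I -> nat) :
  NoDup l -> (forall i, In i l -> count_eq (A i) (n i)) ->
  (forall i j z, In i l -> In j l -> A i z -> A j z -> i = j) ->
  count_eq (fun z => exists i, In i l /\ A i z) (fold_right (fun i s => n i + s)%nat 0%nat l).
Proof.
  induction l as [|i l IH]; intros HN Hc Hd.
  - simpl. apply count_eq_0. intros z [i [[] _]].
  - inversion HN as [|i' l' Hni HN' E]; subst. simpl.
    apply (count_eq_ext (fun z => A i z \/ exists j, In j l /\ A j z)).
    { intro z. split.
      - intros [Ha|[j [Hj Ha]]]; [exists i|exists j]; auto.
      - intros [j [[<-|Hj] Ha]]; [left|right; exists j]; auto. }
    apply count_eq_union.
    + apply Hc. now left.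
    + apply IH; auto.
      * intros j Hj. apply Hc. now right.
      * intros j k z Hj Hk. apply Hd; now right.
    + intros z Ha [j [Hj Hb]]. assert (i = j) by (apply (Hd i j z); auto; [now left|now right]).
      subst j. contradiction.
Qed.

Lemma list_choice {I X : Type} (x0 : X) (l : list I) (P : I -> X -> Prop) :
  (forall i, In i l -> exists x, P i x) -> exists F : I -> X, forall i, In i l -> P i (F i).
Proof.
  intro H. assert (K : forall i, exists x, In i l -> P i x).
  { intro i. destruct (classic (In i l)) as [Hi|Hi].
    - destruct (H i Hi) as [x Hx]. now exists x.
    - exists x0. intro; contradiction. }
  exists (fun i => proj1_sig (constructive_indefinite_description _ (K i))).
  intro i. exact (proj2_sig (constructive_indefinite_description _ (K i))).
Qed.

Lemma list_eps {I : Type} (l : list I) (P : I -> R -> Prop) :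
  (forall i, In i l -> exists e, (0 < e)%R /\ forall e', (0 < e' <= e)%R -> P i e') ->
  exists e, (0 < e)%R /\ forall i, In i l -> P i e.
Proof.
  intro H.
  assert (K : exists e, (0 < e)%R /\ forall i, In i l -> forall e', (0 < e' <= e)%R -> P i e').
  { induction l as [|i l IH].
    - exists 1%R. split; [lra|]. intros i [].
    - destruct IH as [e [He IH]]; [intros j Hj; apply H; now right|].
      destruct (H i (or_introl eq_refl)) as [e1 [He1 H1]].
      exists (Rmin e e1). split; [now apply Rmin_glb_lt|].
      intros j [<-|Hj] e' He'.
      + apply H1. split; [lra|]. eapply Rle_trans; [apply He'|apply Rmin_r].
      + apply IH; auto. split; [lra|]. eapply Rle_trans; [apply He'|apply Rmin_l]. }
  destruct K as [e [He K]]. exists e. split; auto. intros i Hi. apply K; auto. lra.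
Qed.

Lemma list_separation (l : list C) :
  exists d, (0 < d)%R /\ forall a b, In a l -> In b l -> a <> b -> (2 * d <= Cmod (a - b))%R.
Proof.
  destruct (list_eps l (fun a d => forall b, In b l -> a <> b -> (2 * d <= Cmod (a - b))%R)) as [d [Hd H]].
  - intros a Ha.
    destruct (list_eps l (fun b d => a <> b -> (2 * d <= Cmod (a - b))%R)) as [d [Hd H]].
    + intros b Hb. destruct (classic (a = b)) as [E|E].
      * exists 1%R. split; [lra|]. intros; contradiction.
      * assert (X : (0 < Cmod (a - b))%R) by (apply Cmod_gt_0; now apply Cminus_neq0).
        exists (Cmod (a - b) / 2)%R. split; [lra|]. intros; lra.
    + exists d. split; auto. intros e' He' b Hb Hn. specialize (H b Hb Hn). lra.
  - exists d. split; auto.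
Qed.

Lemma cnear_list {I : Type} (z : C) (l : list I) (P : I -> C -> Prop) :
  (forall i, In i l -> cnear z (P i)) -> cnear z (fun w => forall i, In i l -> P i w).
Proof.
  induction l as [|i l IH]; intro H.
  - apply filter_forall. intros w i [].
  - eapply filter_imp; [|apply filter_and; [apply (H i); now left|apply IH; intros j Hj; apply H; now right]].
    intros w [H1 H2] j [<-|Hj]; auto.
Qed.

(* [D] selects a region near [w0] and [n z] is the number of preimages near [z] of points of
   that region. *)
Lemma local_count f w0 l (D : C -> Prop) (n : C -> nat) : ctsC f -> ~ cluster_inf f w0 ->
  NoDup l -> (forall z, f z = w0 <-> In z l) ->
  (forall z, In z l -> forall r0, (0 < r0)%R -> exists (U : C -> Prop) r, (0 < r)%R /\
     (forall v, (Cmod (v - z) < r)%R -> U v) /\ (forall v, U v -> (Cmod (v - z) < r0)%R) /\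
     cnear w0 (fun w => D w -> count_eq (fun v => U v /\ f v = w) (n z))) ->
  cnear w0 (fun w => D w -> count_eq (fun v => f v = w) (fold_right (fun z s => n z + s)%nat 0%nat l)).
Proof.
  intros Hf Hc HN Hl Hch.
  destruct (list_separation l) as [d [Hd Hsep]].
  destruct (list_choice (fun _ : C => True) l (fun z U => exists r, (0 < r)%R /\
     (forall v, (Cmod (v - z) < r)%R -> U v) /\ (forall v, U v -> (Cmod (v - z) < d)%R) /\
     cnear w0 (fun w => D w -> count_eq (fun v => U v /\ f v = w) (n z)))) as [U HU].
  { intros z Hz. exact (Hch z Hz d Hd). }
  (* With the complement of the charts as the excluded set, all preimages of nearby values lie in
     the charts. These have radius [d] about centres at least 2 d apart, so none is counted
     twice. *)
  assert (H1 : cnear w0 (fun w => ~ cluster_inf f w /\ forall z, f z = w ->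
      ~ (~ exists i, In i l /\ U i z))).
  { apply preimages_away; auto. intros z Hz. apply Hl in Hz.
    destruct (HU z Hz) as (r & Hr & HUr & _). exists r. split; auto.
    intros v Hv Hn. apply Hn. exists z. auto. }
  assert (H2 : cnear w0 (fun w => forall z, In z l -> D w -> count_eq (fun v => U z v /\ f v = w) (n z))).
  { apply cnear_list. intros z Hz. destruct (HU z Hz) as (r & _ & _ & _ & H). exact H. }
  eapply filter_imp; [|apply filter_and; [exact H1|exact H2]]. cbv beta.
  intros w [[_ Ha] Hb] Dw.
  apply (count_eq_ext (fun v => exists i, In i l /\ (U i v /\ f v = w))).
  { intro v. split; [intros (i & _ & _ & E); exact E|]. intro E.
    destruct (NNPP _ (Ha v E)) as (i & Hi & Ui). exists i. auto. }
  apply (count_eq_bigunion l (fun i v => U i v /\ f v = w)); auto.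
  intros i j z Hi Hj [Ui _] [Uj _]. apply NNPP. intro Hn.
  assert (X := Hsep i j Hi Hj Hn).
  destruct (HU i Hi) as (_ & _ & _ & A1 & _). destruct (HU j Hj) as (_ & _ & _ & A2 & _).
  apply A1 in Ui. apply A2 in Uj. assert (T := Cmod_sub_triangle i z j).
  rewrite (Cmod_sub_sym i z) in T. lra.
Qed.

Lemma harmonic_sdiff f h g dh dg d2h d2g z0 : hol h dh -> hol g dg -> hol dh d2h -> hol dg d2g ->
  (forall z, f z = h z + Cconj (g z)) -> sdiff f z0 (dh z0) (dg z0).
Proof.
  intros Hh Hg Hdh Hdg Hf eps He.
  assert (Sh := strict_diff h dh z0 (filter_forall _ Hh) (hol_cts _ _ Hdh z0)).
  assert (Sg := strict_diff g dg z0 (filter_forall _ Hg) (hol_cts _ _ Hdg z0)).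
  destruct (Sh (eps / 2)%R ltac:(lra)) as [d1 [Hd1 S1]].
  destruct (Sg (eps / 2)%R ltac:(lra)) as [d2 [Hd2 S2]].
  exists (Rmin d1 d2). split; [now apply Rmin_glb_lt|]. intros z z' Hz Hz'.
  assert (X := S1 z z' (Rlt_le_trans _ _ _ Hz (Rmin_l _ _)) (Rlt_le_trans _ _ _ Hz' (Rmin_l _ _))).
  assert (Y := S2 z z' (Rlt_le_trans _ _ _ Hz (Rmin_r _ _)) (Rlt_le_trans _ _ _ Hz' (Rmin_r _ _))).
  assert (C0 : Cconj (0 * (z' - z)) = 0) by (apply injective_projections; simpl; ring).
  rewrite C0 in X, Y. rewrite !Hf.
  replace (h z' + Cconj (g z') - (h z + Cconj (g z)) -
     (dh z0 * (z' - z) + Cconj (dg z0 * (z' - z))))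
    with ((h z' - h z - (dh z0 * (z' - z) + 0)) +
          Cconj (g z' - g z - (dg z0 * (z' - z) + 0))).
  - eapply Rle_trans; [apply Cmod_triangle|]. rewrite Cmod_conj. lra.
  - rewrite !Cminus_conj, Cplus_conj.
    replace (Cconj 0) with (RtoC 0) by (apply injective_projections; simpl; ring). ring.
Qed.

Lemma regular_chart f z0 a b : sdiff f z0 a b -> Cmod a <> Cmod b ->
  forall r0, (0 < r0)%R -> exists (U : C -> Prop) r, (0 < r)%R /\
     (forall v, (Cmod (v - z0) < r)%R -> U v) /\ (forall v, U v -> (Cmod (v - z0) < r0)%R) /\
     cnear (f z0) (fun w => count_eq (fun v => U v /\ f v = w) 1).
Proof.
  intros HS Hab r0 Hr0.
  destruct (local_homeo f z0 a b HS Hab) as (kap & r1 & Hk & Hr1 & Hinj & Hsur).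
  set (r := Rmin r0 r1). assert (Hr : (0 < r)%R) by (now apply Rmin_glb_lt).
  destruct (Hsur r) as (rho & Hrho & Hs); [split; [auto|apply Rmin_r]|].
  exists (fun v => (Cmod (v - z0) < r)%R), r. split; auto. split; auto. split.
  { intros v Hv. eapply Rlt_le_trans; [exact Hv|apply Rmin_l]. }
  exists rho. split; auto. intros w Hw. destruct (Hs w Hw) as [z [Z1 Z2]].
  exists (z :: nil). split; [constructor; [intros []|constructor]|]. split; [reflexivity|].
  intro v. split.
  - intros [V1 V2]. left.
    assert (X := Hinj z v (Rlt_le_trans _ _ _ Z1 (Rmin_r _ _)) (Rlt_le_trans _ _ _ V1 (Rmin_r _ _))).
    rewrite V2, Z2 in X. replace (w - w) with (RtoC 0) in X by ring. rewrite Cmod_0 in X.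
    symmetry. apply eq_of_Cminus, Cmod_eq_0, Rle_antisym; [|apply Cmod_ge_0].
    assert (Y := Cmod_ge_0 (v - z)). nra.
  - intros [<-|[]]. auto.
Qed.

(** * Connectedness and components *)

Lemma cconnected_one_side (A U V : C -> Prop) : cconnected A -> copen U -> copen V ->
  (forall z, A z -> U z \/ V z) -> (forall z, A z -> U z -> V z -> False) ->
  (forall z, A z -> U z) \/ (forall z, A z -> V z).
Proof.
  intros HA HU HV Hcov Hd. apply NNPP. intro Hn. apply not_or_and in Hn. destruct Hn as [N1 N2].
  apply not_all_ex_not in N1. destruct N1 as [a Ha]. apply imply_to_and in Ha. destruct Ha as [a1 a2].
  apply not_all_ex_not in N2. destruct N2 as [b Hb]. apply imply_to_and in Hb. destruct Hb as [b1 b2].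
  apply HA. exists U, V. split; auto. split; auto. split; [auto|]. split; [|split; [|auto]].
  - exists b. split; auto. destruct (Hcov b); tauto.
  - exists a. split; auto. destruct (Hcov a); tauto.
Qed.

Lemma cconnected_union (A B : C -> Prop) p : cconnected A -> cconnected B -> A p -> B p ->
  cconnected (fun z => A z \/ B z).
Proof.
  intros HA HB Ap Bp (U & V & HU & HV & Hcov & [x [Hx Ux]] & [y [Hy Vy]] & Hd).
  destruct (cconnected_one_side A U V) as [KA|KA]; auto.
  { intros z Hz. apply Hd. auto. }
  all: destruct (cconnected_one_side B U V) as [KB|KB]; auto.
  all: try (intros z Hz; apply Hd; now auto).
  - apply (Hd y); auto. destruct Hy; auto.
  - apply (Hd p); auto.
  - apply (Hd p); auto.
  - apply (Hd x); auto. destruct Hx; auto.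
Qed.

Definition seg (p q : C) (z : C) : Prop :=
  exists t, (0 <= t <= 1)%R /\ z = p + RtoC t * (q - p).

(** The retraction of the line onto [0, 1]; it extends paths given on [0, 1] to the whole line,
    where continuity is formulated. *)
Definition clamp (t : R) : R := Rmax 0 (Rmin 1 t).

Lemma clamp_bounds t : (0 <= clamp t <= 1)%R.
Proof. unfold clamp, Rmax, Rmin. repeat destruct Rle_dec; lra. Qed.

Lemma clamp_id t : (0 <= t <= 1)%R -> clamp t = t.
Proof. unfold clamp, Rmax, Rmin. repeat destruct Rle_dec; lra. Qed.

Lemma clamp_lip s t : (Rabs (clamp s - clamp t) <= Rabs (s - t))%R.
Proof.
  unfold clamp, Rmax, Rmin. repeat destruct Rle_dec; unfold Rabs; repeat destruct Rcase_abs; lra.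
Qed.

(** A separation would make the indicator of one piece, pulled back to the parameter, continuous
    with values 0 and 1 only, against the intermediate value theorem. *)
Lemma seg_connected p q : cconnected (seg p q).
Proof.
  intros (U & V & HU & HV & Hcov & [x [Hx Ux]] & [y [Hy Vy]] & Hd).
  set (sg := fun t => p + RtoC (clamp t) * (q - p)).
  assert (Hsg : forall t, seg p q (sg t)) by (intro t; exists (clamp t); split; [apply clamp_bounds|reflexivity]).
  assert (Hsc : forall t, tends (locally t) sg (sg t)).
  { intros t. assert (K : tends (locally t) (fun s => RtoC (clamp s)) (RtoC (clamp t))).
    { intros e He. apply locally_R_iff. exists e. split; auto. intros s Hs.
      rewrite <- RtoC_minus, Cmod_R. eapply Rle_lt_trans; [apply clamp_lip|auto]. }
    unfold sg. tends_auto. }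
  assert (Hop : forall W : C -> Prop, copen W -> forall t, W (sg t) -> locally t (fun s => W (sg s))).
  { intros W HW t Ht. destruct (HW _ Ht) as [e [He K]].
    eapply filter_imp; [|exact (Hsc t e He)]. cbv beta. auto. }
  set (chi := fun t => if excluded_middle_informative (U (sg t)) then 0%R else 1%R).
  assert (Hchi : continuity chi).
  { intro t. apply continuity_pt_filterlim, continuous_of_eps. intros e He. unfold chi.
    destruct (excluded_middle_informative (U (sg t))) as [E|E].
    - eapply filter_imp; [|exact (Hop U HU t E)]. cbv beta. intros s Hs.
      destruct excluded_middle_informative; [|contradiction]. now rewrite Rminus_diag, Rabs_R0.
    - assert (E' : V (sg t)) by (destruct (Hcov _ (Hsg t)); tauto).
      eapply filter_imp; [|exact (Hop V HV t E')]. cbv beta. intros s Hs.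
      destruct excluded_middle_informative as [E2|E2].
      + exfalso. exact (Hd _ (Hsg s) E2 Hs).
      + now rewrite Rminus_diag, Rabs_R0. }
  destruct Hx as [a [Ha Ea]]. destruct Hy as [b [Hb Eb]].
  assert (Ca : chi a = 0%R).
  { unfold chi. destruct excluded_middle_informative as [E|E]; auto. exfalso. apply E.
    unfold sg. rewrite clamp_id, <- Ea; auto. }
  assert (Cb : chi b = 1%R).
  { unfold chi. destruct excluded_middle_informative as [E|E]; auto. exfalso.
    apply (Hd (sg b) (Hsg b) E). unfold sg. rewrite clamp_id, <- Eb; auto. }
  destruct (IVT_gen chi a b (1 / 2) Hchi) as [c [_ Hc]].
  { rewrite Ca, Cb, Rmin_left, Rmax_right by lra. lra. }
  unfold chi in Hc. destruct excluded_middle_informative; lra.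
Qed.

Lemma component_seg X Om p q : is_component X Om -> Om p ->
  (forall z, seg p q z -> X z) -> Om q.
Proof.
  intros (_ & HX & Hc & Hmax) Hp Hs.
  apply (Hmax (fun z => Om z \/ seg p q z)).
  - apply (cconnected_union Om (seg p q) p); auto using seg_connected.
    exists 0%R. split; [lra|ring].
  - auto.
  - intros z [Hz|Hz]; auto.
  - right. exists 1%R. split; [lra|ring].
Qed.

Lemma component_eq X O1 O2 p : is_component X O1 -> is_component X O2 -> O1 p -> O2 p ->
  forall z, O1 z <-> O2 z.
Proof.
  intros (_ & X1 & C1 & M1) (_ & X2 & C2 & M2) P1 P2 z.
  assert (Cu := cconnected_union O1 O2 p C1 C2 P1 P2).
  split; intro Hz.
  - apply (M2 (fun z => O1 z \/ O2 z)); auto. intros v [Hv|Hv]; auto.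
  - apply (M1 (fun z => O1 z \/ O2 z)); auto. intros v [Hv|Hv]; auto.
Qed.

Lemma seg_in_ball p q c r : (Cmod (p - c) < r)%R -> (Cmod (q - c) < r)%R ->
  forall z, seg p q z -> (Cmod (z - c) < r)%R.
Proof.
  intros Hp Hq z [t [Ht ->]].
  replace (p + RtoC t * (q - p) - c)
      with (RtoC (1 - t) * (p - c) + RtoC t * (q - c)) by (rewrite RtoC_minus; ring).
  eapply Rle_lt_trans; [apply Cmod_triangle|].
  rewrite !Cmod_mult, !Cmod_R, !Rabs_pos_eq by lra.
  destruct (Rle_or_lt (Cmod (p - c)) (Cmod (q - c))); nra.
Qed.

(** If a ball about [w] lay in [X], segments from a point of [Om] in the ball would put the whole
    ball into [Om], and [w] would be interior. *)
Lemma boundary_not_near X Om w : is_component X Om -> cboundary Om w -> ~ cnear w X.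
Proof.
  intros Hc [Hcl Hint] [e [He K]]. apply Hint. exists e. split; auto. intros v Hv.
  destruct (Hcl e He) as [a [Ha1 Ha2]].
  apply (component_seg X Om a v Hc Ha1). intros z Hz. apply K. now apply (seg_in_ball a v).
Qed.

(** Local constancy makes both the points with n preimages and those with another number of
    preimages open sets, which would separate the component. *)
Lemma component_count_const (X Om : C -> Prop) (f : C -> C) n w0 : is_component X Om ->
  (forall w m, X w -> count_eq (fun z => f z = w) m -> cnear w (fun v => count_eq (fun z => f z = v) m)) ->
  (forall w, exists m, count_eq (fun z => f z = w) m) ->
  Om w0 -> count_eq (fun z => f z = w0) n -> forall w, Om w -> count_eq (fun z => f z = w) n.
Proof.
  intros (_ & HX & Hc & _) Hloc Hex H0 Hn w Hw. apply NNPP. intro Hne. apply Hc.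
  exists (fun v => cnear v (fun v => count_eq (fun z => f z = v) n)).
  exists (fun v => cnear v (fun v => exists m, m <> n /\ count_eq (fun z => f z = v) m)).
  assert (Huni : forall v m m', count_eq (fun z => f z = v) m -> count_eq (fun z => f z = v) m' -> m = m').
  { intros v m m' (l & L1 & L2 & L3) (l' & L1' & L2' & L3'). subst.
    apply Nat.le_antisymm; apply NoDup_incl_length; auto; intros z Hz.
    - now apply L3', L3. - now apply L3, L3'. }
  split; [|split; [|split; [|split; [|split]]]].
  - intros v Hv. apply cnear_cnear in Hv. exact Hv.
  - intros v Hv. apply cnear_cnear in Hv. exact Hv.
  - intros v Hv. destruct (Hex v) as [m Hm]. destruct (Nat.eq_dec m n) as [->|Hmn].
    + left. apply Hloc; auto.
    + right. eapply filter_imp; [|exact (Hloc v m (HX v Hv) Hm)]. cbv beta. intros x Hx. now exists m.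
  - exists w0. split; auto.
  - exists w. split; auto. destruct (Hex w) as [m Hm].
    eapply filter_imp; [|exact (Hloc w m (HX w Hw) Hm)]. cbv beta. intros x Hx. exists m. split; auto.
    intros ->. contradiction.
  - intros v _ H1 H2. apply cnear_self in H1. apply cnear_self in H2.
    destruct H2 as [m [Hm H2]]. apply Hm. exact (Huni v m n H2 H1).
Qed.

Lemma Val_on_eq_of_count f Om n : (exists w, Om w) ->
  (forall w, Om w -> count_eq (fun z => f z = w) n) -> Val_on_eq f Om n.
Proof.
  intros [w0 H0] H. split; [|exists w0; auto].
  intros w Hw l HN Hl. destruct (H w Hw) as (l' & H1 & H2 & H3). rewrite <- H2.
  apply NoDup_incl_length; auto. intros z Hz. now apply H3, Hl.
Qed.

(** * Generic values *)

Record harmonic (f h g dh dg d2h d2g : C -> C) : Prop := {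
  hm_h : hol h dh; hm_g : hol g dg; hm_dh : hol dh d2h; hm_dg : hol dg d2g;
  hm_f : forall z, f z = h z + Cconj (g z) }.

Definition crit (dh dg : C -> C) (z : C) : Prop := Cmod (dh z) = Cmod (dg z).

(** Each condition is closed in t: it holds on the whole current interval, or it fails at some point
    and then on a subinterval, to which the conditions already treated restrict. *)
Lemma select_interval {I : Type} (l : list I) (K : I -> R -> Prop) s1 s2 : (s1 < s2)%R ->
  (forall i t, In i l -> (s1 <= t <= s2)%R -> ~ K i t -> locally t (fun s => ~ K i s)) ->
  exists a b, (s1 <= a < b)%R /\ (b <= s2)%R /\ forall i, In i l ->
    (forall t, (a <= t <= b)%R -> K i t) \/ (forall t, (a <= t <= b)%R -> ~ K i t).
Proof.
  intros H12. induction l as [|i l IH]; intro HK.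
  - exists s1, s2. split; [lra|]. split; [lra|]. intros i [].
  - destruct IH as (a & b & Ha & Hb & H).
    { intros j t Hj. apply HK. now right. }
    destruct (classic (forall t, (a <= t <= b)%R -> K i t)) as [Hon|Hoff].
    + exists a, b. split; [lra|]. split; [lra|]. intros j [<-|Hj]; auto.
    + apply not_all_ex_not in Hoff. destruct Hoff as [t Ht]. apply imply_to_and in Ht.
      destruct Ht as [Ht Hn].
      destruct (proj1 (locally_R_iff _ _) (HK i t (or_introl eq_refl) ltac:(lra) Hn)) as [d [Hd Hl]].
      assert (Hex : exists a' b', (a <= a' < b' /\ b' <= b /\ t - d < a' /\ b' < t + d)%R).
      { destruct (Rlt_or_le t b) as [L|L].
        - exists t, (Rmin b (t + d / 2)). unfold Rmin. destruct Rle_dec; lra.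
        - exists (Rmax a (t - d / 2)), t. unfold Rmax. destruct Rle_dec; lra. }
      destruct Hex as (a' & b' & H1 & H2 & H3 & H4).
      exists a', b'. split; [lra|]. split; [lra|]. intros j [<-|Hj].
      * right. intros s Hs. apply Hl. apply Rabs_def1; lra.
      * destruct (H j Hj) as [X|X]; [left|right]; intros s Hs; apply X; lra.
Qed.

Lemma grid_cell a h n t : (0 < n)%nat -> (a <= t <= a + INR n * h)%R ->
  exists i, (i < n)%nat /\ (a + INR i * h <= t <= a + (INR i + 1) * h)%R.
Proof.
  induction n as [|n IH]; intros Hn Ht; [lia|].
  rewrite S_INR in Ht. destruct (Rle_or_lt (a + INR n * h) t) as [L|L].
  - exists n. split; [lia|lra].
  - destruct n as [|n]; [simpl in *; lra|].
    destruct IH as [i [Hi E]]; [lia|lra|]. exists i. split; [lia|lra].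
Qed.

(* One-dimensional Sard: n + 1 equally spaced critical values would put two critical points
   in the same cell of a partition into n cells. *)
Lemma sard_1d (k dk : R -> R) a b c d : (a < b)%R -> (c < d)%R ->
  (forall t, (a <= t <= b)%R -> is_derive k t (dk t)) ->
  (forall t, (a <= t <= b)%R -> continuity_pt dk t) ->
  exists y, (c <= y <= d)%R /\ forall t, (a <= t <= b)%R -> k t = y -> dk t <> 0%R.
Proof.
  intros Hab Hcd Hk Hdk. apply NNPP. intro Hno.
  assert (Hcv : forall y, (c <= y <= d)%R -> exists t, (a <= t <= b)%R /\ k t = y /\ dk t = 0%R).
  { intros y Hy. apply NNPP. intro Hn. apply Hno. exists y. split; auto. intros t Ht E Z.
    apply Hn. now exists t. }
  (* With the oscillation of [dk] on a cell below (d - c) / (b - a), a cell of length (b - a) / n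
     that contains a zero of [dk] changes [k] by less than (d - c) / n, the spacing of the critical
     values. *)
  assert (He : (0 < (d - c) / (b - a))%R) by (apply Rdiv_lt_0_compat; lra).
  destruct (Heine_cor2 Hdk (mkposreal _ He)) as [del Hdel]. simpl in Hdel.
  assert (Hdp := cond_pos del).
  destruct (archimed_cor1 (del / (b - a))%R) as [n [Hn1 Hn2]]; [apply Rdiv_lt_0_compat; lra|].
  assert (HnR : (0 < INR n)%R) by now apply lt_0_INR.
  set (hh := ((b - a) / INR n)%R).
  assert (Hh0 : (0 < hh)%R) by (apply Rdiv_lt_0_compat; lra).
  assert (Hh : (hh < del)%R).
  { unfold hh. apply Rmult_lt_compat_l with (r := (b - a)%R) in Hn1; [|lra].
    replace ((b - a) * (del / (b - a)))%R with (pos del) in Hn1 by (field; lra). exact Hn1. }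
  assert (Hnh : (INR n * hh = b - a)%R) by (unfold hh; field; lra).
  set (y := fun j : nat => (c + INR j * ((d - c) / INR n))%R).
  assert (Hy : forall j, (j <= n)%nat -> (c <= y j <= d)%R).
  { intros j Hj. apply le_INR in Hj. assert (P := pos_INR j). unfold y.
    assert (Q : (0 < (d - c) / INR n)%R) by (apply Rdiv_lt_0_compat; lra).
    assert (E : (INR n * ((d - c) / INR n) = d - c)%R) by (field; lra). nra. }
  assert (HT : forall j, exists ti : R * nat, (j <= n)%nat -> (a <= fst ti <= b)%R /\ k (fst ti) = y j /\
     dk (fst ti) = 0%R /\ (snd ti < n)%nat /\
     (a + INR (snd ti) * hh <= fst ti <= a + (INR (snd ti) + 1) * hh)%R).
  { intro j. destruct (Compare_dec.le_dec j n) as [L|L]; [|exists (0%R, 0%nat); intro; lia].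
    destruct (Hcv (y j) (Hy j L)) as (t & T1 & T2 & T3).
    destruct (grid_cell a hh n t Hn2 ltac:(lra)) as (i & I1 & I2).
    exists (t, i). intros _. simpl. auto. }
  set (ti := fun j => proj1_sig (constructive_indefinite_description _ (HT j))).
  assert (Hti : forall j, (j <= n)%nat -> (a <= fst (ti j) <= b)%R /\ k (fst (ti j)) = y j /\
     dk (fst (ti j)) = 0%R /\ (snd (ti j) < n)%nat /\
     (a + INR (snd (ti j)) * hh <= fst (ti j) <= a + (INR (snd (ti j)) + 1) * hh)%R)
    by (intro j; exact (proj2_sig (constructive_indefinite_description _ (HT j)))).
  assert (Hpig : exists j j', (j <= n)%nat /\ (j' <= n)%nat /\ (j < j')%nat /\ snd (ti j) = snd (ti j')).
  { apply NNPP. intro Hp.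
    assert (ND : NoDup (map (fun j => snd (ti j)) (seq 0 (S n)))).
    { apply NoDup_map_NoDup_ForallPairs; [|apply seq_NoDup].
      intros j j' Hj Hj' E. apply in_seq in Hj. apply in_seq in Hj'.
      destruct (Nat.lt_trichotomy j j') as [L|[L|L]]; auto; exfalso; apply Hp.
      - exists j, j'. repeat split; auto; lia.
      - exists j', j. repeat split; auto; lia. }
    apply NoDup_incl_length with (l' := seq 0 n) in ND.
    - rewrite length_map, !length_seq in ND. lia.
    - intros i Hi. apply in_map_iff in Hi. destruct Hi as [j [<- Hj]]. apply in_seq in Hj.
      apply in_seq. destruct (Hti j ltac:(lia)) as (_ & _ & _ & X & _). lia. }
  destruct Hpig as (j & j' & J1 & J2 & J3 & J4).
  destruct (Hti j J1) as (A1 & A2 & A3 & _ & A5). destruct (Hti j' J2) as (B1 & B2 & B3 & _ & B5).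
  rewrite <- J4 in B5.
  assert (Hyy : ((d - c) / INR n <= y j' - y j)%R).
  { unfold y. apply lt_INR in J3. assert (INR j + 1 <= INR j')%R.
    { rewrite <- S_INR. apply le_INR. apply INR_lt in J3. lia. }
    assert (Q : (0 < (d - c) / INR n)%R) by (apply Rdiv_lt_0_compat; lra). nra. }
  assert (Hq : (0 < (d - c) / INR n)%R) by (apply Rdiv_lt_0_compat; lra).
  assert (Hbig : forall s t, (a <= s <= b)%R -> (a <= t <= b)%R -> (s < t)%R -> (t - s <= hh)%R ->
     dk s = 0%R -> (Rabs (k t - k s) < (d - c) / INR n)%R).
  { intros s t Hs Ht L Lh Z. destruct (mvt_strict k dk s t L) as [x [Hx E]].
    - intros v Hv. apply Hk. lra.
    - rewrite E, Rabs_mult, (Rabs_pos_eq (t - s)) by lra.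
      assert (X := Hdel x s ltac:(lra) Hs). rewrite Z, Rminus_0_r in X.
      assert (Y : (Rabs (dk x) < (d - c) / (b - a))%R).
      { apply X. rewrite Rabs_pos_eq; lra. }
      apply Rlt_le_trans with ((d - c) / (b - a) * (t - s))%R; [apply Rmult_lt_compat_r; lra|].
      apply Rle_trans with ((d - c) / (b - a) * hh)%R; [apply Rmult_le_compat_l; lra|].
      right. unfold hh. field. lra. }
  destruct (Rtotal_order (fst (ti j)) (fst (ti j'))) as [L|[L|L]].
  - assert (X := Hbig _ _ A1 B1 L ltac:(lra) A3). rewrite A2, B2 in X.
    apply Rabs_lt_between in X. lra.
  - rewrite L, B2 in A2. lra.
  - assert (X := Hbig _ _ B1 A1 L ltac:(lra) B3). rewrite A2, B2 in X.
    apply Rabs_lt_between in X. lra.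
Qed.

Lemma cx_cts u gam t : tends (locally t) gam (gam t) -> continuity_pt (fun s => cx u (gam s)) t.
Proof.
  intro H. apply continuity_pt_filterlim.
  apply (tends_fst (fun s => u * gam s)). tends_auto.
Qed.

Lemma cy_cts u gam t : tends (locally t) gam (gam t) -> continuity_pt (fun s => cy u (gam s)) t.
Proof.
  intro H. apply continuity_pt_filterlim.
  apply (tends_snd (fun s => u * gam s)). tends_auto.
Qed.

Lemma cxy_inj (u a b : C) : u <> 0 -> cx u a = cx u b -> cy u a = cy u b -> a = b.
Proof.
  intros Hu H1 H2. assert (E : u * a = u * b) by (now apply injective_projections).
  replace a with (/ u * (u * a)) by (field; auto). rewrite E. field; auto.
Qed.

(** If one real continuous function determines f, a level between two of its values is attained on
    each of infinitely many arcs joining two points, and f takes a single value at all these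
    points. *)
Lemma infinite_level_sets f (rho : C -> R) : finite_valence f ->
  (forall phi, ctsR phi -> continuity (fun t => rho (phi t))) ->
  (forall z z', rho z = rho z' -> f z = f z') -> False.
Proof.
  intros [M HM] Hc Hdet.
  assert (Hlist : forall (P : nat -> C), (forall j k, P j = P k -> j = k) ->
     (forall j k, f (P j) = f (P k)) -> False).
  { intros P Hinj Heq.
    assert (X := HM (f (P 0%nat)) (map P (seq 0 (S M)))).
    rewrite length_map, length_seq in X.
    enough (S M <= M)%nat by lia. apply X.
    - apply NoDup_map_NoDup_ForallPairs; [|apply seq_NoDup]. intros j k _ _. apply Hinj.
    - intros z Hz. apply in_map_iff in Hz. destruct Hz as [j [<- _]]. apply Heq. }
  destruct (classic (exists p q, (rho p < rho q)%R)) as [(p & q & Hpq)|Hn].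
  (* Parabolic arcs from p to q, pairwise disjoint apart from their ends; the mid level is not
     attained at the ends. *)
  - set (path := fun (k : nat) (t : R) => p + RtoC t * (q - p) + Ci * RtoC (INR k * (t * (1 - t))) * (q - p)).
    assert (Hpc : forall k, ctsR (path k)).
    { intros k t. unfold path. assert (X := tends_RtoC t).
      assert (Y : tends (locally t) (fun s => RtoC (INR k * (s * (1 - s)))) (RtoC (INR k * (t * (1 - t))))).
      { apply (tends_ext (locally t) (fun s => RtoC (INR k) * (RtoC s * (1 - RtoC s)))).
        - apply filter_forall. intro s. now rewrite !RtoC_mult, RtoC_minus.
        - rewrite !RtoC_mult, RtoC_minus. tends_auto. }
      tends_auto. }
    assert (Hqp : q - p <> 0).
    { apply Cminus_neq0. intros ->. lra. }
    assert (K : forall k, exists t, (0 <= t <= 1)%R /\ rho (path k t) = ((rho p + rho q) / 2)%R).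
    { intro k. destruct (IVT_gen (fun t => rho (path k t)) 0 1 ((rho p + rho q) / 2)) as [t [Ht E]].
      - now apply Hc.
      - unfold path. replace (p + 0 * (q - p) + Ci * RtoC (INR k * (0 * (1 - 0))) * (q - p)) with p.
        2: { rewrite Rmult_0_l, Rmult_0_r. ring. }
        replace (p + 1 * (q - p) + Ci * RtoC (INR k * (1 * (1 - 1))) * (q - p)) with q.
        2: { rewrite Rminus_diag, !Rmult_0_r. ring. }
        rewrite Rmin_left, Rmax_right; lra.
      - rewrite Rmin_left, Rmax_right in Ht by lra. now exists t. }
    set (tt := fun k => proj1_sig (constructive_indefinite_description _ (K k))).
    assert (Htt : forall k, (0 <= tt k <= 1)%R /\ rho (path k (tt k)) = ((rho p + rho q) / 2)%R)
      by (intro k; exact (proj2_sig (constructive_indefinite_description _ (K k)))).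
    apply (Hlist (fun k => path k (tt k))).
    + intros j k E. destruct (Htt j) as [T1 E1]. destruct (Htt k) as [T2 E2].
      assert (E' : (tt j, (INR j * (tt j * (1 - tt j)))%R) = (tt k, (INR k * (tt k * (1 - tt k)))%R) :> C).
      { assert (F : forall i t, (path i t - p) / (q - p) = (t, (INR i * (t * (1 - t)))%R)).
        { intros i t. unfold path. replace (p + RtoC t * (q - p) + Ci * RtoC (INR i * (t * (1 - t))) * (q - p) - p)
            with ((RtoC t + Ci * RtoC (INR i * (t * (1 - t)))) * (q - p)) by ring.
          replace ((RtoC t + Ci * RtoC (INR i * (t * (1 - t)))) * (q - p) / (q - p))
            with (RtoC t + Ci * RtoC (INR i * (t * (1 - t)))) by (field; auto).
          apply injective_projections; simpl; ring. }
        rewrite <- !F, E. reflexivity. }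
      inversion E' as [[H1 H2]]. rewrite H1 in H2.
      assert (Hne0 : tt k <> 0%R).
      { intro Z. rewrite Z in E2. unfold path in E2.
        replace (p + 0 * (q - p) + Ci * RtoC (INR k * (0 * (1 - 0))) * (q - p)) with p in E2; [lra|].
        rewrite Rmult_0_l, Rmult_0_r. ring. }
      assert (Hne1 : tt k <> 1%R).
      { intro Z. rewrite Z in E2. unfold path in E2.
        replace (p + 1 * (q - p) + Ci * RtoC (INR k * (1 * (1 - 1))) * (q - p)) with q in E2; [lra|].
        rewrite Rminus_diag, !Rmult_0_r. ring. }
      apply Rmult_eq_reg_r in H2; [now apply INR_eq|]. nra.
    + intros j k. apply Hdet. destruct (Htt j) as [_ ->]. destruct (Htt k) as [_ ->]. reflexivity.
  (* Here [rho] is constant, hence f is constant as well, and any infinite sequence of points will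
     do. *)
  - apply (Hlist (fun k => RtoC (INR k))).
    + intros j k E. apply RtoC_inj in E. now apply INR_eq.
    + intros j k. apply Hdet. apply Rle_antisym; apply Rnot_lt_le; intro L; apply Hn; eauto.
Qed.

(** The equation places all values of f on a line through [K]. The imaginary part determines a point
    of the line when it is vertical, c = -1, and the real part does otherwise. *)
Lemma not_in_line f c K : ctsC f -> finite_valence f -> Cmod c = 1%R ->
  (forall z, f z - K = c * Cconj (f z - K)) -> False.
Proof.
  intros Hf Hv Hc H.
  assert (Hd : forall z z', f z - f z' = c * Cconj (f z - f z')).
  { intros z z'. replace (f z - f z') with ((f z - K) - (f z' - K)) at 1 by ring.
    rewrite (H z), (H z'), !Cminus_conj. ring. }
  destruct (classic (c = - (1))) as [E|E].
  - apply (infinite_level_sets f (fun z => snd (f z)) Hv).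
    + intros phi Hphi t. apply continuity_pt_filterlim, (tends_snd (fun s => f (phi s))).
      now apply ctsR_comp.
    + intros z z' Hs. apply injective_projections; auto. specialize (Hd z z'). rewrite E in Hd.
      apply (f_equal fst) in Hd. simpl in Hd. lra.
  - apply (infinite_level_sets f (fun z => fst (f z)) Hv).
    + intros phi Hphi t. apply continuity_pt_filterlim, (tends_fst (fun s => f (phi s))).
      now apply ctsR_comp.
    + intros z z' Hs. apply injective_projections; auto. specialize (Hd z z').
      set (y := (snd (f z) - snd (f z'))%R).
      assert (Ed : f z - f z' = Ci * RtoC y).
      { apply injective_projections; simpl; unfold y; [rewrite Hs|]; ring. }
      destruct (Req_dec y 0) as [Z|Z]; [unfold y in Z; lra|]. exfalso. apply E.
      rewrite Ed in Hd. replace (Cconj (Ci * RtoC y)) with (- (Ci * RtoC y)) in Hd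
        by (apply injective_projections; simpl; ring).
      assert (N : Ci * RtoC y <> 0).
      { intro Q. apply (f_equal snd) in Q. simpl in Q. lra. }
      assert (Q : (c + 1) * (Ci * RtoC y) = 0).
      { replace ((c + 1) * (Ci * RtoC y)) with (Ci * RtoC y - c * - (Ci * RtoC y)) by ring.
        rewrite <- Hd. ring. }
      set (m := Ci * RtoC y) in *. clearbody m.
      replace c with ((c + 1) * m / m - 1) by (field; auto).
      rewrite Q. field. auto.
Qed.

Lemma hol_const_of_zero h dh z0 r : hol h dh ->
  (forall z, (Cmod (z - z0) < r)%R -> dh z = 0) -> forall z, (Cmod (z - z0) < r)%R -> h z = h z0.
Proof.
  intros Hh H z Hz. apply eq_of_Cminus, Cmod_eq_0, Rle_antisym; [|apply Cmod_ge_0].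
  assert (P := path_mean_value (fun s => h (z0 + RtoC s * (z - z0)))
     (fun s => dh (z0 + RtoC s * (z - z0)) * (z - z0)) 0).
  cbv beta in P. replace (z0 + RtoC 1 * (z - z0)) with z in P by ring.
  replace (z0 + RtoC 0 * (z - z0)) with z0 in P by ring.
  apply Rle_trans with (2 * 0)%R; [|lra]. apply P.
  - intros t Ht. apply (pdiff_comp (fun s => z0 + RtoC s * (z - z0))); [apply pdiff_seg|apply Hh].
  - intros t Ht. rewrite H.
    + replace (0 * (z - z0)) with (RtoC 0) by ring. rewrite Cmod_0. lra.
    + replace (z0 + RtoC t * (z - z0) - z0) with (RtoC t * (z - z0)) by ring.
      rewrite Cmod_mult, Cmod_R, Rabs_pos_eq by lra. assert (X := Cmod_ge_0 (z - z0)). nra.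
Qed.

Lemma isolated_zeros k dk : hol k dk -> (exists z, k z <> 0) ->
  forall z, cnear z (fun w => k w = 0 -> w = z).
Proof.
  intros Hk [z1 H1] z. apply NNPP. intro Hn. apply H1.
  apply (identity_theorem k dk z Hk). intros e He. apply NNPP. intro Hno. apply Hn.
  exists e. split; auto. intros w Hw Z. apply NNPP. intro Hne. apply Hno. now exists w.
Qed.

(** As a rule k = h' W serves. If this vanishes identically but g' does not, k = g' serves because
    its condition is never met: a critical point with g' <> 0 has h' <> 0, so W = 0 nearby, h' = c
    g' everywhere with |c| = 1, and f maps into a line. If g' vanishes identically, k = h' serves:
    critical points are its zeros, and it is not identically zero since f is not constant. *)
Lemma generic_function f h g dh dg d2h d2g : harmonic f h g dh dg d2h d2g -> finite_valence f ->
  exists k dk, hol k dk /\ (exists z, k z <> 0) /\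
    forall z, crit dh dg z -> k z <> 0 -> dh z <> 0 /\ wronsk dh dg d2h d2g z <> 0.
Proof.
  intros [Hh Hg Hdh Hdg Hf] Hv.
  destruct (hol_derivative _ _ Hdh) as [d3h Hd2h]. destruct (hol_derivative _ _ Hdg) as [d3g Hd2g].
  set (W := wronsk dh dg d2h d2g).
  assert (HW : hol W (fun z => (d3h z * dg z + d2h z * d2g z) - (d2h z * d2g z + dh z * d3g z))).
  { intro z. apply cdiff_minus; apply cdiff_mult; auto. }
  destruct (classic (exists z, dh z * W z <> 0)) as [Hex|Hno].
  { exists (fun z => dh z * W z). eexists. split; [intro z; apply cdiff_mult; [apply Hdh|apply HW]|].
    split; auto. intros z _ Hk. split; intro E; apply Hk; [|fold W in E]; rewrite E; ring. }
  assert (Hz : forall z, dh z * W z = 0).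
  { intro z. apply NNPP. intro. apply Hno. now exists z. }
  assert (Hfc : ctsC f) by exact (harmonic_cts f h g dh dg Hh Hg Hf).
  destruct (classic (exists z, dg z <> 0)) as [Hgex|Hgno].
  - exists dg, d2g. split; auto. split; auto. intros z Hc Hgz. exfalso.
    assert (Hhz : dh z <> 0).
    { intro E. unfold crit in Hc. rewrite E, Cmod_0 in Hc. symmetry in Hc.
      now apply Cmod_eq_0 in Hc. }
    assert (Hnear : cnear z (fun w => dh w <> 0 /\ dg w <> 0)).
    { apply (filter_and (F := cnear z)).
      - exact (tends_near_neq0 (cnear z) dh _ (hol_cts _ _ Hdh z) Hhz).
      - exact (tends_near_neq0 (cnear z) dg _ (hol_cts _ _ Hdg z) Hgz). }
    destruct Hnear as [r [Hr Hnear]].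
    assert (HWz : forall w, (Cmod (w - z) < r)%R -> W w = 0).
    { intros w Hw. destruct (Hnear w Hw) as [N1 N2].
      replace (W w) with (dh w * W w / dh w) by (field; auto). rewrite Hz. field. auto. }
    set (c := dh z / dg z).
    assert (Hquot : forall w, (Cmod (w - z) < r)%R -> dh w = c * dg w).
    { intros w Hw. destruct (Hnear w Hw) as [N1 N2].
      assert (P := path_mean_value (fun s => dh (z + RtoC s * (w - z)) / dg (z + RtoC s * (w - z)))
         (fun _ => 0) 0).
      cbv beta in P. replace (z + RtoC 1 * (w - z)) with w in P by ring.
      replace (z + RtoC 0 * (w - z)) with z in P by ring.
      assert (E : dh w / dg w - dh z / dg z = 0).
      { apply Cmod_eq_0, Rle_antisym; [|apply Cmod_ge_0].
        apply Rle_trans with (2 * 0)%R; [|lra]. apply P.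
        - intros t Ht. set (v := z + RtoC t * (w - z)).
          assert (Hvb : (Cmod (v - z) < r)%R).
          { unfold v. replace (z + RtoC t * (w - z) - z) with (RtoC t * (w - z)) by ring.
            rewrite Cmod_mult, Cmod_R, Rabs_pos_eq by lra. assert (X := Cmod_ge_0 (w - z)). nra. }
          destruct (Hnear v Hvb) as [V1 V2].
          assert (Z := pdiff_comp (fun s => z + RtoC s * (w - z)) t _ (fun v => dh v / dg v) _
             (pdiff_seg z w t) (cdiff_div dh dg v _ _ V2 (Hdh v) (Hdg v))).
          fold v in Z. change (d2h v * dg v - dh v * d2g v) with (W v) in Z.
          rewrite (HWz v Hvb) in Z.
          replace (0 / (dg v * dg v) * (w - z)) with (RtoC 0) in Z by (field; auto). exact Z.
        - intros. rewrite Cmod_0. lra. }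
      apply eq_of_Cminus in E. unfold c. rewrite <- E. field. auto. }
    assert (Hall : forall w, dh w - c * dg w = 0).
    { apply (identity_theorem (fun w => dh w - c * dg w) (fun w => d2h w - c * d2g w) z).
      - intro w. apply cdiff_minus; [apply Hdh|apply cdiff_scal, Hdg].
      - intros e He. exists (z + RtoC (Rmin e r / 2)). assert (Hm : (0 < Rmin e r)%R) by now apply Rmin_glb_lt.
        assert (Em : Cmod (z + RtoC (Rmin e r / 2) - z) = (Rmin e r / 2)%R).
        { replace (z + RtoC (Rmin e r / 2) - z) with (RtoC (Rmin e r / 2)) by ring.
          rewrite Cmod_R, Rabs_pos_eq; lra. }
        assert (L1 := Rmin_l e r). assert (L2 := Rmin_r e r).
        split; [|split].
        + intro E. rewrite E in Em. replace (z - z) with (RtoC 0) in Em by ring.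
          rewrite Cmod_0 in Em. lra.
        + lra.
        + rewrite Hquot by lra. ring. }
    assert (Hc1 : Cmod c = 1%R).
    { unfold c. rewrite Cmod_div by auto. unfold crit in Hc. rewrite Hc. field.
      apply Cmod_gt_0 in Hgz. lra. }
    assert (Hcc : c * Cconj c = 1) by (rewrite <- Cmod2_conj, Hc1; f_equal; ring).
    apply (not_in_line f c (h 0 - c * g 0) Hfc Hv Hc1). intro w.
    assert (E : h w - c * g w = h 0 - c * g 0).
    { apply (hol_const_of_zero (fun w => h w - c * g w) (fun w => dh w - c * dg w) 0 (Cmod w + 1)).
      - intro v. apply cdiff_minus; [apply Hh|apply cdiff_scal, Hg].
      - intros v _. apply Hall.
      - replace (w - 0) with w by ring. lra. }
    rewrite Hf, <- E. replace (h w + Cconj (g w) - (h w - c * g w)) with (c * g w + Cconj (g w)) by ring.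
    rewrite Cplus_conj, Cmult_conj, Cconj_conj.
    replace (c * (Cconj c * Cconj (g w) + g w)) with ((c * Cconj c) * Cconj (g w) + c * g w) by ring.
    rewrite Hcc. ring.
  - assert (Hg0 : forall z, dg z = 0).
    { intro z. apply NNPP. intro. apply Hgno. now exists z. }
    exists dh, d2h. split; auto. split.
    + apply NNPP. intro Hn.
      assert (Hh0 : forall z, dh z = 0) by (intro z; apply NNPP; intro; apply Hn; now exists z).
      apply (infinite_level_sets f (fun _ => 0%R) Hv).
      * intros phi _. apply continuity_const. intros a b. reflexivity.
      * assert (E : forall k dk, hol k dk -> (forall z, dk z = 0) -> forall z, k z = k 0).
        { intros k dk Hk Hk0 z. apply (hol_const_of_zero k dk 0 (Cmod z + 1)); auto.
          replace (z - 0) with z by ring. lra. }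
        intros z z' _. rewrite !Hf, (E h dh Hh Hh0 z), (E h dh Hh Hh0 z'),
          (E g dg Hg Hg0 z), (E g dg Hg Hg0 z'). reflexivity.
    + intros z Hc Hk. exfalso. apply Hk. unfold crit in Hc. rewrite (Hg0 z), Cmod_0 in Hc.
      now apply Cmod_eq_0.
Qed.

(** The bounded disc contains finitely many zeros, and the injective arc stays on none of their
    images for an interval of parameters. *)
Lemma avoid_zeros f k dk gam r s1 s2 : hol k dk -> (exists z, k z <> 0) ->
  ctsR gam -> (s1 < s2)%R ->
  (forall s t, (s1 <= s <= s2)%R -> (s1 <= t <= s2)%R -> gam s = gam t -> s = t) ->
  (forall t z, (s1 <= t <= s2)%R -> f z = gam t -> (Cmod z <= r)%R) ->
  exists t, (s1 < t < s2)%R /\ forall z, f z = gam t -> k z <> 0.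
Proof.
  intros Hk Hne Hg H12 Hinj Hb.
  destruct (compact_finite (fun z => k z = 0) r (isolated_zeros k dk Hk Hne)) as [l Hl].
  destruct (select_interval l (fun i t => gam t = f i) s1 s2 H12) as (a & b & Hab & Hb2 & H).
  { intros i t _ _ Hn. assert (Hp : (0 < Cmod (gam t - f i))%R) by (apply Cmod_gt_0; now apply Cminus_neq0).
    eapply filter_imp; [|exact (Hg t _ Hp)]. cbv beta. intros s Hs E. rewrite E in Hs.
    rewrite Cmod_sub_sym in Hs. lra. }
  exists ((a + b) / 2)%R. split; [lra|]. intros z E Z.
  assert (Hin : In z l) by (apply Hl; auto; apply (Hb ((a + b) / 2)%R); auto; lra).
  destruct (H z Hin) as [Hon|Hoff].
  - assert (gam a = gam b) by (rewrite (Hon a), (Hon b) by lra; reflexivity).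
    apply Hinj in H0; lra.
  - apply (Hoff ((a + b) / 2)%R); [lra|auto].
Qed.

(** * The fold arc *)

Lemma dQ_cts u dh dg d2h d2g : hol dh d2h -> hol dg d2g -> ctsC (dQ u dh dg).
Proof.
  intros Hh Hg z. unfold dQ. assert (X := hol_cts _ _ Hh z). assert (Y := hol_cts _ _ Hg z).
  tends_auto.
Qed.

Lemma wronsk_cts dh dg d2h d2g : hol dh d2h -> hol dg d2g -> ctsC (wronsk dh dg d2h d2g).
Proof.
  intros Hh Hg z. unfold wronsk. assert (X := hol_cts _ _ Hh z). assert (Y := hol_cts _ _ Hg z).
  destruct (hol_derivative _ _ Hh) as [d3h H3]. destruct (hol_derivative _ _ Hg) as [d3g H3'].
  assert (X' := hol_cts _ _ H3 z). assert (Y' := hol_cts _ _ H3' z).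
  tends_auto.
Qed.

Lemma fold_point_open u dh dg d2h d2g z : hol dh d2h -> hol dg d2g ->
  fold_point u dh dg d2h d2g z -> cnear z (fold_point u dh dg d2h d2g).
Proof.
  intros Hh Hg [H1 H2]. assert (X := dQ_cts u _ _ _ _ Hh Hg z). assert (Y := wronsk_cts _ _ _ _ Hh Hg z).
  apply (filter_and (F := cnear z)); [exact (tends_near_neq0 _ _ _ X H1)|].
  set (F := fun w => wronsk dh dg d2h d2g w / Cpow (dQ u dh dg w) 3).
  assert (T : tends (cnear z) F (F z)).
  { unfold F. assert (Hn : Cpow (dQ u dh dg z) 3 <> 0) by now apply Cpow_nz. tends_auto. exact Hn. }
  assert (Hp : (0 < Rabs (snd (F z)))%R) by now apply Rabs_pos_lt.
  eapply filter_imp; [|exact (T _ Hp)]. cbv beta. intros w Hw E. fold (F w) in E.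
  assert (S := snd_le_Cmod (F w - F z)). change (snd (F w - F z)) with (snd (F w) - snd (F z))%R in S.
  rewrite E in S. replace (0 - snd (F z))%R with (- snd (F z))%R in S by ring.
  rewrite Rabs_Ropp in S. lra.
Qed.

Lemma not_crit_open dh dg d2h d2g z : hol dh d2h -> hol dg d2g ->
  ~ crit dh dg z -> cnear z (fun w => ~ crit dh dg w).
Proof.
  intros Hh Hg H. set (e := Rabs (Cmod (dh z) - Cmod (dg z))).
  assert (He : (0 < e)%R) by (apply Rabs_pos_lt; unfold crit in H; lra).
  assert (He2 : (0 < e / 2)%R) by lra.
  eapply filter_imp; [|apply filter_and; [exact (hol_cts _ _ Hh z _ He2)|exact (hol_cts _ _ Hg z _ He2)]].
  cbv beta. intros w [A B] E. unfold crit in E.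
  assert (A1 := Cmod_rev_triangle (dh w) (dh z)). assert (A2 := Cmod_rev_triangle (dh z) (dh w)).
  assert (B1 := Cmod_rev_triangle (dg w) (dg z)). assert (B2 := Cmod_rev_triangle (dg z) (dg w)).
  rewrite (Cmod_sub_sym (dh z)) in A2. rewrite (Cmod_sub_sym (dg z)) in B2.
  assert (K : (e < e)%R); [|lra]. unfold e at 1. apply Rabs_def1; lra.
Qed.

Lemma filter_prop {I : Type} (l : list I) (P : I -> Prop) :
  NoDup l -> exists l', NoDup l' /\ forall i, In i l' <-> In i l /\ P i.
Proof.
  induction l as [|i l IH]; intro HN.
  - exists nil. split; [constructor|]. intro i. simpl. tauto.
  - inversion HN as [|i' l0 Hni HN' E]; subst. destruct (IH HN') as [l' [N' H]].
    destruct (classic (P i)) as [Hp|Hp].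
    + exists (i :: l'). split.
      * constructor; auto. rewrite H. tauto.
      * intro j. simpl. rewrite H. split; [intros [<-|X]; tauto|intros [[<-|X] Y]; tauto].
    + exists l'. split; auto. intro j. rewrite H. simpl. split; [tauto|].
      intros [[<-|X] Y]; [contradiction|tauto].
Qed.

Lemma near_subinterval (gam : R -> C) (P : C -> Prop) s1 s2 t : ctsR gam -> (s1 < t < s2)%R ->
  cnear (gam t) P ->
  exists a b, (s1 < a < t)%R /\ (t < b < s2)%R /\ forall s, (a <= s <= b)%R -> P (gam s).
Proof.
  intros Hg Ht HP.
  destruct (proj1 (locally_R_iff _ _) (tends_near (locally t) gam (gam t) P (Hg t) HP)) as [d [Hd H]].
  exists (Rmax ((s1 + t) / 2) (t - d / 2)), (Rmin ((t + s2) / 2) (t + d / 2)).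
  unfold Rmax, Rmin. repeat destruct Rle_dec; repeat split; try lra; intros s Hs; apply H, Rabs_def1; lra.
Qed.

(** As W <> 0, the quotient R = P'/Q' is a local coordinate, and the critical set is the curve c(t)
    with R = i t. At the bad points both coordinates of f o c have zero derivative; by Sard neither
    coordinate can vary along an arc of bad values, and an injective arc cannot be a point. *)
Lemma sard_chart f h g dh dg d2h d2g (u z0 : C) : harmonic f h g dh dg d2h d2g -> u <> 0 ->
  crit dh dg z0 -> dQ u dh dg z0 <> 0 -> wronsk dh dg d2h d2g z0 <> 0 ->
  exists r, (0 < r)%R /\
    forall gam s1 s2, ctsR gam -> (s1 < s2)%R ->
      (forall s t, (s1 <= s <= s2)%R -> (s1 <= t <= s2)%R -> gam s = gam t -> s = t) ->
      ~ (forall t, (s1 <= t <= s2)%R -> exists z, (Cmod (z - z0) <= r)%R /\ crit dh dg z /\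
           ~ fold_point u dh dg d2h d2g z /\ f z = gam t).
Proof.
  intros [Hh Hg Hdh Hdg Hf] Hu Hcr HQ0 HW0.
  set (W := wronsk dh dg d2h d2g). set (q1 := dQ u dh dg). set (p1 := dP u dh dg).
  set (Q := fun z => u * h z + Cconj u * g z). set (P := fun z => u * h z - Cconj u * g z).
  assert (HQ : hol Q q1) by (intro z; apply cdiff_plus; apply cdiff_scal; auto).
  assert (HP : hol P p1) by (intro z; apply cdiff_minus; apply cdiff_scal; auto).
  assert (Cq1 : ctsC q1) by exact (dQ_cts u _ _ _ _ Hdh Hdg).
  assert (CW : ctsC W) by exact (wronsk_cts _ _ _ _ Hdh Hdg).
  set (K := RtoC 2 * (u * Cconj u)).
  set (c2 := (2 * Cmod u ^ 2)%R).
  assert (HK : K = RtoC c2) by (unfold K, c2; rewrite RtoC_mult, Cmod2_conj; reflexivity).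
  assert (Hc2 : (0 < c2)%R) by (unfold c2; apply Cmod_gt_0 in Hu; nra).
  assert (HKn : K <> 0) by (rewrite HK; intro E; apply RtoC_inj in E; lra).
  set (Rf := fun z => p1 z / q1 z). set (dR := fun z => K * W z / (q1 z * q1 z)).
  assert (HR : forall z, q1 z <> 0 -> cdiff Rf z (dR z)).
  { intros z Hz. now apply dilatation_diff. }
  assert (Hnear : cnear z0 (fun z => q1 z <> 0 /\ W z <> 0)).
  { apply (filter_and (F := cnear z0)); [exact (tends_near_neq0 _ _ _ (Cq1 z0) HQ0)|
      exact (tends_near_neq0 _ _ _ (CW z0) HW0)]. }
  assert (CdR : forall z, q1 z <> 0 -> tends (cnear z) dR (dR z)).
  { intros z Hz. unfold dR. assert (X := Cq1 z). assert (Y := CW z). tends_auto. now apply Cmult_neq_0. }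
  assert (HdRn : forall z, q1 z <> 0 -> W z <> 0 -> dR z <> 0).
  { intros z H1 H2 E. unfold dR in E. apply H2.
    replace (W z) with (K * W z / (q1 z * q1 z) * (q1 z * q1 z) / K) by (field; auto).
    rewrite E. field. auto. }
  assert (Hnear' := Hnear). destruct Hnear as [r1 [Hr1 Hnear]].
  destruct (local_inverse Rf dR z0 r1) as (r' & rho & q & [Hr' Hr'1] & Hrho & Hq1 & Hq2); auto.
  { eapply filter_imp; [|exact Hnear']. cbv beta. intros z [H1 _]. now apply HR. }
  assert (CR : tends (cnear z0) Rf (Rf z0)) by (eapply cdiff_cts; now apply HR).
  assert (Hr2 : (0 < rho / 2)%R) by lra.
  destruct (CR _ Hr2) as [r2 [Hr2p Hr2b]].
  set (r := (Rmin r' r2 / 2)%R). assert (Hm := Rmin_glb_lt _ _ _ Hr' Hr2p).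
  assert (Rr' : (r < r')%R) by (unfold r; generalize (Rmin_l r' r2); lra).
  assert (Rr2 : (r < r2)%R) by (unfold r; generalize (Rmin_r r' r2); lra).
  exists r. split; [unfold r; lra|].
  set (t0 := snd (Rf z0)).
  assert (HR0 : Rf z0 = (0%R, t0)).
  { apply injective_projections; auto. simpl. now apply (critical_iff u dh dg z0 Hu HQ0). }
  assert (Hvert : forall t, (t0 - rho / 2 <= t <= t0 + rho / 2)%R -> (Cmod ((0%R, t) - Rf z0) < rho)%R).
  { intros t Ht. rewrite HR0. replace ((0%R, t) - (0%R, t0)) with (Ci * RtoC (t - t0))
      by (apply injective_projections; simpl; ring).
    rewrite Cmod_mult, Cmod_Ci, Cmod_R, Rmult_1_l. apply Rabs_def1; lra. }
  set (c := fun t => q (0%R, t)).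
  set (I0 := fun t => (t0 - rho / 2 <= t <= t0 + rho / 2)%R).
  assert (Hcg : forall t, I0 t -> q1 (c t) <> 0 /\ W (c t) <> 0 /\ Rf (c t) = (0%R, t)).
  { intros t Ht. destruct (Hq2 _ (Hvert t Ht)) as (A1 & A2 & _).
    destruct (Hnear (c t)) as [B1 B2]; [unfold c; lra|]. auto. }
  assert (Hcd : forall t, I0 t -> pdiff c t (/ dR (c t) * Ci)).
  { intros t Ht. destruct (Hq2 _ (Hvert t Ht)) as (_ & _ & A3).
    apply (pdiff_comp (fun s => (0%R, s))); [apply pdiff_vert|exact A3]. }
  (* The velocity of Q along the critical curve. Since P' = i t Q' there, the coordinates of u f
     move with velocities Re E and t Re E. *)
  set (E := fun t => q1 (c t) * (/ dR (c t) * Ci)).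
  assert (HE : forall t, I0 t -> tends (locally t) E (E t)).
  { intros t Ht. destruct (Hcg t Ht) as (A1 & A2 & _).
    assert (Ct := pdiff_cts _ _ _ (Hcd t Ht)).
    assert (T1 := tends_comp (locally t) q1 c (c t) _ Ct (Cq1 (c t))).
    assert (T2 := tends_comp (locally t) dR c (c t) _ Ct (CdR (c t) A1)).
    unfold E. tends_auto. now apply HdRn. }
  assert (HdX : forall t, I0 t -> is_derive (fun s => cx u (f (c s))) t (fst (E t))).
  { intros t Ht. assert (Z := pdiff_fst _ _ _ (pdiff_comp c t _ Q _ (Hcd t Ht) (HQ (c t)))).
    eapply is_derive_ext; [|exact Z]. intro s. unfold cx, Q. simpl. rewrite Hf. simpl. ring. }
  assert (HdY : forall t, I0 t -> is_derive (fun s => cy u (f (c s))) t (t * fst (E t))%R).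
  { intros t Ht. assert (Z := pdiff_snd _ _ _ (pdiff_comp c t _ P _ (Hcd t Ht) (HP (c t)))).
    destruct (Hcg t Ht) as (A1 & A2 & A3).
    replace (p1 (c t) * (/ dR (c t) * Ci)) with ((0%R, t) * E t) in Z.
    - replace (snd ((0%R, t) * E t)) with (t * fst (E t))%R in Z by (simpl; ring).
      eapply is_derive_ext; [|exact Z]. intro s. unfold cy, P. simpl. rewrite Hf. simpl. ring.
    - rewrite <- A3. unfold E, Rf. field. split; auto. }
  assert (Hbad : forall z, (Cmod (z - z0) <= r)%R -> crit dh dg z -> ~ fold_point u dh dg d2h d2g z ->
     exists t, I0 t /\ c t = z /\ fst (E t) = 0%R).
  { intros z Hz Hcz Hnf. destruct (Hnear z) as [N1 N2]; [lra|].
    assert (B := Hr2b z ltac:(lra)).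
    assert (Rz : Rf z = (0%R, snd (Rf z))).
    { apply injective_projections; auto. simpl. now apply (critical_iff u dh dg z Hu N1). }
    assert (Cz : c (snd (Rf z)) = z) by (unfold c; rewrite <- Rz; apply Hq1; lra).
    exists (snd (Rf z)). split; [|split; auto].
    - unfold I0. assert (S := snd_le_Cmod (Rf z - Rf z0)).
      change (snd (Rf z - Rf z0)) with (snd (Rf z) - t0)%R in S.
      assert (S' : (Rabs (snd (Rf z) - t0) < rho / 2)%R) by lra. apply Rabs_lt_between in S'. lra.
    - unfold E. rewrite Cz.
      set (kap := W z / Cpow (q1 z) 3).
      assert (Hk0 : snd kap = 0%R).
      { apply NNPP. intro Hn. apply Hnf. split; auto. }
      assert (Hkn : kap <> 0).
      { intro Z. apply N2. replace (W z) with (kap * Cpow (q1 z) 3) by (unfold kap; simpl; field; auto).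
        rewrite Z. ring. }
      assert (Hkr : kap = RtoC (fst kap)) by (now apply injective_projections).
      (* Hence E = i / (K kap) with K > 0, and a real kap makes E purely imaginary. *)
      assert (EE : q1 z * (/ dR z * Ci) = Ci * / (K * kap)).
      { unfold dR, kap. simpl. field. repeat split; auto. }
      rewrite EE, HK, Hkr, <- RtoC_mult. simpl. unfold Rdiv. ring. }
  intros gam s1 s2 Hgc H12 Hinj Hall.
  (* If a coordinate took two values on the arc it would take all values between them, each one a
     critical value of that coordinate along the critical curve. *)
  assert (Hconst : forall (ro : C -> R) (dk : R -> R),
     continuity (fun t => ro (gam t)) ->
     (forall t, I0 t -> is_derive (fun s => ro (f (c s))) t (dk t)) ->
     (forall t, I0 t -> continuity_pt dk t) ->
     (forall t, I0 t -> fst (E t) = 0%R -> dk t = 0%R) ->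
     forall s s', (s1 <= s <= s2)%R -> (s1 <= s' <= s2)%R -> (ro (gam s) < ro (gam s'))%R -> False).
  { intros ro dk C1 D1 C2 Z1 s s' Hs Hs' L.
    destruct (sard_1d (fun t => ro (f (c t))) dk (t0 - rho / 2) (t0 + rho / 2) _ _ ltac:(lra) L D1 C2)
      as (y & Hy & Hreg).
    destruct (IVT_gen (fun t => ro (gam t)) s s' y C1) as [x [Hx Ex]].
    { rewrite Rmin_left, Rmax_right; lra. }
    assert (Hx' : (s1 <= x <= s2)%R).
    { revert Hx. unfold Rmin, Rmax. destruct Rle_dec; lra. }
    destruct (Hall x Hx') as (z & B1 & B2 & B3 & B4).
    destruct (Hbad z B1 B2 B3) as (t & T1 & T2 & T3).
    apply (Hreg t T1); [|now apply Z1]. rewrite T2, B4. exact Ex. }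
  assert (HfE : forall t, I0 t -> continuity_pt (fun s => fst (E s)) t).
  { intros t Ht. apply continuity_pt_filterlim, tends_fst, HE, Ht. }
  assert (Hx : cx u (gam s1) = cx u (gam s2)).
  { destruct (Rtotal_order (cx u (gam s1)) (cx u (gam s2))) as [L|[L|L]]; auto; exfalso.
    - apply (Hconst (cx u) (fun t => fst (E t))) with (s := s1) (s' := s2); auto; try lra.
      intro t. now apply cx_cts.
    - apply (Hconst (cx u) (fun t => fst (E t))) with (s := s2) (s' := s1); auto; try lra.
      intro t. now apply cx_cts. }
  assert (HyE : forall t, I0 t -> continuity_pt (fun s => s * fst (E s))%R t).
  { intros t Ht. apply continuity_pt_mult; [apply derivable_continuous_pt, derivable_pt_id|auto]. }
  assert (Hy : cy u (gam s1) = cy u (gam s2)).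
  { destruct (Rtotal_order (cy u (gam s1)) (cy u (gam s2))) as [L|[L|L]]; auto; exfalso.
    - apply (Hconst (cy u) (fun t => t * fst (E t))%R) with (s := s1) (s' := s2); auto; try lra.
      + intro t. now apply cy_cts.
      + intros t _ ->. ring.
    - apply (Hconst (cy u) (fun t => t * fst (E t))%R) with (s := s2) (s' := s1); auto; try lra.
      + intro t. now apply cy_cts.
      + intros t _ ->. ring. }
  assert (X := Hinj s1 s2 ltac:(lra) ltac:(lra) (cxy_inj u _ _ Hu Hx Hy)). lra.
Qed.

(* Along u = 1 + i s, [dQ u] is affine in s and vanishes for at most one value of s. *)
Lemma choose_direction (dh dg : C -> C) (l : list C) : (forall z, In z l -> dh z <> 0) ->
  exists u : C, u <> 0 /\ forall z, In z l -> dQ u dh dg z <> 0.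
Proof.
  intro H.
  assert (K : exists s0, (0 < s0)%R /\ forall z, In z l -> forall s, (s0 < s)%R -> dQ (1%R, s) dh dg z <> 0).
  { induction l as [|z l IH].
    - exists 1%R. split; [lra|]. intros z [].
    - destruct IH as [s0 [Hs0 IH]]; [intros; apply H; now right|].
      destruct (classic (exists s1, dQ (1%R, s1) dh dg z = 0)) as [[s1 E1]|Hn].
      + exists (Rmax s0 s1). split; [eapply Rlt_le_trans; [exact Hs0|apply Rmax_l]|].
        intros v [<-|Hv] s Hs.
        * intro E. apply (H z (or_introl eq_refl)).
          (* Two zeros in s would give h' = g'. As Re u = 1, then dQ = 2 h', and h' = 0 follows,
             against the hypothesis on the list. *)
          assert (L := Rle_lt_trans _ _ _ (Rmax_r s0 s1) Hs).
          assert (Hd : RtoC (s - s1) <> 0) by (intro Z; apply RtoC_inj in Z; lra).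
          assert (B : RtoC (s - s1) * (dh z - dg z) = 0).
          { replace (RtoC (s - s1) * (dh z - dg z))
              with (- Ci * (dQ (1%R, s) dh dg z - dQ (1%R, s1) dh dg z)).
            - rewrite E, E1. ring.
            - unfold dQ. apply injective_projections; simpl; ring. }
          assert (B' : dh z - dg z = 0).
          { replace (dh z - dg z) with (RtoC (s - s1) * (dh z - dg z) / RtoC (s - s1)) by (field; auto).
            rewrite B. field. auto. }
          apply eq_of_Cminus in B'. unfold dQ in E. rewrite <- B' in E.
          assert (Q : forall v : C, (1%R, s) * v + Cconj (1%R, s) * v = RtoC 2 * v)
            by (intro v; apply injective_projections; simpl; ring).
          rewrite Q in E. replace (dh z) with (RtoC (/ 2) * (RtoC 2 * dh z))
            by (apply injective_projections; simpl; field).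
          rewrite E. ring.
        * apply IH; auto. eapply Rle_lt_trans; [apply Rmax_l|exact Hs].
      + exists s0. split; auto. intros v [<-|Hv] s Hs.
        * intro E. apply Hn. now exists s.
        * now apply IH. }
  destruct K as [s0 [Hs0 K]]. exists (1%R, (s0 + 1)%R). split.
  - intro E. apply (f_equal fst) in E. simpl in E. lra.
  - intros z Hz. apply K; auto. lra.
Qed.

(** The order of choices matters: the notion of fold point depends on [u], and [u] can only be
    adapted to a finite list of critical points with h' <> 0. So a parameter [t1] with good critical
    preimages fixes [u], and the parameter is then moved, within the range where critical preimages
    stay in the Sard discs. *)
Lemma generic_fold_parameter f h g dh dg d2h d2g gam r s1 s2 :
  harmonic f h g dh dg d2h d2g -> finite_valence f -> ctsR gam -> (s1 < s2)%R ->
  (forall s t, (s1 <= s <= s2)%R -> (s1 <= t <= s2)%R -> gam s = gam t -> s = t) ->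
  (forall t, (s1 <= t <= s2)%R -> ~ cluster_inf f (gam t)) ->
  (forall t z, (s1 <= t <= s2)%R -> f z = gam t -> (Cmod z <= r)%R) ->
  exists (u : C) t, u <> 0 /\ (s1 < t < s2)%R /\
    forall z, f z = gam t -> crit dh dg z -> fold_point u dh dg d2h d2g z.
Proof.
  intros HH Hv Hgc H12 Hinj Hncl Hbd.
  assert (HH' := HH). destruct HH' as [Hh Hg Hdh Hdg Hf].
  assert (Hfc : ctsC f) by exact (harmonic_cts f h g dh dg Hh Hg Hf).
  destruct (generic_function f h g dh dg d2h d2g HH Hv) as (k & dk & Hk & Hkne & Hkg).
  destruct (avoid_zeros f k dk gam r s1 s2 Hk Hkne Hgc H12 Hinj Hbd) as (t1 & Ht1 & Hkt).
  destruct (complete_preimage f (gam t1) Hv) as (l & HN & Hl).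
  destruct (filter_prop l (crit dh dg) HN) as (lc & HNc & Hlc).
  assert (Hlg : forall z, In z lc -> crit dh dg z /\ dh z <> 0 /\ wronsk dh dg d2h d2g z <> 0).
  { intros z Hz. apply Hlc in Hz. destruct Hz as [Z1 Z2]. apply Hl in Z1.
    split; auto. }
  destruct (choose_direction dh dg lc) as (u & Hu & HuQ); [intros z Hz; now apply Hlg|].
  destruct (list_choice 0%R lc (fun z r => (0 < r)%R /\
    forall gam s1 s2, ctsR gam -> (s1 < s2)%R ->
      (forall s t, (s1 <= s <= s2)%R -> (s1 <= t <= s2)%R -> gam s = gam t -> s = t) ->
      ~ (forall t, (s1 <= t <= s2)%R -> exists v, (Cmod (v - z) <= r)%R /\ crit dh dg v /\
           ~ fold_point u dh dg d2h d2g v /\ f v = gam t))) as [rr Hrr].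
  { intros z Hz. destruct (Hlg z Hz) as (A1 & A2 & A3).
    apply (sard_chart f h g dh dg d2h d2g u z); auto. }
  assert (Hnear : cnear (gam t1) (fun w => ~ cluster_inf f w /\ forall z, f z = w ->
     ~ (crit dh dg z /\ ~ exists i, In i lc /\ (Cmod (z - i) < rr i)%R))).
  { apply preimages_away; auto; [apply Hncl; lra|].
    intros z E. destruct (classic (crit dh dg z)) as [Hc|Hc].
    - assert (Hz : In z lc) by (apply Hlc; split; auto; now apply Hl).
      exists (rr z). split; [now apply Hrr|]. intros v Hv' [_ Hn]. apply Hn. now exists z.
    - eapply filter_imp; [|exact (not_crit_open _ _ _ _ z Hdh Hdg Hc)]. cbv beta. tauto. }
  destruct (near_subinterval gam _ s1 s2 t1 Hgc Ht1 Hnear) as (a0 & b0 & Ha0 & Hb0 & Hab0).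
  (* Being the value of a critical point of the closed disc that is not a fold point is a closed
     condition on t, since fold points and noncritical points form open sets. Sard forbids it to
     hold on an interval. *)
  destruct (select_interval lc (fun i t => exists v, (Cmod (v - i) <= rr i)%R /\ crit dh dg v /\
           ~ fold_point u dh dg d2h d2g v /\ f v = gam t) a0 b0 ltac:(lra)) as (a & b & Hab & Hb & Hsel).
  { intros i t Hi Ht Hn.
    destruct (compact_away f (gam t) (fun v => (Cmod (v - i) <= rr i)%R /\ crit dh dg v /\
           ~ fold_point u dh dg d2h d2g v) (Cmod i + rr i) Hfc) as (del & Hdel & Ha).
    { intros z E. destruct (classic ((Cmod (z - i) <= rr i)%R)) as [Z1|Z1].
      - destruct (classic (crit dh dg z)) as [Z2|Z2].
        + destruct (classic (fold_point u dh dg d2h d2g z)) as [Z3|Z3].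
          * eapply filter_imp; [|exact (fold_point_open u _ _ _ _ z Hdh Hdg Z3)]. cbv beta. tauto.
          * exfalso. apply Hn. exists z. auto.
        + eapply filter_imp; [|exact (not_crit_open _ _ _ _ z Hdh Hdg Z2)]. cbv beta. tauto.
      - exists (Cmod (z - i) - rr i)%R. split; [lra|]. intros v Hv' [V1 _].
        assert (T := Cmod_sub_triangle z v i). rewrite (Cmod_sub_sym z v) in T. lra. }
    eapply filter_imp; [|exact (Hgc t del Hdel)]. cbv beta. intros s Hs (v & V1 & V2 & V3 & V4).
    assert (X := Ha v). rewrite V4 in X. specialize (X ltac:(
      generalize (Cmod_triangle (v - i) i); replace (v - i + i) with v by ring; lra) (conj V1 (conj V2 V3))).
    lra. }
  exists u, ((a + b) / 2)%R. split; auto. split; [lra|]. intros z E Hc.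
  apply NNPP. intro Hnf.
  destruct (Hab0 ((a + b) / 2)%R ltac:(lra)) as [_ Hpre].
  assert (Hi : exists i, In i lc /\ (Cmod (z - i) < rr i)%R).
  { apply NNPP. intro Hn. exact (Hpre z E (conj Hc Hn)). }
  destruct Hi as (i & Hi & Hzi).
  destruct (Hsel i Hi) as [Hon|Hoff].
  - apply (proj2 (Hrr i Hi) gam a b Hgc ltac:(lra)); auto.
    intros s t Hs Ht. apply Hinj; lra.
  - apply (Hoff ((a + b) / 2)%R ltac:(lra)). exists z. split; [lra|auto].
Qed.

Lemma cx_near u w0 e : (0 < e)%R -> cnear w0 (fun w => (Rabs (cx u w - cx u w0) < e)%R).
Proof.
  intro He. assert (T : tends (cnear w0) (fun w => u * w) (u * w0)).
  { assert (X := tends_id w0). tends_auto. }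
  eapply filter_imp; [|exact (T e He)]. cbv beta. intros w Hw.
  eapply Rle_lt_trans; [|exact Hw]. apply (fst_le_Cmod (u * w - u * w0)).
Qed.

Lemma cy_near u w0 e : (0 < e)%R -> cnear w0 (fun w => (Rabs (cy u w - cy u w0) < e)%R).
Proof.
  intro He. assert (T : tends (cnear w0) (fun w => u * w) (u * w0)).
  { assert (X := tends_id w0). tends_auto. }
  eapply filter_imp; [|exact (T e He)]. cbv beta. intros w Hw.
  eapply Rle_lt_trans; [|exact Hw]. apply (snd_le_Cmod (u * w - u * w0)).
Qed.

Lemma off_graph_open u (M : R -> R) w0 : continuity_pt M (cx u w0) -> cy u w0 <> M (cx u w0) ->
  cnear w0 (fun w => cy u w <> M (cx u w)).
Proof.
  intros HM Hn. set (e := Rabs (cy u w0 - M (cx u w0))).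
  assert (He : (0 < e)%R) by (apply Rabs_pos_lt; lra).
  destruct (continuity_pt_eps M _ HM (e / 2)%R ltac:(lra)) as [d [Hd K]].
  assert (He2 : (0 < e / 2)%R) by lra.
  eapply filter_imp; [|apply filter_and; [exact (cx_near u w0 d Hd)|exact (cy_near u w0 _ He2)]].
  cbv beta. intros w [W1 W2] E. specialize (K _ W1). rewrite E in W2.
  assert (X : (e < e)%R); [|lra]. unfold e at 1.
  replace (cy u w0 - M (cx u w0))%R with (- (M (cx u w) - cy u w0) + (M (cx u w) - M (cx u w0)))%R by ring.
  eapply Rle_lt_trans; [apply Rabs_triang|]. rewrite Rabs_Ropp. lra.
Qed.

(** Nearby critical values lie on the graphs of the charts over [gam t0]. After shrinking, some
    graph contains the arc, and injectivity makes the arc cover an interval of abscissae. Over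
    interior points the graphs containing the arc coincide and the others stay away; this gives the
    last clause, that near the arc there are no further critical values. *)
Lemma fold_arc f h g dh dg d2h d2g gam (u : C) s1 s2 t0 :
  harmonic f h g dh dg d2h d2g -> finite_valence f -> ctsR gam -> (s1 < t0 < s2)%R ->
  (forall s t, (s1 <= s <= s2)%R -> (s1 <= t <= s2)%R -> gam s = gam t -> s = t) -> u <> 0 ->
  ~ cluster_inf f (gam t0) ->
  (forall z, f z = gam t0 -> crit dh dg z -> fold_point u dh dg d2h d2g z) ->
  (forall t, (s1 <= t <= s2)%R -> exists z, f z = gam t /\ crit dh dg z) ->
  exists c d (M : R -> R), (c < d)%R /\
    (forall x, (c <= x <= d)%R -> continuity_pt M x) /\
    (forall w, (c <= cx u w <= d)%R -> cy u w = M (cx u w) ->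
       (exists t, (s1 <= t <= s2)%R /\ w = gam t) /\ ~ cluster_inf f w /\
       forall z, f z = w -> crit dh dg z -> fold_point u dh dg d2h d2g z) /\
    (forall w0, (c < cx u w0 < d)%R -> cy u w0 = M (cx u w0) ->
       cnear w0 (fun w => forall z, f z = w -> crit dh dg z ->
          (c <= cx u w <= d)%R /\ cy u w = M (cx u w))).
Proof.
  intros HH Hv Hgc Ht0 Hinj Hu Hncl Hfold Hcrit.
  assert (HH' := HH). destruct HH' as [Hh Hg Hdh Hdg Hf].
  assert (Hfc : ctsC f) by exact (harmonic_cts f h g dh dg Hh Hg Hf).
  destruct (hol_derivative _ _ Hdh) as [d3h H3h]. destruct (hol_derivative _ _ Hdg) as [d3g H3g].
  destruct (complete_preimage f (gam t0) Hv) as (l & HN & Hl).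
  destruct (filter_prop l (crit dh dg) HN) as (lc & HNc & Hlc).
  set (w2 := gam t0) in *. set (x2 := cx u w2).
  destruct (list_choice ((fun _ : C => True), (0%R, (0%R, fun _ : R => 0%R))) lc
    (fun z (x : (C -> Prop) * (R * (R * (R -> R)))) => exists sg dM,
       fold_chart f dh dg d2h d2g u z 1 (fst x) (fst (snd x)) (fst (snd (snd x))) sg (snd (snd (snd x))) dM))
    as [ch Hch].
  { intros z Hz. apply Hlc in Hz. destruct Hz as [Z1 Z2]. apply Hl in Z1.
    destruct (fold_chart_exists f h g dh dg d2h d2g u z 1 Hh Hg Hdh Hdg
      (hol_cts _ _ H3h) (hol_cts _ _ H3g) Hf Hu ltac:(lra) Z2 (Hfold z Z1 Z2))
      as (U & r & eps & sg & M & dM & HC).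
    exists (U, (r, (eps, M))), sg, dM. exact HC. }
  set (Uf := fun i => fst (ch i)). set (ef := fun i => fst (snd (snd (ch i)))).
  set (Mf := fun i => snd (snd (snd (ch i)))).
  assert (HfE : forall z, In z lc -> f z = w2) by (intros z Hz; apply Hl; now apply Hlc in Hz).
  destruct (list_eps lc (fun i e => (e <= ef i)%R)) as [e0 [He0 Hef]].
  { intros i Hi. destruct (Hch i Hi) as (sg & dM & HC). exists (ef i). split; [apply HC|]. intros; lra. }
  assert (HMc : forall i x, In i lc -> (Rabs (x - x2) < e0)%R -> continuity_pt (Mf i) x).
  { intros i x Hi Hx. destruct (Hch i Hi) as (sg & dM & HC).
    eapply is_derive_continuity_pt. apply (fc_der _ _ _ _ _ _ _ _ _ _ _ _ _ _ HC).
    rewrite (HfE i Hi). specialize (Hef i Hi). unfold ef in Hef. fold x2. lra. }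
  assert (Hpre : cnear w2 (fun w => ~ cluster_inf f w /\ forall z, f z = w ->
     ~ (crit dh dg z /\ ~ exists i, In i lc /\ Uf i z))).
  { apply preimages_away; auto. intros z E. destruct (classic (crit dh dg z)) as [Hc|Hc].
    - assert (Hz : In z lc) by (apply Hlc; split; auto; now apply Hl).
      destruct (Hch z Hz) as (sg & dM & HC).
      exists (fst (snd (ch z))). split; [apply HC|]. intros v Hv' [_ Hn]. apply Hn. exists z.
      split; auto. now apply HC.
    - eapply filter_imp; [|exact (not_crit_open _ _ _ _ z Hdh Hdg Hc)]. cbv beta. tauto. }
  assert (Hgood : cnear w2 (fun w => (Rabs (cx u w - x2) < e0)%R /\ ~ cluster_inf f w /\
     forall z, f z = w -> crit dh dg z -> fold_point u dh dg d2h d2g z /\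
        exists i, In i lc /\ cy u w = Mf i (cx u w))).
  { eapply filter_imp; [|apply filter_and; [exact (cx_near u w2 e0 He0)|exact Hpre]]. cbv beta.
    intros w (W1 & W2 & W3). split; [exact W1|]. split; [auto|]. intros z E Hc.
    assert (Hi : exists i, In i lc /\ Uf i z).
    { apply NNPP. intro Hn. exact (W3 z E (conj Hc Hn)). }
    destruct Hi as (i & Hi & Ui). destruct (Hch i Hi) as (sg & dM & HC). split.
    - apply (fc_fold _ _ _ _ _ _ _ _ _ _ _ _ _ _ HC). exact Ui.
    - exists i. split; auto. rewrite <- E. now apply (fc_crit _ _ _ _ _ _ _ _ _ _ _ _ _ _ HC). }
  apply cnear_cnear in Hgood.
  destruct (near_subinterval gam _ s1 s2 t0 Hgc Ht0 Hgood) as (a0 & b0 & Ha0 & Hb0 & Hab0).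
  destruct (select_interval lc (fun i t => cy u (gam t) = Mf i (cx u (gam t))) a0 b0 ltac:(lra))
    as (a & b & Hab & Hb & Hsel).
  { intros i t Hi Ht Hn. apply (tends_near (locally t) gam (gam t)
      (fun w => cy u w <> Mf i (cx u w)) (Hgc t)).
    apply off_graph_open; auto. apply HMc; auto.
    apply (cnear_self _ _ (Hab0 t Ht)). }
  (* The point [gam a] is a critical value, so it lies on some graph; that graph does not miss the
     arc, hence contains it. *)
  assert (Hi0 : exists i0, In i0 lc /\ forall t, (a <= t <= b)%R -> cy u (gam t) = Mf i0 (cx u (gam t))).
  { destruct (Hcrit a ltac:(lra)) as (z & E & Hc).
    destruct (cnear_self _ _ (Hab0 a ltac:(lra))) as (_ & _ & X). destruct (X z E Hc) as (_ & i & Hi & Ei).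
    exists i. split; auto. destruct (Hsel i Hi) as [Hon|Hoff]; auto.
    exfalso. apply (Hoff a ltac:(lra)). exact Ei. }
  destruct Hi0 as (i0 & Hi0 & Hon0).
  set (xa := cx u (gam a)). set (xb := cx u (gam b)).
  assert (Hxab : xa <> xb).
  { intro E. assert (gam a = gam b).
    { apply (cxy_inj u); auto. rewrite !Hon0 by lra. fold xa xb. now rewrite E. }
    apply Hinj in H; lra. }
  assert (Hxi : forall x, (Rmin xa xb <= x <= Rmax xa xb)%R -> exists t, (a <= t <= b)%R /\ cx u (gam t) = x).
  { intros x Hx. destruct (IVT_gen (fun t => cx u (gam t)) a b x) as [t [T1 T2]]; auto.
    - intro t. now apply cx_cts.
    - rewrite Rmin_left, Rmax_right in T1 by lra. now exists t. }
  assert (Hw : forall w, (Rmin xa xb <= cx u w <= Rmax xa xb)%R -> cy u w = Mf i0 (cx u w) ->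
     exists t, (a <= t <= b)%R /\ w = gam t).
  { intros w Hx Hy. destruct (Hxi _ Hx) as (t & T1 & T2). exists t. split; auto.
    apply (cxy_inj u); auto. rewrite Hy, (Hon0 t T1), T2. reflexivity. }
  exists (Rmin xa xb), (Rmax xa xb), (Mf i0). split; [|split; [|split]].
  - unfold Rmin, Rmax. destruct Rle_dec; lra.
  - intros x Hx. destruct (Hxi x Hx) as (t & T1 & T2). apply HMc; auto. rewrite <- T2.
    apply (cnear_self _ _ (Hab0 t ltac:(lra))).
  - intros w Hx Hy. destruct (Hw w Hx Hy) as (t & T1 & T2). split; [exists t; split; [lra|auto]|].
    destruct (cnear_self _ _ (Hab0 t ltac:(lra))) as (_ & X1 & X2). rewrite T2. split; auto.
    intros z E Hc. now apply (X2 z E Hc).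
  - intros w0 Hx Hy. destruct (Hw w0 ltac:(lra) Hy) as (t & T1 & T2).
    assert (Hng := Hab0 t ltac:(lra)). rewrite <- T2 in Hng.
    assert (Hlist : cnear w0 (fun w => forall i, In i lc -> cy u w = Mf i (cx u w) ->
       (Rmin xa xb <= cx u w <= Rmax xa xb)%R /\ cy u w = Mf i0 (cx u w))).
    { apply cnear_list. intros i Hi. destruct (Hsel i Hi) as [Hon|Hoff].
      - set (e := Rmin (cx u w0 - Rmin xa xb) (Rmax xa xb - cx u w0)).
        assert (He : (0 < e)%R) by (apply Rmin_glb_lt; lra).
        eapply filter_imp; [|exact (cx_near u w0 e He)]. cbv beta. intros w W1 W2.
        apply Rabs_lt_between in W1.
        assert (E1 := Rmin_l (cx u w0 - Rmin xa xb) (Rmax xa xb - cx u w0)).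
        assert (E2 := Rmin_r (cx u w0 - Rmin xa xb) (Rmax xa xb - cx u w0)). fold e in E1, E2.
        assert (Hx' : (Rmin xa xb <= cx u w <= Rmax xa xb)%R) by lra.
        split; auto. destruct (Hxi _ Hx') as (t' & T1' & T2').
        rewrite W2, <- T2', <- (Hon t' T1'). now apply Hon0.
      - eapply filter_imp; [|apply (off_graph_open u (Mf i) w0)].
        + cbv beta. intros w W1 W2. contradiction.
        + apply HMc; auto. apply (cnear_self _ _ Hng).
        + rewrite T2. now apply Hoff. }
    eapply filter_imp; [|apply filter_and; [exact Hng|exact Hlist]]. cbv beta.
    intros w [(_ & _ & W1) W2] z E Hc. destruct (W1 z E Hc) as (_ & i & Hi & Ei). now apply (W2 i).
Qed.

(** * Fold points lie outside F and N *)

Lemma cis_plus a b : cis (a + b) = cis a * cis b.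
Proof. unfold cis. apply injective_projections; simpl; rewrite ?cos_plus, ?sin_plus; ring. Qed.

Lemma cis_0 : cis 0 = 1.
Proof. unfold cis. now rewrite cos_0, sin_0. Qed.

Lemma cis_neq0 a : cis a <> 0.
Proof.
  intro E. assert (X : cis a * cis (- a) = 1) by (rewrite <- cis_plus, Rplus_opp_r; apply cis_0).
  rewrite E in X. apply (f_equal fst) in X. simpl in X. lra.
Qed.

Lemma cis_cts phi t : continuity_pt phi t -> tends (locally t) (fun s => cis (phi s)) (cis (phi t)).
Proof.
  intro H. apply (tends_pair (fun s => cos (phi s)) (fun s => sin (phi s)));
    apply continuity_pt_filterlim.
  - apply (continuity_pt_comp phi cos); auto. apply continuity_cos.
  - apply (continuity_pt_comp phi sin); auto. apply continuity_sin.
Qed.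

Lemma derive_right_nonneg k t l d : is_derive k t l -> (0 < d)%R ->
  (forall s, (t < s < t + d)%R -> (k t <= k s)%R) -> (0 <= l)%R.
Proof.
  intros H Hd Hk. apply Rnot_lt_le. intro L.
  destruct (proj1 (locally_R_iff _ _) (proj1 (is_derive_eps k t l) H (- l / 2)%R ltac:(lra))) as [e [He K]].
  set (s := (t + Rmin d e / 2)%R). assert (Hm : (0 < Rmin d e)%R) by now apply Rmin_glb_lt.
  assert (M1 := Rmin_l d e). assert (M2 := Rmin_r d e).
  assert (X := K s). assert (Es : (s - t = Rmin d e / 2)%R) by (unfold s; ring).
  rewrite Es in X. rewrite (Rabs_pos_eq (Rmin d e / 2)) in X by lra. specialize (X ltac:(lra)).
  assert (Y := Hk s ltac:(unfold s; lra)). apply Rabs_le_between in X. nra.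
Qed.

Lemma derive_left_nonpos k t l d : is_derive k t l -> (0 < d)%R ->
  (forall s, (t - d < s < t)%R -> (k t <= k s)%R) -> (l <= 0)%R.
Proof.
  intros H Hd Hk. apply Rnot_lt_le. intro L.
  destruct (proj1 (locally_R_iff _ _) (proj1 (is_derive_eps k t l) H (l / 2)%R ltac:(lra))) as [e [He K]].
  set (s := (t - Rmin d e / 2)%R). assert (Hm : (0 < Rmin d e)%R) by now apply Rmin_glb_lt.
  assert (M1 := Rmin_l d e). assert (M2 := Rmin_r d e).
  assert (X := K s). assert (Es : (s - t = - (Rmin d e / 2))%R) by (unfold s; ring).
  rewrite Es in X. rewrite Rabs_Ropp, (Rabs_pos_eq (Rmin d e / 2)) in X by lra. specialize (X ltac:(lra)).
  assert (Y := Hk s ltac:(unfold s; lra)). apply Rabs_le_between in X. nra.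
Qed.

(** The argument [phi] is merely continuous and cannot be differentiated. Instead, Re chi is maximal
    at t, so the velocity is imaginary; and Im chi = sin(phi s - phi t) is nonnegative just after t,
    so it points upwards. *)
Lemma unimodular_velocity (chi : R -> C) phi t (e : C) d : (0 < d)%R ->
  (forall s, (Rabs (s - t) < d)%R -> chi s = cis (phi s - phi t)) ->
  continuity_pt phi t ->
  (forall s s', (Rabs (s - t) < d)%R -> (Rabs (s' - t) < d)%R -> (s < s')%R -> (phi s < phi s')%R) ->
  pdiff chi t e -> exists r, (0 <= r)%R /\ e = Ci * RtoC r.
Proof.
  intros Hd Hchi Hc Hinc He.
  assert (Hd0 : (Rabs (t - t) < d)%R) by (rewrite Rminus_diag, Rabs_R0; lra).
  assert (D1 := pdiff_fst _ _ _ He). assert (D2 := pdiff_snd _ _ _ He).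
  assert (C0 : chi t = 1) by (rewrite Hchi, Rminus_diag by auto; apply cis_0).
  assert (Hmax : forall s, (Rabs (s - t) < d)%R -> (- fst (chi t) <= - fst (chi s))%R).
  { intros s Hs. rewrite C0, (Hchi s Hs). simpl. generalize (COS_bound (phi s - phi t)). lra. }
  assert (D1' : is_derive (fun s => - fst (chi s))%R t (- fst e)%R).
  { apply (is_derive_opp (fun s => fst (chi s))). exact D1. }
  assert (F1 : (0 <= - fst e)%R).
  { apply (derive_right_nonneg _ t _ d D1' Hd). intros s Hs. apply Hmax. apply Rabs_def1; lra. }
  assert (F2 : (- fst e <= 0)%R).
  { apply (derive_left_nonpos _ t _ d D1' Hd). intros s Hs. apply Hmax. apply Rabs_def1; lra. }
  assert (HPI := PI_RGT_0).
  destruct (continuity_pt_eps phi t Hc PI HPI) as [d2 [Hd2 K]].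
  assert (G1 : (0 <= snd e)%R).
  { apply (derive_right_nonneg _ t _ (Rmin d d2) D2); [now apply Rmin_glb_lt|].
    intros s Hs. assert (M1 := Rmin_l d d2). assert (M2 := Rmin_r d d2).
    assert (Hsd : (Rabs (s - t) < d)%R) by (apply Rabs_def1; lra).
    rewrite C0, (Hchi s Hsd). simpl.
    assert (X := Hinc t s Hd0 Hsd ltac:(lra)).
    assert (Y := K s ltac:(apply Rabs_def1; lra)). apply Rabs_lt_between in Y.
    apply Rlt_le, sin_gt_0; lra. }
  exists (snd e). split; auto. apply injective_projections; simpl; lra.
Qed.

Lemma psi_value_unique dh dg z w w' : psi_value dh dg z w -> psi_value dh dg z w' -> w = w'.
Proof.
  intros [H1 H2] [_ H3]. apply NNPP. intro Hn.
  assert (Hk : (0 < Cmod (w - w'))%R) by (apply Cmod_gt_0; now apply Cminus_neq0).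
  destruct (H2 (Cmod (w - w') / 2)%R ltac:(lra)) as [d [Hd K]].
  destruct (H3 (Cmod (w - w') / 2)%R ltac:(lra)) as [d' [Hd' K']].
  destruct (H1 (Rmin d d') ltac:(now apply Rmin_glb_lt)) as (v & V1 & V2 & V3).
  assert (A := K v V1 (Rlt_le_trans _ _ _ V2 (Rmin_l _ _)) V3).
  assert (A' := K' v V1 (Rlt_le_trans _ _ _ V2 (Rmin_r _ _)) V3).
  assert (T := Cmod_sub_triangle w (dh v / dg v) w'). rewrite (Cmod_sub_sym w (dh v / dg v)) in T. lra.
Qed.

Lemma psi_value_regular (dh dg : C -> C) d2h d2g z : hol dh d2h -> hol dg d2g -> dg z <> 0 ->
  psi_value dh dg z (dh z / dg z).
Proof.
  intros Hh Hg Hn. assert (X := hol_cts _ _ Hh z). assert (Y := hol_cts _ _ Hg z). split.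
  - intros e He. destruct (tends_near_neq0 _ _ _ Y Hn) as [d [Hd K]].
    set (r := (Rmin e d / 2)%R). assert (Hr : (0 < Rmin e d)%R) by now apply Rmin_glb_lt.
    assert (M1 := Rmin_l e d). assert (M2 := Rmin_r e d).
    assert (E : Cmod (z + RtoC r - z) = r).
    { replace (z + RtoC r - z) with (RtoC r) by ring. rewrite Cmod_R, Rabs_pos_eq; unfold r; lra. }
    exists (z + RtoC r). split; [|split].
    + intro Q. rewrite Q in E. replace (z - z) with (RtoC 0) in E by ring.
      rewrite Cmod_0 in E. unfold r in E. lra.
    + rewrite E. unfold r. lra.
    + apply K. rewrite E. unfold r. lra.
  - intros e He.
    assert (T : tends (cnear z) (fun w => dh w / dg w) (dh z / dg z)) by (tends_auto; auto).
    destruct (T e He) as [d [Hd K]]. exists d. split; auto.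
Qed.

(** At such a point h', g' and W are nonzero, which excludes F_2, F_3 and N. For F_1, Re(omega)
    equals r Re E with r >= 0 and E continuous; the fold condition gives Re E <> 0 at [t0], so
    Re(omega) cannot have strictly opposite signs on the two sides. *)
Lemma fold_not_exceptional f h g dh dg d2h d2g (u z : C) : harmonic f h g dh dg d2h d2g ->
  crit dh dg z -> fold_point u dh dg d2h d2g z -> ~ (Fset f dh dg z \/ Nset f dh dg z).
Proof.
  intros [Hh Hg Hdh Hdg Hf] Hcr [HQ HI].
  assert (Hgz : dg z <> 0).
  { intro E. unfold crit in Hcr. rewrite E, Cmod_0 in Hcr. apply Cmod_eq_0 in Hcr.
    apply HQ. unfold dQ. rewrite E, Hcr. ring. }
  assert (Hhz : dh z <> 0).
  { intro E. unfold crit in Hcr. rewrite E, Cmod_0 in Hcr. symmetry in Hcr.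
    apply Cmod_eq_0 in Hcr. contradiction. }
  assert (HWz : wronsk dh dg d2h d2g z <> 0).
  { intro E. apply HI. rewrite E. unfold Cdiv. rewrite Cmult_0_l. reflexivity. }
  assert (Hpsi := psi_value_regular dh dg d2h d2g z Hdh Hdg Hgz).
  assert (Hmod : Cmod (dh z / dg z) = 1%R).
  { rewrite Cmod_div by auto. rewrite Hcr. field. apply Cmod_gt_0 in Hgz. lra. }
  assert (Hnd : ~ psi_deriv dh dg z 0).
  { intros (w & Hw & Hd). assert (Ew : w = dh z / dg z) by exact (psi_value_unique _ _ _ _ _ Hw Hpsi).
    apply cderiv_cdiff in Hd.
    assert (X := cdiff_div dh dg z _ _ Hgz (Hdh z) (Hdg z)).
    assert (Y : cdiff (psi_ext dh dg z w) z ((d2h z * dg z - dh z * d2g z) / (dg z * dg z))).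
    { eapply cdiff_near; [|exact X]. apply filter_forall. intro v. unfold psi_ext.
      destruct excluded_middle_informative as [E|E]; auto. subst v. auto. }
    assert (E := cdiff_unique _ _ _ _ Hd Y). apply HWz. unfold wronsk.
    replace (d2h z * dg z - dh z * d2g z)
      with ((d2h z * dg z - dh z * d2g z) / (dg z * dg z) * (dg z * dg z)) by (field; auto).
    rewrite <- E. ring. }
  intros [[H1|[H2|H3]]|HN].
  - destruct H1 as (_ & _ & zz & dz & phi & t0 & Hz & _ & _ & Ht0 & Ez & Hphi & Hinc & Hpv & Hsign).
    set (W := wronsk dh dg d2h d2g).
    assert (CW : ctsC W) by exact (wronsk_cts _ _ _ _ Hdh Hdg).
    assert (Zc : tends (locally t0) zz (zz t0)).
    { eapply pdiff_cts. apply pdiff_rderiv. apply Hz. lra. }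
    assert (Hn : locally t0 (fun t => dg (zz t) <> 0 /\ W (zz t) <> 0)).
    { apply (tends_near (locally t0) zz (zz t0) (fun v => dg v <> 0 /\ W v <> 0) Zc). rewrite Ez.
      apply (filter_and (F := cnear z)); [exact (tends_near_neq0 _ _ _ (hol_cts _ _ Hdg z) Hgz)|
        exact (tends_near_neq0 _ _ _ (CW z) HWz)]. }
    (* Obtained from omega by substituting h' = e^(i phi) g' and z' = i r e^(i phi) g'^2 / W, with
       the factor r removed. *)
    set (E := fun t => Ci * cis (3 / 2 * phi t) * (dg (zz t) * dg (zz t) * dg (zz t)) / W (zz t)).
    assert (HEc : tends (locally t0) E (E t0)).
    { assert (Y := tends_comp (locally t0) dg zz (zz t0) _ Zc (hol_cts _ _ Hdg _)).
      assert (Y' := tends_comp (locally t0) W zz (zz t0) _ Zc (CW _)).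
      assert (Y2 : tends (locally t0) (fun t => cis (3 / 2 * phi t)) (cis (3 / 2 * phi t0))).
      { apply (cis_cts (fun t => 3 / 2 * phi t)%R). apply continuity_pt_mult.
        - apply continuity_pt_const. intros a b. reflexivity.
        - apply Hphi. lra. }
      unfold E. tends_auto. now rewrite Ez. }
    assert (Hval : forall t, (0 <= t <= 1)%R -> dg (zz t) <> 0 -> dh (zz t) = cis (phi t) * dg (zz t)).
    { intros t Ht Hgt.
      assert (X := psi_value_unique _ _ _ _ _ (Hpv t Ht) (psi_value_regular dh dg d2h d2g (zz t) Hdh Hdg Hgt)).
      rewrite X. field. auto. }
    assert (HE0 : fst (E t0) <> 0%R).
    { intro Z. apply HI.
      assert (Hv := Hval t0 ltac:(lra)). rewrite Ez in Hv. specialize (Hv Hgz).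
      (* From h' = e^(i ph) g' it follows that Q' = g' e^(i ph/2) m with m real. Therefore E m^3 = i
         / kap, and Re E = 0 would make kap real. *)
      set (ph := phi t0) in *. set (m := (2 * cx u (cis (ph / 2)))%R).
      assert (Ec : cis ph = cis (ph / 2) * cis (ph / 2)) by (rewrite <- cis_plus; f_equal; field).
      assert (EQ : dQ u dh dg z = dg z * cis (ph / 2) * RtoC m).
      { unfold dQ. rewrite Hv, Ec.
        assert (Em : RtoC m = u * cis (ph / 2) + Cconj (u * cis (ph / 2)))
          by (apply injective_projections; unfold m, cx; simpl; ring).
        assert (Ecc : Cconj (cis (ph / 2)) * cis (ph / 2) = 1).
        { rewrite Cmult_comm, <- Cmod2_conj. replace (Cmod (cis (ph / 2)) ^ 2)%R with 1%R; auto.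
          rewrite Cmod2_alt. unfold cis, Re, Im. simpl fst; simpl snd.
          rewrite <- !Rsqr_pow2, Rplus_comm, sin2_cos2. reflexivity. }
        rewrite Em, Cmult_conj.
        replace (dg z * cis (ph / 2) * (u * cis (ph / 2) + Cconj u * Cconj (cis (ph / 2))))
          with (u * (cis (ph / 2) * cis (ph / 2) * dg z)
                + Cconj u * dg z * (Cconj (cis (ph / 2)) * cis (ph / 2))) by ring.
        rewrite Ecc. ring. }
      assert (Hm : RtoC m <> 0).
      { intro Q. apply HQ. rewrite EQ, Q. ring. }
      set (kap := wronsk dh dg d2h d2g z / Cpow (dQ u dh dg z) 3) in *.
      assert (Ec3 : cis (3 / 2 * ph) = cis (ph / 2) * cis (ph / 2) * cis (ph / 2))
        by (rewrite <- !cis_plus; f_equal; field).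
      assert (Hcn := cis_neq0 (ph / 2)).
      assert (Hkn : kap <> 0).
      { intro Q. apply HWz. replace (wronsk dh dg d2h d2g z) with (kap * Cpow (dQ u dh dg z) 3)
          by (unfold kap; simpl; field; auto). rewrite Q. ring. }
      assert (EE : E t0 * RtoC (m * m * m) = Ci / kap).
      { unfold E. rewrite Ez. fold ph. unfold kap. rewrite EQ, Ec3, !RtoC_mult. unfold W. simpl. field.
        repeat split; auto. }
      assert (Ei : / kap = RtoC (snd (E t0) * (m * m * m))).
      { replace (/ kap) with (- Ci * (Ci / kap)).
        - assert (G : forall (v : C) (k : R), fst v = 0%R -> - Ci * (v * RtoC k) = RtoC (snd v * k)).
          { intros v k Hv0. apply injective_projections; simpl; rewrite Hv0; ring. }
          rewrite <- EE. now apply G.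
        - unfold Cdiv. replace (- Ci * (Ci * / kap)) with (- (Ci * Ci) * / kap) by ring.
          replace (- (Ci * Ci)) with (RtoC 1) by (apply injective_projections; simpl; ring). ring. }
      replace kap with (/ / kap) by (field; auto). rewrite Ei. simpl. unfold Rdiv. ring. }
    assert (Hsg : locally t0 (fun t => 0 < fst (E t0) * fst (E t))%R).
    { assert (Cf := tends_fst E t0 HEc).
      assert (Ha : (0 < Rabs (fst (E t0)))%R) by now apply Rabs_pos_lt.
      eapply filter_imp; [|exact (eps_of_continuous _ _ Cf _ Ha)]. cbv beta. intros t Ht.
      revert Ht. unfold Rabs. repeat destruct Rcase_abs; nra. }
    (* Rotated by e^(-i phi t), psi along the path is unimodular with increasing argument and equals
       1 at t; its velocity i r, r >= 0, determines z'. *)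
    assert (Hrw : forall t, (0 < t < 1)%R -> dg (zz t) <> 0 -> W (zz t) <> 0 ->
       exists r, (0 <= r)%R /\ fst (dh (zz t) * dz t * cis (- phi t / 2)) = (r * fst (E t))%R).
    { intros t Ht Hgt HWt.
      assert (Hzt : pdiff zz t (dz t)) by (apply pdiff_rderiv; apply Hz; lra).
      assert (Hgl : locally t (fun s => dg (zz s) <> 0)).
      { apply (tends_near (locally t) zz (zz t) (fun v => dg v <> 0) (pdiff_cts _ _ _ Hzt)).
        exact (tends_near_neq0 _ _ _ (hol_cts _ _ Hdg _) Hgt). }
      apply locally_R_iff in Hgl. destruct Hgl as [d1 [Hd1 Hgl]].
      set (d := Rmin d1 (Rmin t (1 - t))).
      assert (Hd : (0 < d)%R) by (unfold d; repeat apply Rmin_glb_lt; lra).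
      assert (Hdd : (d <= d1 /\ d <= t /\ d <= 1 - t)%R).
      { unfold d, Rmin. repeat destruct Rle_dec; lra. }
      assert (Pd := pdiff_comp zz t _ (fun v => dh v / dg v) _ Hzt
         (cdiff_div dh dg (zz t) _ _ Hgt (Hdh _) (Hdg _))).
      assert (Pd' := hasd_scal (locally t) RtoC t (cis (- phi t)) _ _ Pd). cbv beta in Pd'.
      assert (U1 : forall s, (Rabs (s - t) < d)%R ->
         cis (- phi t) * (dh (zz s) / dg (zz s)) = cis (phi s - phi t)).
      { intros s Hs. assert (Hgs : dg (zz s) <> 0) by (apply Hgl; lra).
        rewrite (Hval s); auto.
        - replace (phi s - phi t)%R with (- phi t + phi s)%R by ring. rewrite cis_plus.
          field. auto.
        - apply Rabs_lt_between in Hs. lra. }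
      assert (U2 : forall s s', (Rabs (s - t) < d)%R -> (Rabs (s' - t) < d)%R -> (s < s')%R ->
         (phi s < phi s')%R).
      { intros s s' H1 H2 H3. apply Rabs_lt_between in H1. apply Rabs_lt_between in H2.
        apply Hinc; lra. }
      destruct (unimodular_velocity _ phi t _ d Hd U1 (Hphi t ltac:(lra)) U2 Pd') as (r & Hr & Er).
      exists r. split; auto.
      change (d2h (zz t) * dg (zz t) - dh (zz t) * d2g (zz t)) with (W (zz t)) in Er.
      assert (Ecc : cis (- phi t) * cis (phi t) = 1)
        by (rewrite <- cis_plus, Rplus_opp_l; apply cis_0).
      assert (Edz : dz t = Ci * RtoC r * cis (phi t) * (dg (zz t) * dg (zz t)) / W (zz t)).
      { rewrite <- Er.
        replace (cis (- phi t) * (W (zz t) / (dg (zz t) * dg (zz t)) * dz t) * cis (phi t)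
             * (dg (zz t) * dg (zz t)) / W (zz t))
          with ((cis (- phi t) * cis (phi t)) * dz t) by (field; auto).
        rewrite Ecc. ring. }
      rewrite Edz, (Hval t) by (auto; lra).
      assert (E3 : cis (phi t) * cis (phi t) * cis (- phi t / 2) = cis (3 / 2 * phi t))
        by (rewrite <- !cis_plus; f_equal; field).
      replace (cis (phi t) * dg (zz t) * (Ci * RtoC r * cis (phi t) * (dg (zz t) * dg (zz t)) / W (zz t)) *
         cis (- phi t / 2)) with (RtoC r * E t).
      - simpl. ring.
      - unfold E. rewrite <- E3. field. auto. }
    assert (Hall : locally t0 (fun t => (0 < t < 1)%R /\ (dg (zz t) <> 0 /\ W (zz t) <> 0) /\
      (0 < fst (E t0) * fst (E t))%R)).
    { apply filter_and; [|apply filter_and; auto]. apply locally_R_iff.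
      exists (Rmin t0 (1 - t0)). split; [apply Rmin_glb_lt; lra|]. intros s Hs.
      assert (M1 := Rmin_l t0 (1 - t0)). assert (M2 := Rmin_r t0 (1 - t0)).
      apply Rabs_lt_between in Hs. lra. }
    apply locally_R_iff in Hall. destruct Hall as [d [Hd Hall]].
    destruct Hsign as [d' [Hd' Hsign]].
    set (e := (Rmin d d' / 2)%R). assert (Hm : (0 < Rmin d d')%R) by now apply Rmin_glb_lt.
    assert (M1 := Rmin_l d d'). assert (M2 := Rmin_r d d').
    destruct (Hall (t0 - e)%R) as (A1 & [A2 A3] & A4); [apply Rabs_def1; unfold e; lra|].
    destruct (Hall (t0 + e)%R) as (B1 & [B2 B3] & B4); [apply Rabs_def1; unfold e; lra|].
    destruct (Hrw _ A1 A2 A3) as (r1 & R1 & Q1). destruct (Hrw _ B1 B2 B3) as (r2 & R2 & Q2).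
    assert (X := Hsign (t0 - e)%R (t0 + e)%R ltac:(unfold e; lra) ltac:(unfold e; lra)).
    cbv beta in X. rewrite Q1, Q2 in X.
    set (a := fst (E (t0 - e)%R)) in *. set (b := fst (E (t0 + e)%R)) in *. set (k := fst (E t0)) in *.
    assert (Hab : (0 <= a * b)%R) by nra.
    assert (0 <= r1 * r2)%R by (now apply Rmult_le_pos).
    assert (0 <= (r1 * r2) * (a * b))%R by (now apply Rmult_le_pos). lra.
  - destruct H2 as (_ & _ & _ & H2). contradiction.
  - destruct H3 as (_ & H3). contradiction.
  - destruct HN as (_ & HN). apply HN. exists (dh z / dg z). auto.
Qed.

(** * The arc and its two sides *)

Definition graph_arc (u : C) (c d : R) (M : R -> R) (w : C) : Prop :=
  (c <= cx u w <= d)%R /\ cy u w = M (cx u w).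

Definition graph_param (u : C) (c d : R) (M : R -> R) (t : R) : C :=
  ((c + t * (d - c))%R, M (c + t * (d - c))%R) / u.

Lemma Cmult_div_cancel (u v : C) : u <> 0 -> u * (v / u) = v.
Proof. intro H. field. auto. Qed.

Lemma cx_div (u : C) (x y : R) : u <> 0 -> cx u ((x, y) / u) = x.
Proof. intro H. unfold cx. now rewrite Cmult_div_cancel. Qed.

Lemma cy_div (u : C) (x y : R) : u <> 0 -> cy u ((x, y) / u) = y.
Proof. intro H. unfold cy. now rewrite Cmult_div_cancel. Qed.

Lemma cxy_eta (u w : C) : u <> 0 -> w = (cx u w, cy u w) / u.
Proof. intro H. apply (cxy_inj u); auto; [now rewrite cx_div|now rewrite cy_div]. Qed.

Lemma graph_param_cts (u : C) c d M t : u <> 0 -> continuity_pt M (c + t * (d - c))%R ->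
  tends (locally t) (graph_param u c d M) (graph_param u c d M t).
Proof.
  intros Hu HM. assert (Cx : continuity_pt (fun s => c + s * (d - c))%R t).
  { apply continuity_pt_plus; [apply continuity_pt_const; intros a b; reflexivity|].
    apply continuity_pt_mult; [apply derivable_continuous_pt, derivable_pt_id|].
    apply continuity_pt_const; intros a b; reflexivity. }
  assert (T : tends (locally t) (fun s => ((c + s * (d - c))%R, M (c + s * (d - c))%R) : C)
     ((c + t * (d - c))%R, M (c + t * (d - c))%R)).
  { apply (tends_pair (fun s => c + s * (d - c))%R (fun s => M (c + s * (d - c))%R));
      apply continuity_pt_filterlim; auto.
    apply (continuity_pt_comp (fun s => c + s * (d - c))%R M); auto. }
  unfold graph_param. tends_auto. exact Hu.
Qed.

Lemma graph_arc_param (u : C) c d M : u <> 0 -> (c < d)%R ->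
  (forall x, (c <= x <= d)%R -> continuity_pt M x) ->
  arc_param (graph_param u c d M) (graph_arc u c d M).
Proof.
  intros Hu Hcd HM. assert (Hr : forall t, (0 <= t <= 1)%R -> (c <= c + t * (d - c) <= d)%R).
  { intros t Ht. nra. }
  split; [|split].
  - intros t Ht e He.
    destruct (proj1 (locally_R_iff _ _) (graph_param_cts u c d M t Hu (HM _ (Hr t Ht)) e He)) as [del [Hdel K]].
    exists del. split; auto.
  - intros s t _ _ E. apply (f_equal (cx u)) in E. unfold graph_param in E. rewrite !cx_div in E by auto. nra.
  - intro w. split.
    + intros [Hx Hy]. exists ((cx u w - c) / (d - c))%R. split.
      * split; [apply Rdiv_le_0_compat; lra|]. apply Rmult_le_reg_r with (d - c)%R; [lra|].
        unfold Rdiv. rewrite Rmult_assoc, Rinv_l; lra.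
      * unfold graph_param. replace (c + (cx u w - c) / (d - c) * (d - c))%R with (cx u w) by (field; lra).
        rewrite <- Hy. symmetry. now apply cxy_eta.
    + intros [t [Ht <-]]. unfold graph_arc, graph_param. rewrite cx_div, cy_div by auto. auto.
Qed.

(** A level slightly above an interior minimum would be attained on both sides of it. *)
Lemma inj_no_min (X : R -> R) t : continuity X ->
  (forall s s', (0 <= s <= 1)%R -> (0 <= s' <= 1)%R -> X s = X s' -> s = s') ->
  (0 < t < 1)%R -> (forall s, (0 <= s <= 1)%R -> (X t <= X s)%R) -> False.
Proof.
  intros HX Hinj Ht Hmin.
  assert (A0 : X t <> X 0%R) by (intro E; apply Hinj in E; lra).
  assert (A1 : X t <> X 1%R) by (intro E; apply Hinj in E; lra).
  assert (B0 := Hmin 0%R ltac:(lra)). assert (B1 := Hmin 1%R ltac:(lra)).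
  set (v := Rmin (X 0%R) (X 1%R)).
  assert (Hv : (X t < v)%R) by (apply Rmin_glb_lt; lra).
  assert (V0 : (v <= X 0)%R) by apply Rmin_l. assert (V1 : (v <= X 1)%R) by apply Rmin_r.
  destruct (IVT_gen X 0 t v HX) as [s [S1 S2]].
  { rewrite Rmin_right, Rmax_left by lra. lra. }
  destruct (IVT_gen X t 1 v HX) as [s' [S1' S2']].
  { rewrite Rmin_left, Rmax_right by lra. lra. }
  rewrite Rmin_left, Rmax_right in S1 by lra. rewrite Rmin_left, Rmax_right in S1' by lra.
  assert (s = s') by (apply Hinj; lra). assert (t <= s <= t)%R by (rewrite H at 1; split; [apply S1'|apply S1]).
  assert (E : s = t) by (apply Rle_antisym; apply H0). rewrite E in S2. lra.
Qed.

Lemma arc_clamp gam beta : arc_param gam beta ->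
  ctsR (fun t => gam (clamp t)) /\ (forall t, (0 <= t <= 1)%R -> gam (clamp t) = gam t).
Proof.
  intros (H & _ & _). split.
  - intros t e He. destruct (H (clamp t) (clamp_bounds t) e He) as [d [Hd K]].
    apply locally_R_iff. exists d. split; auto. intros s Hs. apply K; [apply clamp_bounds|].
    eapply Rle_lt_trans; [apply clamp_lip|auto].
  - intros t Ht. now rewrite clamp_id.
Qed.

(** Interior points of an arc are defined through an arbitrary parametrization. The abscissa along
    it is continuous and injective, so it has no extremum at an interior parameter and avoids both c
    and d. *)
Lemma graph_arc_int (u : C) c d M w : u <> 0 -> arc_int (graph_arc u c d M) w ->
  (c < cx u w < d)%R /\ cy u w = M (cx u w).
Proof.
  intros Hu (gam & Hg & t & Ht & Ew).
  destruct (arc_clamp _ _ Hg) as [Hc Hcl]. destruct Hg as (_ & Hinj & Hbeta).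
  assert (Hin : forall s, (0 <= s <= 1)%R -> graph_arc u c d M (gam s)).
  { intros s Hs. apply Hbeta. now exists s. }
  assert (Hw : graph_arc u c d M w) by (rewrite <- Ew; apply Hin; lra).
  destruct Hw as [Hx Hy]. split; [|auto].
  set (X := fun s => cx u (gam (clamp s))).
  assert (HX : continuity X) by (intro s; now apply (cx_cts u (fun s => gam (clamp s)))).
  assert (HXi : forall s s', (0 <= s <= 1)%R -> (0 <= s' <= 1)%R -> X s = X s' -> s = s').
  { intros s s' Hs Hs' E. unfold X in E. rewrite !Hcl in E by auto. apply Hinj; auto.
    apply (cxy_inj u); auto. destruct (Hin s Hs) as [_ ->]. destruct (Hin s' Hs') as [_ ->]. now rewrite E. }
  assert (Xt : X t = cx u w) by (unfold X; rewrite Hcl by lra; now rewrite Ew).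
  split.
  - apply Rnot_le_lt. intro L. apply (inj_no_min X t HX HXi Ht). intros s Hs. rewrite Xt.
    unfold X. rewrite Hcl by auto. destruct (Hin s Hs) as [Hb _]. lra.
  - apply Rnot_le_lt. intro L. apply (inj_no_min (fun s => - X s)%R t).
    + now apply continuity_opp.
    + intros s s' Hs Hs' E. apply HXi; auto. lra.
    + exact Ht.
    + intros s Hs. rewrite Xt. unfold X. rewrite Hcl by auto. destruct (Hin s Hs) as [Hb _]. lra.
Qed.

Lemma graph_arc_tangent (u : C) c d M l w : u <> 0 -> (c < d)%R ->
  (forall x, (c <= x <= d)%R -> continuity_pt M x) ->
  (c < cx u w < d)%R -> cy u w = M (cx u w) -> is_derive M (cx u w) l ->
  tangent_dir (graph_arc u c d M) w (((d - c)%R, ((d - c) * l)%R) / u).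
Proof.
  intros Hu Hcd HM Hx Hy Hl. split.
  - intro E. apply (f_equal (cx u)) in E. rewrite cx_div in E by auto. unfold cx in E. simpl in E. lra.
  - set (t0 := ((cx u w - c) / (d - c))%R).
    assert (Et : (c + t0 * (d - c) = cx u w)%R) by (unfold t0; field; lra).
    assert (Ht0 : (0 < t0 < 1)%R) by nra.
    exists (graph_param u c d M), t0. split; [now apply graph_arc_param|]. split; [auto|]. split.
    + unfold graph_param. rewrite Et, <- Hy. symmetry. now apply cxy_eta.
    + apply pdiff_rderiv.
      assert (Dx : is_derive (fun s => c + s * (d - c))%R t0 (d - c)%R) by (auto_derive; auto; ring).
      assert (P : pdiff (fun s => ((c + s * (d - c))%R, M (c + s * (d - c))%R)) t0 ((d - c)%R, ((d - c) * l)%R)).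
      { apply (pdiff_pair (fun s => c + s * (d - c))%R (fun s => M (c + s * (d - c))%R)); auto.
        rewrite <- Et in Hl. exact (is_derive_comp M _ t0 _ _ Hl Dx). }
      assert (Z := hasd_scal (locally t0) RtoC t0 (/ u) _ _ P).
      unfold Cdiv. rewrite Cmult_comm. apply (hasd_ext (locally t0) RtoC t0
        (fun s => / u * ((c + s * (d - c))%R, M (c + s * (d - c))%R))); auto.
      * unfold graph_param, Cdiv. now rewrite Cmult_comm.
      * apply filter_forall. intro s. unfold graph_param, Cdiv. now rewrite Cmult_comm.
Qed.

Lemma cnear_box (u w0 : C) (P : C -> Prop) : u <> 0 -> cnear w0 P ->
  exists e, (0 < e)%R /\ forall w, (Rabs (cx u w - cx u w0) < e)%R -> (Rabs (cy u w - cy u w0) < e)%R -> P w.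
Proof.
  intros Hu [d [Hd H]]. assert (Hk : (0 < Cmod u)%R) by now apply Cmod_gt_0.
  exists (Cmod u * d / 2)%R. split; [apply Rdiv_lt_0_compat; [apply Rmult_lt_0_compat|]; lra|].
  intros w H1 H2. apply H. apply Rmult_lt_reg_l with (Cmod u); auto. rewrite <- Cmod_mult.
  eapply Rle_lt_trans; [apply Cmod_le_sum|].
  replace (fst (u * (w - w0))) with (cx u w - cx u w0)%R by (unfold cx; simpl; ring).
  replace (snd (u * (w - w0))) with (cy u w - cy u w0)%R by (unfold cy; simpl; ring). lra.
Qed.

Lemma box_cnear (u w0 : C) e : (0 < e)%R ->
  cnear w0 (fun w => (Rabs (cx u w - cx u w0) < e)%R /\ (Rabs (cy u w - cy u w0) < e)%R).
Proof.
  intro He. apply (filter_and (F := cnear w0)); [exact (cx_near u w0 e He)|exact (cy_near u w0 e He)].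
Qed.

Lemma seg_coords (u p q : C) t :
  cx u (p + RtoC t * (q - p)) = (cx u p + t * (cx u q - cx u p))%R /\
  cy u (p + RtoC t * (q - p)) = (cy u p + t * (cy u q - cy u p))%R.
Proof. unfold cx, cy. simpl. split; ring. Qed.

(* Two points on the same side of the graph are joined by a vertical, a horizontal and a vertical
   segment, the horizontal one at height [y0 + s * e / 2]. *)
Lemma side_in_component (X Om : C -> Prop) (u : C) M x0 y0 a e s : u <> 0 -> is_component X Om ->
  (s = 1 \/ s = -1)%R -> (0 < e)%R ->
  (forall x, (Rabs (x - x0) < a)%R -> (Rabs (M x - y0) < e / 2)%R) ->
  (forall w, (Rabs (cx u w - x0) < a)%R -> (Rabs (cy u w - y0) < e)%R ->
     (0 < s * (cy u w - M (cx u w)))%R -> X w) ->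
  forall p q, (Rabs (cx u p - x0) < a)%R -> (Rabs (cy u p - y0) < e)%R ->
     (0 < s * (cy u p - M (cx u p)))%R ->
     (Rabs (cx u q - x0) < a)%R -> (Rabs (cy u q - y0) < e)%R ->
     (0 < s * (cy u q - M (cx u q)))%R -> Om p -> Om q.
Proof.
  intros Hu HC Hs He HM HX p q Px Py Ps Qx Qy Qs HO.
  set (y1 := (y0 + s * (e / 2))%R).
  set (p1 := (cx u p, y1) / u). set (q1 := (cx u q, y1) / u).
  assert (P1x : cx u p1 = cx u p) by now apply cx_div.
  assert (P1y : cy u p1 = y1) by now apply cy_div.
  assert (Q1x : cx u q1 = cx u q) by now apply cx_div.
  assert (Q1y : cy u q1 = y1) by now apply cy_div.
  assert (Hlev : forall x, (Rabs (x - x0) < a)%R -> (0 < s * (y1 - M x))%R).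
  { intros x Hx. assert (X1 := HM x Hx). apply Rabs_lt_between in X1. unfold y1.
    destruct Hs; subst s; lra. }
  assert (Hy1 : (Rabs (y1 - y0) < e)%R).
  { unfold y1. apply Rabs_def1; destruct Hs; subst s; lra. }
  assert (Hconv : forall b c t r m, (Rabs (b - m) < r)%R -> (Rabs (c - m) < r)%R -> (0 <= t <= 1)%R ->
     (Rabs (b + t * (c - b) - m) < r)%R).
  { intros b c t r m H1 H2 Ht. apply Rabs_lt_between in H1. apply Rabs_lt_between in H2.
    destruct (Rle_or_lt b c); apply Rabs_def1; nra. }
  assert (Hpos : forall b c t, (0 < b)%R -> (0 < c)%R -> (0 <= t <= 1)%R -> (0 < b + t * (c - b))%R).
  { intros b c t H1 H2 Ht. destruct (Rle_or_lt b c); nra. }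
  assert (Hvert : forall v v1, (Rabs (cx u v - x0) < a)%R -> (Rabs (cy u v - y0) < e)%R ->
     (0 < s * (cy u v - M (cx u v)))%R -> cx u v1 = cx u v -> cy u v1 = y1 ->
     forall t, (0 <= t <= 1)%R -> X (v + RtoC t * (v1 - v)) /\ X (v1 + RtoC t * (v - v1))).
  { intros v v1 V1 V2 V3 E1 E2 t Ht.
    assert (Z1 := Hlev _ V1). split; apply HX;
      destruct (seg_coords u v v1 t) as [S1 S2]; destruct (seg_coords u v1 v t) as [S1' S2'];
      rewrite ?S1, ?S2, ?S1', ?S2', ?E1, ?E2.
    - apply Hconv; auto.
    - apply Hconv; auto.
    - replace (cx u v + t * (cx u v - cx u v))%R with (cx u v) by ring.
      replace (s * (cy u v + t * (y1 - cy u v) - M (cx u v)))%R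
        with (s * (cy u v - M (cx u v)) + t * (s * (y1 - M (cx u v)) - s * (cy u v - M (cx u v))))%R by ring.
      now apply Hpos.
    - apply Hconv; auto.
    - apply Hconv; auto.
    - replace (cx u v + t * (cx u v - cx u v))%R with (cx u v) by ring.
      replace (s * (y1 + t * (cy u v - y1) - M (cx u v)))%R
        with (s * (y1 - M (cx u v)) + t * (s * (cy u v - M (cx u v)) - s * (y1 - M (cx u v))))%R by ring.
      now apply Hpos. }
  assert (O1 : Om p1).
  { apply (component_seg X Om p p1 HC HO). intros z [t [Ht ->]].
    apply (Hvert p p1 Px Py Ps P1x P1y t Ht). }
  assert (O2 : Om q1).
  { apply (component_seg X Om p1 q1 HC O1). intros z [t [Ht ->]].
    destruct (seg_coords u p1 q1 t) as [S1 S2]. apply HX; rewrite ?S1, ?S2, ?P1x, ?P1y, ?Q1x, ?Q1y.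
    - now apply Hconv.
    - now apply Hconv.
    - replace (y1 + t * (y1 - y1))%R with y1 by ring. apply Hlev. now apply Hconv. }
  apply (component_seg X Om q1 q HC O2). intros z [t [Ht ->]].
  apply (Hvert q q1 Qx Qy Qs Q1x Q1y t Ht).
Qed.

Lemma fold_right_const {I : Type} (n : I -> nat) a (l : list I) k :
  (forall i, In i l -> n i = a) ->
  fold_right (fun i s => n i + s)%nat k l = (a * length l + k)%nat.
Proof.
  induction l as [|i l IH]; intro H; [simpl; lia|].
  simpl. rewrite IH by (intros j Hj; apply H; now right). rewrite (H i) by now left. lia.
Qed.

(* Charts at different critical preimages of [w0] have the same image curve near [w0], and the
   convexity of that curve determines the side on which each fold has two preimages. *)
Lemma chart_agrees f dh dg d2h d2g (u : C) w0 (c d : R) (M : R -> R) z r0 U r eps sg M' dM' :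
  u <> 0 -> f z = w0 -> fold_chart f dh dg d2h d2g u z r0 U r eps sg M' dM' ->
  cnear w0 (fun w => forall z, f z = w -> crit dh dg z -> (c <= cx u w <= d)%R /\ cy u w = M (cx u w)) ->
  exists eta, (0 < eta <= eps)%R /\
    (forall x, (Rabs (x - cx u w0) < eta)%R -> M' x = M x) /\
    is_derive M (cx u w0) (dM' (cx u w0)) /\
    (forall x, (Rabs (x - cx u w0) < eta)%R -> x <> cx u w0 ->
       (sg * M x < sg * (M (cx u w0) + dM' (cx u w0) * (x - cx u w0)))%R).
Proof.
  intros Hu Ez HC Hnear. set (x0 := cx u w0).
  destruct (cnear_box u w0 _ Hu Hnear) as [e [He Hb]]. fold x0 in Hb.
  assert (Heps := fc_eps _ _ _ _ _ _ _ _ _ _ _ _ _ _ HC).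
  assert (Hder := fc_der _ _ _ _ _ _ _ _ _ _ _ _ _ _ HC). rewrite Ez in Hder. fold x0 in Hder.
  assert (Hcv := fc_conv _ _ _ _ _ _ _ _ _ _ _ _ _ _ HC). rewrite Ez in Hcv. fold x0 in Hcv.
  assert (Hcu := fc_curve _ _ _ _ _ _ _ _ _ _ _ _ _ _ HC). rewrite Ez in Hcu. fold x0 in Hcu.
  assert (Hba := fc_base _ _ _ _ _ _ _ _ _ _ _ _ _ _ HC). rewrite Ez in Hba. fold x0 in Hba.
  assert (Hx00 : (Rabs (x0 - x0) < eps)%R) by (rewrite Rminus_diag, Rabs_R0; lra).
  destruct (continuity_pt_eps M' x0 (is_derive_continuity_pt _ _ _ (Hder x0 Hx00)) e He) as [d1 [Hd1 K]].
  set (eta := Rmin eps (Rmin e d1)).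
  assert (Heta : (0 < eta)%R) by (repeat apply Rmin_glb_lt; auto).
  assert (L1 : (eta <= eps)%R) by apply Rmin_l.
  assert (L2 : (eta <= e)%R) by (eapply Rle_trans; [apply Rmin_r|apply Rmin_l]).
  assert (L3 : (eta <= d1)%R) by (eapply Rle_trans; [apply Rmin_r|apply Rmin_r]).
  (* The chart realises (x, M' x) as a critical value close to [w0], and all such values lie on the
     graph of [M]. *)
  assert (Hag : forall x, (Rabs (x - x0) < eta)%R -> M' x = M x).
  { intros x Hx. destruct (Hcu x ltac:(lra)) as (v & _ & V1 & V2 & V3).
    assert (B := Hb (f v)). rewrite V2, V3 in B. rewrite <- Hba in B.
    destruct (B ltac:(lra) (K x ltac:(lra)) v eq_refl V1) as [_ E]. exact E. }
  assert (Hx0e : (Rabs (x0 - x0) < eta)%R) by (rewrite Rminus_diag, Rabs_R0; lra).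
  exists eta. split; [lra|]. split; [auto|]. split.
  - apply (is_derive_ext_loc M'); [|now apply Hder].
    apply locally_R_iff. exists eta. split; auto.
  - intros x Hx Hn. rewrite <- (Hag x Hx), <- (Hag x0 Hx0e). apply Hcv; auto; lra.
Qed.

(** Otherwise all values near [w] would be neither critical nor cluster values, and [w] could not be
    a boundary point of a component. *)
Lemma critical_value_exists f h g dh dg d2h d2g (X Om : C -> Prop) w :
  harmonic f h g dh dg d2h d2g ->
  (forall v, (forall z, f z = v -> ~ crit dh dg z) -> ~ cluster_inf f v -> X v) ->
  is_component X Om -> cboundary Om w -> ~ cluster_inf f w ->
  exists z, f z = w /\ crit dh dg z.
Proof.
  intros [Hh Hg Hdh Hdg Hf] HX HC Hb Hn. apply NNPP. intro Hno.
  apply (boundary_not_near X Om w HC Hb).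
  eapply filter_imp; [|apply (preimages_away f w (crit dh dg))].
  - cbv beta. intros v [V1 V2]. apply HX; auto.
  - exact (harmonic_cts f h g dh dg Hh Hg Hf).
  - exact Hn.
  - intros z E. apply (not_crit_open dh dg d2h d2g); auto. intro Hc. apply Hno. now exists z.
Qed.

(** The factor INR k - 1 is 1 for k = 2 and -1 for k = 0, so a single statement covers the doubly
    covered side and the empty side of the folds. *)
Lemma count_near_fold f h g dh dg d2h d2g (u w0 : C) c d (M : R -> R) sg l0 l1 k :
  harmonic f h g dh dg d2h d2g -> u <> 0 -> (sg = 1 \/ sg = -1)%R -> (k = 0 \/ k = 2)%nat ->
  ~ cluster_inf f w0 ->
  NoDup l0 -> NoDup l1 ->
  (forall z, f z = w0 /\ ~ crit dh dg z <-> In z l0) ->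
  (forall z, f z = w0 /\ crit dh dg z <-> In z l1) ->
  (forall z, f z = w0 -> crit dh dg z -> fold_point u dh dg d2h d2g z) ->
  cnear w0 (fun w => forall z, f z = w -> crit dh dg z -> (c <= cx u w <= d)%R /\ cy u w = M (cx u w)) ->
  (forall z r0 U r eps sg' M' dM', f z = w0 ->
      fold_chart f dh dg d2h d2g u z r0 U r eps sg' M' dM' -> sg' = sg) ->
  cnear w0 (fun w => (0 < (INR k - 1) * sg * (cy u w - M (cx u w)))%R ->
     count_eq (fun z => f z = w) (length l0 + k * length l1)).
Proof.
  intros [Hh Hg Hdh Hdg Hf] Hu Hsg Hk Hncl N0 N1 H0 H1 Hfp Hnear Hch.
  assert (Hfc := harmonic_cts f h g dh dg Hh Hg Hf).
  destruct (hol_derivative _ _ Hdh) as [d3h H3h]. destruct (hol_derivative _ _ Hdg) as [d3g H3g].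
  set (n := fun z => if excluded_middle_informative (crit dh dg z) then k else 1%nat).
  replace (length l0 + k * length l1)%nat with (fold_right (fun z s => n z + s)%nat 0%nat (l0 ++ l1)).
  2: { rewrite fold_right_app, (fold_right_const n 1 l0), (fold_right_const n k l1).
       - lia.
       - intros z Hz. apply H1 in Hz. unfold n. destruct excluded_middle_informative; tauto.
       - intros z Hz. apply H0 in Hz. unfold n. destruct excluded_middle_informative; tauto. }
  apply (local_count f w0 (l0 ++ l1)); auto.
  - apply NoDup_app; auto. intros z Z0 Z1. apply H0 in Z0. apply H1 in Z1. tauto.
  - intro z. rewrite in_app_iff, <- H0, <- H1. tauto.
  - intros z Hz r0 Hr0.
    assert (Ez : f z = w0) by (apply in_app_iff in Hz; rewrite <- H0, <- H1 in Hz; tauto).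
    unfold n. destruct (excluded_middle_informative (crit dh dg z)) as [Hc|Hc].
    + destruct (fold_chart_exists f h g dh dg d2h d2g u z r0 Hh Hg Hdh Hdg
        (hol_cts _ _ H3h) (hol_cts _ _ H3g) Hf Hu Hr0 Hc (Hfp z Ez Hc))
        as (U & r & eps & sg' & M' & dM' & HC).
      assert (Esg := Hch _ _ _ _ _ _ _ _ Ez HC). subst sg'.
      destruct (chart_agrees _ _ _ _ _ u w0 c d M z r0 U r eps sg M' dM' Hu Ez HC Hnear)
        as (eta & Heta & Hag & _).
      exists U, r. split; [apply HC|]. split; [apply HC|]. split; [apply HC|].
      eapply filter_imp; [|exact (box_cnear u w0 eta (proj1 Heta))]. cbv beta.
      intros w [W1 W2] Hs. rewrite <- Hag in Hs by auto.
      destruct Hk as [-> | ->].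
      * apply count_eq_0. intros v [V1 V2].
        apply (fc_none _ _ _ _ _ _ _ _ _ _ _ _ _ _ HC w) with (z := v); auto; rewrite ?Ez; try lra.
        simpl in Hs. lra.
      * apply (fc_two _ _ _ _ _ _ _ _ _ _ _ _ _ _ HC w); rewrite ?Ez; try lra.
        simpl in Hs. lra.
    + destruct (regular_chart f z (dh z) (dg z) (harmonic_sdiff f h g dh dg d2h d2g z Hh Hg Hdh Hdg Hf)
        Hc r0 Hr0) as (U & r & A1 & A2 & A3 & A4).
      exists U, r. split; [auto|]. split; [auto|]. split; [auto|]. rewrite Ez in A4.
      eapply filter_imp; [|exact A4]. cbv beta. auto.
Qed.

(** Every preimage is regular and contributes exactly one preimage of each nearby value. *)
Lemma count_locally_constant f h g dh dg d2h d2g w m : harmonic f h g dh dg d2h d2g ->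
  (forall z, f z = w -> ~ crit dh dg z) -> ~ cluster_inf f w ->
  count_eq (fun z => f z = w) m -> cnear w (fun v => count_eq (fun z => f z = v) m).
Proof.
  intros [Hh Hg Hdh Hdg Hf] Hnc Hncl (l & L1 & L2 & L3).
  assert (Hfc := harmonic_cts f h g dh dg Hh Hg Hf).
  assert (X : cnear w (fun v => True -> count_eq (fun z => f z = v)
     (fold_right (fun z s => 1 + s)%nat 0%nat l))).
  { apply (local_count f w l (fun _ => True) (fun _ => 1%nat)); auto.
    intros z Hz r0 Hr0. apply L3 in Hz.
    destruct (regular_chart f z (dh z) (dg z) (harmonic_sdiff f h g dh dg d2h d2g z Hh Hg Hdh Hdg Hf)
        (Hnc z Hz) r0 Hr0) as (U & r & A1 & A2 & A3 & A4).
    exists U, r. split; [auto|]. split; [auto|]. split; [auto|]. rewrite Hz in A4.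
    eapply filter_imp; [|exact A4]. cbv beta. auto. }
  rewrite (fold_right_const (fun _ : C => 1%nat) 1 l) in X by auto.
  replace (1 * length l + 0)%nat with m in X by lia.
  eapply filter_imp; [|exact X]. cbv beta. auto.
Qed.

(** * The valence across the arc *)

Lemma scal_RtoC (s : R) (v : C) : scal s v = RtoC s * v.
Proof.
  destruct v as [x y]. change (scal s (x, y)) with (((s * x)%R, (s * y)%R) : C).
  apply injective_projections; simpl; ring.
Qed.

(** A component with [w0] on its boundary contains a full side of the graph near [w0]. Distinct
    components take opposite sides, and the common sign [sg] of the charts tells which side is
    doubly covered and carries the tangent. *)
Lemma valence_across_arc f h g dh dg d2h d2g (Omp Omm : C -> Prop) (u w0 : C) c d (M : R -> R) N0 N1 :
  harmonic f h g dh dg d2h d2g -> finite_valence f -> u <> 0 -> (c < d)%R ->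
  (forall x, (c <= x <= d)%R -> continuity_pt M x) ->
  is_component (fun w => ~ image f (Sset f) w /\ ~ cluster_inf f w) Omp ->
  is_component (fun w => ~ image f (Sset f) w /\ ~ cluster_inf f w) Omm ->
  ~ (forall w, Omp w <-> Omm w) ->
  cboundary Omp w0 -> cboundary Omm w0 ->
  (c < cx u w0 < d)%R -> cy u w0 = M (cx u w0) -> ~ cluster_inf f w0 ->
  (forall z, f z = w0 -> crit dh dg z -> fold_point u dh dg d2h d2g z) ->
  cnear w0 (fun w => forall z, f z = w -> crit dh dg z -> (c <= cx u w <= d)%R /\ cy u w = M (cx u w)) ->
  (forall w, graph_arc u c d M w -> exists z, f z = w /\ crit dh dg z) ->
  count_eq (fun z => f z = w0 /\ ~ Sset f z) N0 ->
  count_eq (fun z => f z = w0 /\ Sset f z) N1 -> (0 < N1)%nat ->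
  exists tau, tangent_dir (graph_arc u c d M) w0 tau /\
    ((tangent_side w0 tau Omp /\ Val_on_eq f Omm N0 /\ Val_on_eq f Omp (N0 + 2 * N1)) \/
     (tangent_side w0 tau Omm /\ Val_on_eq f Omp N0 /\ Val_on_eq f Omm (N0 + 2 * N1))).
Proof.
  intros HH Hv Hu Hcd HMc HCp HCm Hdist Hbp Hbm Hx0 Hy0 Hncl Hfp Hnear Hac HN0 HN1 HN1p.
  assert (HH' := HH). destruct HH' as [Hh Hg Hdh Hdg Hf].
  assert (Hfc := harmonic_cts f h g dh dg Hh Hg Hf).
  destruct (hol_derivative _ _ Hdh) as [d3h H3h]. destruct (hol_derivative _ _ Hdg) as [d3g H3g].
  set (X := fun w => ~ image f (Sset f) w /\ ~ cluster_inf f w) in *.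
  assert (HS : forall z, Sset f z <-> crit dh dg z) by (intro z; exact (Sset_iff f h g dh dg z Hh Hg Hf)).
  assert (HX1 : forall w, X w -> forall z, f z = w -> ~ crit dh dg z).
  { intros w [H1 _] z E Hc. apply H1. exists z. split; auto. now apply HS. }
  assert (HX2 : forall w, (forall z, f z = w -> ~ crit dh dg z) -> ~ cluster_inf f w -> X w).
  { intros w H1 H2. split; auto. intros [z [Z1 Z2]]. apply (H1 z Z2). now apply HS. }
  destruct HN0 as (l0 & L0 & E0 & A0). destruct HN1 as (l1 & L1 & E1 & A1).
  assert (A0' : forall z, f z = w0 /\ ~ crit dh dg z <-> In z l0).
  { intro z. rewrite <- A0, HS. tauto. }
  assert (A1' : forall z, f z = w0 /\ crit dh dg z <-> In z l1).
  { intro z. rewrite <- A1, HS. tauto. }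
  set (x0 := cx u w0) in *. set (y0 := cy u w0) in *.
  destruct l1 as [|z1 l1']; [simpl in E1; lia|].
  destruct (proj2 (A1' z1) (or_introl eq_refl)) as [Ez1 Hc1].
  destruct (fold_chart_exists f h g dh dg d2h d2g u z1 1 Hh Hg Hdh Hdg
      (hol_cts _ _ H3h) (hol_cts _ _ H3g) Hf Hu ltac:(lra) Hc1 (Hfp z1 Ez1 Hc1))
      as (U1 & r1 & eps1 & sg & M1 & dM1 & HC1).
  assert (Hsg := fc_sg _ _ _ _ _ _ _ _ _ _ _ _ _ _ HC1).
  destruct (chart_agrees _ _ _ _ _ u w0 c d M z1 1 U1 r1 eps1 sg M1 dM1 Hu Ez1 HC1 Hnear)
    as (eta & [Heta _] & _ & Hdl & Hconv).
  fold x0 in Hdl, Hconv. set (l := dM1 x0) in *.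
  (* Charts of opposite sign would put the same graph strictly above and strictly below the same
     tangent line. *)
  assert (Hch : forall z r0 U r eps sg' M' dM', f z = w0 ->
      fold_chart f dh dg d2h d2g u z r0 U r eps sg' M' dM' -> sg' = sg).
  { intros z r0 U r eps sg' M' dM' Ez HC.
    destruct (chart_agrees _ _ _ _ _ u w0 c d M z r0 U r eps sg' M' dM' Hu Ez HC Hnear)
      as (eta' & [Heta' _] & _ & Hdl' & Hconv'). fold x0 in Hdl', Hconv'.
    assert (El : dM' x0 = l).
    { rewrite <- (is_derive_unique M x0 _ Hdl'). exact (is_derive_unique M x0 _ Hdl). }
    rewrite El in Hconv'.
    assert (Hm : (0 < Rmin eta eta')%R) by now apply Rmin_glb_lt.
    assert (m1 := Rmin_l eta eta'). assert (m2 := Rmin_r eta eta').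
    set (x := (x0 + Rmin eta eta' / 2)%R).
    assert (Q1 := Hconv x ltac:(unfold x; apply Rabs_def1; lra) ltac:(unfold x; lra)).
    assert (Q2 := Hconv' x ltac:(unfold x; apply Rabs_def1; lra) ltac:(unfold x; lra)).
    destruct (fc_sg _ _ _ _ _ _ _ _ _ _ _ _ _ _ HC) as [S|S]; destruct Hsg as [S'|S'];
      rewrite ?S, ?S' in *; lra. }
  assert (K2 := count_near_fold f h g dh dg d2h d2g u w0 c d M sg l0 (z1 :: l1') 2 HH Hu Hsg
    (or_intror eq_refl) Hncl L0 L1 A0' A1' Hfp Hnear Hch).
  assert (K0 := count_near_fold f h g dh dg d2h d2g u w0 c d M sg l0 (z1 :: l1') 0 HH Hu Hsg
    (or_introl eq_refl) Hncl L0 L1 A0' A1' Hfp Hnear Hch).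
  rewrite E0, E1 in K2, K0.
  (* Used with an empty excluded set: only the openness of the complement of the cluster set is
     wanted. *)
  assert (Kc : cnear w0 (fun w => ~ cluster_inf f w /\ forall z, f z = w -> ~ False)).
  { apply preimages_away; auto. intros z _. apply filter_forall. tauto. }
  destruct (cnear_box u w0 _ Hu (filter_and (F := cnear w0) _ _ Kc
     (filter_and (F := cnear w0) _ _ Hnear (filter_and (F := cnear w0) _ _ K2 K0)))) as [e [He Hbox]].
  fold x0 y0 in Hbox.
  destruct (continuity_pt_eps M x0 (HMc x0 ltac:(lra)) (e / 2)%R ltac:(lra)) as [a0 [Ha0 HMa]].
  rewrite <- Hy0 in HMa.
  (* A box so narrow that the graph over it stays within e / 2 of y0 and its abscissae remain
     between c and d. *)
  set (a := Rmin (Rmin a0 e) (Rmin (x0 - c) (d - x0))).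
  assert (Ha : (0 < a)%R) by (repeat apply Rmin_glb_lt; lra).
  assert (Haa : (a <= a0 /\ a <= e /\ a <= x0 - c /\ a <= d - x0)%R).
  { unfold a, Rmin. repeat destruct Rle_dec; lra. }
  destruct Haa as (Aa0 & Aae & Aac & Aad).
  assert (HMa' : forall x, (Rabs (x - x0) < a)%R -> (Rabs (M x - y0) < e / 2)%R)
    by (intros x Hx; apply HMa; lra).
  assert (HXs : forall s, (s = 1 \/ s = -1)%R -> forall w, (Rabs (cx u w - x0) < a)%R ->
     (Rabs (cy u w - y0) < e)%R -> (0 < s * (cy u w - M (cx u w)))%R -> X w).
  { intros s Hs w W1 W2 W3. destruct (Hbox w ltac:(lra) W2) as ([B1 _] & B2 & _).
    apply HX2; auto. intros z Ez Hc. destruct (B2 z Ez Hc) as [_ B3]. rewrite B3 in W3.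
    rewrite Rminus_diag, Rmult_0_r in W3. lra. }
  assert (Hside : forall Om, is_component X Om -> cboundary Om w0 -> exists s, (s = 1 \/ s = -1)%R /\
     forall q, (Rabs (cx u q - x0) < a)%R -> (Rabs (cy u q - y0) < e)%R ->
       (0 < s * (cy u q - M (cx u q)))%R -> Om q).
  { intros Om HC [Hcl _].
    destruct (box_cnear u w0 a Ha) as [del [Hdel Hb]]. fold x0 y0 in Hb.
    destruct (Hcl del Hdel) as (p & Hp & Hpd). destruct (Hb p Hpd) as [P1 P2].
    (* Graph points over [c, d] are critical values, so a point of the component lies strictly on
       one side. *)
    assert (Hpn : cy u p <> M (cx u p)).
    { intro E. destruct (Hac p) as (z & Z1 & Z2).
      - split; auto. apply Rabs_lt_between in P1. lra.
      - apply (HX1 p) with (z := z); auto. destruct HC as (_ & HCX & _). auto. }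
    assert (Hs : exists s, (s = 1 \/ s = -1)%R /\ (0 < s * (cy u p - M (cx u p)))%R).
    { destruct (Rtotal_order (cy u p) (M (cx u p))) as [L|[L|L]]; [|contradiction|].
      - exists (-1)%R. split; [auto|lra].
      - exists 1%R. split; [auto|lra]. }
    destruct Hs as (s & Hs & Hsp). exists s. split; auto. intros q Q1 Q2 Q3.
    apply (side_in_component X Om u M x0 y0 a e s Hu HC Hs He HMa' (HXs s Hs) p q); auto. lra. }
  assert (Hpt : forall s, (s = 1 \/ s = -1)%R -> exists q, (Rabs (cx u q - x0) < a)%R /\
     (Rabs (cy u q - y0) < e)%R /\ (0 < s * (cy u q - M (cx u q)))%R).
  { intros s Hs. exists ((x0, (y0 + s * (e / 2))%R) / u). rewrite cx_div, cy_div by auto.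
    rewrite <- Hy0. split; [|split].
    - now rewrite Rminus_diag, Rabs_R0.
    - apply Rabs_def1; destruct Hs; subst s; lra.
    - destruct Hs; subst s; lra. }
  assert (Hconst : forall Om q n, is_component X Om -> Om q -> count_eq (fun z => f z = q) n ->
     Val_on_eq f Om n).
  { intros Om q n HC Hq Hn. apply Val_on_eq_of_count; [now exists q|].
    apply (component_count_const X Om f n q HC); auto.
    - intros w m Hw Hm. exact (count_locally_constant f h g dh dg d2h d2g w m HH (HX1 w Hw) (proj2 Hw) Hm).
    - intro w. destruct (complete_preimage f w Hv) as (lw & B1 & B2).
      exists (length lw), lw. auto. }
  assert (Hval0 : forall Om, is_component X Om ->
     (forall q, (Rabs (cx u q - x0) < a)%R -> (Rabs (cy u q - y0) < e)%R ->
       (0 < - sg * (cy u q - M (cx u q)))%R -> Om q) -> Val_on_eq f Om N0).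
  { intros Om HC HO. destruct (Hpt (- sg)%R) as (q & Q1 & Q2 & Q3); [destruct Hsg; subst sg; lra|].
    apply (Hconst Om q); auto. destruct (Hbox q ltac:(lra) Q2) as (_ & _ & _ & B).
    replace (N0 + 0 * N1)%nat with N0 in B by lia. apply B. simpl. lra. }
  assert (Hval2 : forall Om, is_component X Om ->
     (forall q, (Rabs (cx u q - x0) < a)%R -> (Rabs (cy u q - y0) < e)%R ->
       (0 < sg * (cy u q - M (cx u q)))%R -> Om q) -> Val_on_eq f Om (N0 + 2 * N1)).
  { intros Om HC HO. destruct (Hpt sg Hsg) as (q & Q1 & Q2 & Q3).
    apply (Hconst Om q); auto. destruct (Hbox q ltac:(lra) Q2) as (_ & _ & B & _).
    apply B. simpl. lra. }
  set (tau := ((d - c)%R, ((d - c) * l)%R) / u).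
  assert (Htan : forall Om, (forall q, (Rabs (cx u q - x0) < a)%R -> (Rabs (cy u q - y0) < e)%R ->
       (0 < sg * (cy u q - M (cx u q)))%R -> Om q) -> tangent_side w0 tau Om).
  (* [B] bounds both coordinates of u tau, so |s| B < Rmin a eta keeps the tangent point inside the
     box, where a <= e. *)
  { intros Om HO. set (B := ((d - c) * (Rabs l + 1))%R).
    assert (Hl0 := Rabs_pos l). assert (HB : (0 < B)%R) by (apply Rmult_lt_0_compat; lra).
    assert (Hae : (0 < Rmin a eta)%R) by now apply Rmin_glb_lt.
    assert (m1 := Rmin_l a eta). assert (m2 := Rmin_r a eta).
    exists (Rmin a eta / B)%R. split; [now apply Rdiv_lt_0_compat|].
    intros s Hs. rewrite scal_RtoC.
    assert (Sx : cx u (w0 + RtoC s * tau) = (x0 + s * (d - c))%R).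
    { transitivity (cx u w0 + s * cx u tau)%R; [unfold cx; simpl; ring|].
      unfold tau. now rewrite cx_div. }
    assert (Sy : cy u (w0 + RtoC s * tau) = (y0 + s * ((d - c) * l))%R).
    { transitivity (cy u w0 + s * cy u tau)%R; [unfold cy; simpl; ring|].
      unfold tau. now rewrite cy_div. }
    assert (HsB : (Rabs s * B < Rmin a eta)%R).
    { apply Rmult_lt_reg_r with (/ B)%R; [now apply Rinv_0_lt_compat|].
      rewrite Rmult_assoc, Rinv_r by lra. unfold Rdiv in Hs. lra. }
    assert (Hsx : (Rabs (s * (d - c)) < Rmin a eta)%R).
    { rewrite Rabs_mult, (Rabs_pos_eq (d - c)) by lra. unfold B in HsB.
      assert (0 <= Rabs s * (d - c) * Rabs l)%R by (repeat apply Rmult_le_pos; try apply Rabs_pos; lra). lra. }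
    assert (Hsy : (Rabs (s * ((d - c) * l)) < Rmin a eta)%R).
    { rewrite !Rabs_mult, (Rabs_pos_eq (d - c)) by lra. unfold B in HsB.
      assert (0 <= Rabs s * (d - c))%R by (apply Rmult_le_pos; [apply Rabs_pos|lra]). lra. }
    assert (Hsn : s <> 0%R) by (intro Z; subst s; rewrite Rabs_R0 in Hs; lra).
    apply HO; rewrite ?Sx, ?Sy.
    - replace (x0 + s * (d - c) - x0)%R with (s * (d - c))%R by ring. lra.
    - replace (y0 + s * ((d - c) * l) - y0)%R with (s * ((d - c) * l))%R by ring. lra.
    (* Strict convexity, read at the abscissa of the tangent point: sg M is smaller there than sg
       times the ordinate of the tangent. *)
    - assert (Q := Hconv (x0 + s * (d - c))%R). rewrite <- Hy0 in Q.
      replace (x0 + s * (d - c) - x0)%R with (s * (d - c))%R in Q by ring.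
      specialize (Q ltac:(lra)). assert (Hne : (x0 + s * (d - c))%R <> x0).
      { intro Z. assert (Z' : (s * (d - c) = 0)%R) by lra. apply Rmult_integral in Z'.
        destruct Z'; [contradiction|lra]. }
      specialize (Q Hne). lra. }
  exists tau. split.
  { apply graph_arc_tangent; auto. }
  destruct (Hside Omp HCp Hbp) as (sp & Hsp & HOp). destruct (Hside Omm HCm Hbm) as (sm & Hsm & HOm).
  assert (Hopp : sm = (- sp)%R).
  { destruct (Req_dec sm sp) as [E|E].
    - exfalso. apply Hdist. subst sm. destruct (Hpt sp Hsp) as (q & Q1 & Q2 & Q3).
      apply (component_eq X Omp Omm q); auto.
    - destruct Hsp, Hsm; subst; lra. }
  destruct (Req_dec sp sg) as [E|E].
  - left. subst sp sm. split; [now apply Htan|]. split; [now apply Hval0|now apply Hval2].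
  - assert (sp = (- sg)%R) by (destruct Hsp, Hsg; subst; lra).
    assert (sm = sg) by lra. right. subst sp. rewrite H0 in HOm. split; [now apply Htan|].
    split; [now apply Hval0|now apply Hval2].
Qed.

Theorem theorem6p7
  (f h g dh dg : C -> C)
  (Hh : entire_with h dh) (Hg : entire_with g dg)
  (Hf : forall z, f z = h z + Cconj (g z))
  (Hval : finite_valence f)
  (Omp Omm beta0 : C -> Prop)
  (Hcp : is_component
           (fun w => ~ image f (Sset f) w /\ ~ cluster_inf f w) Omp)
  (Hcm : is_component
           (fun w => ~ image f (Sset f) w /\ ~ cluster_inf f w) Omm)
  (Hdist : ~ (forall w, Omp w <-> Omm w))
  (Harc : is_arc beta0) (Hnd : nondegenerate beta0)
  (Hbdp : forall w, beta0 w -> cboundary Omp w)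
  (Hbdm : forall w, beta0 w -> cboundary Omm w)
  (Hint : exists w, arc_int beta0 w /\ ~ cluster_inf f w) :
  exists beta : C -> Prop,
    is_arc beta /\ nondegenerate beta /\ (forall w, beta w -> beta0 w) /\
    (forall w, beta w -> ~ cluster_inf f w) /\
    (forall z, beta (f z) -> ~ (Fset f dh dg z \/ Nset f dh dg z)) /\
    forall (w0 : C) (N0 N1 : nat),
      arc_int beta w0 ->
      count_eq (fun z => f z = w0 /\ ~ Sset f z) N0 ->
      count_eq (fun z => f z = w0 /\ Sset f z) N1 ->
      (0 < N1)%nat ->
      exists tau, tangent_dir beta w0 tau /\
        ((tangent_side w0 tau Omp /\
          Val_on_eq f Omm N0 /\ Val_on_eq f Omp (N0 + 2 * N1)) \/
         (tangent_side w0 tau Omm /\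
          Val_on_eq f Omp N0 /\ Val_on_eq f Omm (N0 + 2 * N1))).
Proof.
  assert (Hhol : hol h dh) by (intro z; apply cderiv_cdiff, Hh).
  assert (Hgol : hol g dg) by (intro z; apply cderiv_cdiff, Hg).
  destruct (hol_derivative _ _ Hhol) as [d2h Hd2h]. destruct (hol_derivative _ _ Hgol) as [d2g Hd2g].
  assert (HH : harmonic f h g dh dg d2h d2g) by (constructor; auto).
  set (X := fun w => ~ image f (Sset f) w /\ ~ cluster_inf f w) in *.
  assert (HS : forall z, Sset f z <-> crit dh dg z) by (intro z; exact (Sset_iff f h g dh dg z Hhol Hgol Hf)).
  assert (HX2 : forall w, (forall z, f z = w -> ~ crit dh dg z) -> ~ cluster_inf f w -> X w).
  { intros w H1 H2. split; auto. intros [z [Z1 Z2]]. apply (H1 z Z2). now apply HS. }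
  destruct Hint as (w & (gam0 & Hgam0 & ts & Hts & Ets) & Hncl).
  destruct (arc_clamp _ _ Hgam0) as [Hgc Hgcl].
  set (gam := fun t => gam0 (clamp t)) in *.
  destruct Hgam0 as (_ & Hinj0 & Hb0).
  assert (Hgw : gam ts = w) by (rewrite <- Ets; apply Hgcl; lra).
  destruct (proper_off_cluster f w Hncl) as (r & del & Hdel & Hr).
  (* On this parameter interval the arc avoids the cluster set and all preimages of its points lie
     in one disc of radius [r]. *)
  destruct (near_subinterval gam (fun v => (Cmod (v - w) < del)%R) 0 1 ts Hgc Hts) as
    (a & b & Ha & Hb & Hab).
  { rewrite Hgw. now apply cnear_ball. }
  assert (Hinj : forall s t, (a <= s <= b)%R -> (a <= t <= b)%R -> gam s = gam t -> s = t).
  { intros s t Hs Ht E. unfold gam in E. rewrite !Hgcl in E by lra. apply Hinj0; auto; lra. }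
  assert (Hbeta : forall t, (a <= t <= b)%R -> beta0 (gam t)).
  { intros t Ht. apply Hb0. exists t. split; [lra|]. symmetry. apply Hgcl. lra. }
  assert (Hcl : forall t, (a <= t <= b)%R -> ~ cluster_inf f (gam t)).
  { intros t Ht. apply (proper_not_cluster f w r del); auto. }
  assert (Hbound : forall t z, (a <= t <= b)%R -> f z = gam t -> (Cmod z <= r)%R).
  { intros t z Ht E. apply Hr. rewrite E. now apply Hab. }
  assert (Hcv : forall t, (a <= t <= b)%R -> exists z, f z = gam t /\ crit dh dg z).
  { intros t Ht. apply (critical_value_exists f h g dh dg d2h d2g X Omp); auto. }
  destruct (generic_fold_parameter f h g dh dg d2h d2g gam r a b HH Hval Hgc ltac:(lra) Hinj Hcl Hbound)
    as (u & t0 & Hu & Ht0 & Hfold).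
  destruct (fold_arc f h g dh dg d2h d2g gam u a b t0 HH Hval Hgc Ht0 Hinj Hu (Hcl t0 ltac:(lra)) Hfold Hcv)
    as (c & d & M & Hcd & HMc & Harcp & Harcn).
  assert (HG : forall v, graph_arc u c d M v -> (exists t, (a <= t <= b)%R /\ v = gam t) /\
     ~ cluster_inf f v /\ forall z, f z = v -> crit dh dg z -> fold_point u dh dg d2h d2g z).
  { intros v [V1 V2]. now apply Harcp. }
  assert (Hin0 : forall v, graph_arc u c d M v -> beta0 v).
  { intros v Hv. destruct (HG v Hv) as ((t & T1 & T2) & _). rewrite T2. now apply Hbeta. }
  exists (graph_arc u c d M). split; [|split; [|split; [|split; [|split]]]].
  - exists (graph_param u c d M). now apply graph_arc_param.
  - exists ((c, M c) / u), ((d, M d) / u). unfold graph_arc. rewrite !cx_div, !cy_div by auto.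
    split; [lra|]. split; [lra|]. intro E. apply (f_equal (cx u)) in E. rewrite !cx_div in E by auto. lra.
  - exact Hin0.
  - intros v Hv. apply (HG v Hv).
  - intros z Hz. destruct (classic (crit dh dg z)) as [Hc|Hc].
    + apply (fold_not_exceptional f h g dh dg d2h d2g u z); auto.
      destruct (HG _ Hz) as (_ & _ & X2). now apply X2.
    (* All the exceptional sets are contained in S, so a noncritical preimage belongs to none of
       them. *)
    + intro HFN. apply Hc, HS.
      destruct HFN as [[H1|[H1|H1]]|H1]; apply H1.
  - intros w0 N0 N1 Hi HN0 HN1 HN1p.
    destruct (graph_arc_int u c d M w0 Hu Hi) as [Hx Hy].
    assert (Hw0 : graph_arc u c d M w0) by (split; [lra|auto]).
    destruct (HG w0 Hw0) as (_ & Hncl0 & Hfp0).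
    apply (valence_across_arc f h g dh dg d2h d2g Omp Omm u w0 c d M N0 N1); auto.
    intros v Hv. destruct (HG v Hv) as ((t & T1 & T2) & _). rewrite T2. now apply Hcv.
Qed.
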